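(* Up to isomorphism there are $59$ complex Jordan superalgebras of type $(3,1)$. With even basis $e_1,e_2,e_3$ and odd basis vector $f$, they are listed below; in square brackets are given the orbit dimension and the decomposition into indecomposables (''Indec.'' means indecomposable): $\mathfrak J_{1}$ [$15$; $\mathcal U_1\oplus\mathcal U_1\oplus\mathcal U_1\oplus\mathcal S_1^1$]: $e_1^2=e_1,\ e_2^2=e_2,\ e_3^2=e_3$; $\mathfrak J_{2}$ [$14$; $\mathcal S_2^2\oplus\mathcal U_1\oplus\mathcal U_1$]: $e_1^2=e_1,\ e_2^2=e_2,\ e_3^2=e_3,\ e_1f=f$; $\mathfrak J_{3}$ [$14$; $\mathcal S_1^2\oplus\mathcal U_1\oplus\mathcal U_1$]: $e_1^2=e_1,\ e_2^2=e_2,\ e_3^2=e_3,\ e_1f=\frac12f$; $\mathfrak J_{4}$ [$14$; $\mathcal S_{13}^3\oplus\mathcal U_1$]: $e_1^2=e_1,\ e_2^2=e_2,\ e_3^2=e_3,\ e_1f=\frac12f,\ e_2f=\frac12f$; $\mathfrak J_{5}$ [$12$; $\mathcal U_1\oplus\mathcal U_1\oplus\mathcal U_2\oplus\mathcal S_1^1$]: $e_1^2=e_1,\ e_2^2=e_2$; $\mathfrak J_{6}$ [$13$; $\mathcal S_2^2\oplus\mathcal U_1\oplus\mathcal U_2$]: $e_1^2=e_1,\ e_2^2=e_2,\ e_1f=f$; $\mathfrak J_{7}$ [$13$; $\mathcal S_1^2\oplus\mathcal U_1\oplus\mathcal U_2$]: $e_1^2=e_1,\ e_2^2=e_2,\ e_1f=\frac12f$;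 $\mathfrak J_{8}$ [$13$; $\mathcal S_{13}^3\oplus\mathcal U_2$]: $e_1^2=e_1,\ e_2^2=e_2,\ e_1f=\frac12f,\ e_2f=\frac12f$; $\mathfrak J_{9}$ [$7$; $\mathcal U_1\oplus\mathcal U_2\oplus\mathcal U_2\oplus\mathcal S_1^1$]: $e_1^2=e_1$; $\mathfrak J_{10}$ [$10$; $\mathcal S_2^2\oplus\mathcal U_2\oplus\mathcal U_2$]: $e_1^2=e_1,\ e_1f=f$; $\mathfrak J_{11}$ [$11$; $\mathcal S_1^2\oplus\mathcal U_2\oplus\mathcal U_2$]: $e_1^2=e_1,\ e_1f=\frac12f$; $\mathfrak J_{12}$ [$14$; $\mathcal B_1\oplus\mathcal U_1\oplus\mathcal S_1^1$]: $e_1^2=e_1,\ e_1e_2=e_2,\ e_3^2=e_3$; $\mathfrak J_{13}$ [$13$; $\mathcal B_1\oplus\mathcal S_2^2$]: $e_1^2=e_1,\ e_1e_2=e_2,\ e_3^2=e_3,\ e_3f=f$; $\mathfrak J_{14}$ [$13$; $\mathcal B_1\oplus\mathcal S_1^2$]: $e_1^2=e_1,\ e_1e_2=e_2,\ e_3^2=e_3,\ e_3f=\frac12f$; $\mathfrak J_{15}$ [$12$; $\mathcal S_{10}^3\oplus\mathcal U_1$]: $e_1^2=e_1,\ e_1e_2=e_2,\ e_3^2=e_3,\ e_1f=f$; $\mathfrak J_{16}$ [$13$; $\mathcal S_9^3\oplus\mathcal U_1$]: $e_1^2=e_1,\ e_1e_2=e_2,\ e_3^2=e_3,\ e_1f=\frac12f$;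 $\mathfrak J_{17}$ [$13$; Indec.]: $e_1^2=e_1,\ e_1e_2=e_2,\ e_3^2=e_3,\ e_1f=\frac12f,\ e_3f=\frac12f$; $\mathfrak J_{18}$ [$11$; $\mathcal B_1\oplus\mathcal U_2\oplus\mathcal S_1^1$]: $e_1^2=e_1,\ e_1e_2=e_2$; $\mathfrak J_{19}$ [$11$; $\mathcal S_{10}^3\oplus\mathcal U_2$]: $e_1^2=e_1,\ e_1e_2=e_2,\ e_1f=f$; $\mathfrak J_{20}$ [$12$; $\mathcal S_9^3\oplus\mathcal U_2$]: $e_1^2=e_1,\ e_1e_2=e_2,\ e_1f=\frac12f$; $\mathfrak J_{21}$ [$13$; $\mathcal B_2\oplus\mathcal U_1\oplus\mathcal S_1^1$]: $e_1^2=e_1,\ e_1e_2=\frac12e_2,\ e_3^2=e_3$; $\mathfrak J_{22}$ [$12$; $\mathcal B_2\oplus\mathcal S_2^2$]: $e_1^2=e_1,\ e_1e_2=\frac12e_2,\ e_3^2=e_3,\ e_3f=f$; $\mathfrak J_{23}$ [$12$; $\mathcal B_2\oplus\mathcal S_1^2$]: $e_1^2=e_1,\ e_1e_2=\frac12e_2,\ e_3^2=e_3,\ e_3f=\frac12f$; $\mathfrak J_{24}$ [$13$; $\mathcal S_{12}^3\oplus\mathcal U_1$]: $e_1^2=e_1,\ e_1e_2=\frac12e_2,\ e_3^2=e_3,\ e_1f=f$; $\mathfrak J_{25}$ [$10$; $\mathcal S_{11}^3\oplus\mathcal U_1$]: $e_1^2=e_1,\ e_1e_2=\frac12e_2,\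 e_3^2=e_3,\ e_1f=\frac12f$; $\mathfrak J_{26}$ [$12$; Indec.]: $e_1^2=e_1,\ e_1e_2=\frac12e_2,\ e_3^2=e_3,\ e_1f=\frac12f,\ e_3f=\frac12f$; $\mathfrak J_{27}$ [$10$; $\mathcal B_2\oplus\mathcal U_2\oplus\mathcal S_1^1$]: $e_1^2=e_1,\ e_1e_2=\frac12e_2$; $\mathfrak J_{28}$ [$12$; $\mathcal S_{12}^3\oplus\mathcal U_2$]: $e_1^2=e_1,\ e_1e_2=\frac12e_2,\ e_1f=f$; $\mathfrak J_{29}$ [$9$; $\mathcal S_{11}^3\oplus\mathcal U_2$]: $e_1^2=e_1,\ e_1e_2=\frac12e_2,\ e_1f=\frac12f$; $\mathfrak J_{30}$ [$11$; $\mathcal B_3\oplus\mathcal U_1\oplus\mathcal S_1^1$]: $e_1^2=e_2,\ e_3^2=e_3$; $\mathfrak J_{31}$ [$12$; $\mathcal B_3\oplus\mathcal S_2^2$]: $e_1^2=e_2,\ e_3^2=e_3,\ e_3f=f$; $\mathfrak J_{32}$ [$12$; $\mathcal B_3\oplus\mathcal S_1^2$]: $e_1^2=e_2,\ e_3^2=e_3,\ e_3f=\frac12f$; $\mathfrak J_{33}$ [$6$; $\mathcal B_3\oplus\mathcal U_2\oplus\mathcal S_1^1$]: $e_1^2=e_2$; $\mathfrak J_{34}$ [$13$; $\mathcal T_1\oplus\mathcal S_1^1$]: $e_1^2=e_1,\ e_1e_2=e_2,\ e_1e_3=e_3,\ e_2^2=e_3$; $\mathfrak J_{35}$ [$11$;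 Indec.]: $e_1^2=e_1,\ e_1e_2=e_2,\ e_1e_3=e_3,\ e_2^2=e_3,\ e_1f=f$; $\mathfrak J_{36}$ [$12$; Indec.]: $e_1^2=e_1,\ e_1e_2=e_2,\ e_1e_3=e_3,\ e_2^2=e_3,\ e_1f=\frac12f$; $\mathfrak J_{37}$ [$11$; $\mathcal T_2\oplus\mathcal S_1^1$]: $e_1^2=e_1,\ e_1e_2=e_2,\ e_1e_3=e_3$; $\mathfrak J_{38}$ [$7$; Indec.]: $e_1^2=e_1,\ e_1e_2=e_2,\ e_1e_3=e_3,\ e_1f=f$; $\mathfrak J_{39}$ [$10$; Indec.]: $e_1^2=e_1,\ e_1e_2=e_2,\ e_1e_3=e_3,\ e_1f=\frac12f$; $\mathfrak J_{40}$ [$10$; $\mathcal T_3\oplus\mathcal S_1^1$]: $e_1^2=e_2,\ e_1e_2=e_3$; $\mathfrak J_{41}$ [$8$; $\mathcal T_4\oplus\mathcal S_1^1$]: $e_1^2=e_2,\ e_1e_3=e_2$; $\mathfrak J_{42}$ [$14$; $\mathcal T_5\oplus\mathcal S_1^1$]: $e_1^2=e_1,\ e_2^2=e_2,\ e_3^2=e_1+e_2,\ e_1e_3=\frac12e_3,\ e_2e_3=\frac12e_3$; $\mathfrak J_{43}$ [$12$; Indec.]: $e_1^2=e_1,\ e_2^2=e_2,\ e_3^2=e_1+e_2,\ e_1e_3=\frac12e_3,\ e_2e_3=\frac12e_3,\ e_1f=\frac12f,\ e_2f=\frac12f$; $\mathfrak J_{44}$ [$12$; $\mathcal T_6\oplus\mathcal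 S_1^1$]: $e_1^2=e_1,\ e_1e_2=\frac12e_2,\ e_1e_3=e_3$; $\mathfrak J_{45}$ [$10$; Indec.]: $e_1^2=e_1,\ e_1e_2=\frac12e_2,\ e_1e_3=e_3,\ e_1f=f$; $\mathfrak J_{46}$ [$9$; Indec.]: $e_1^2=e_1,\ e_1e_2=\frac12e_2,\ e_1e_3=e_3,\ e_1f=\frac12f$; $\mathfrak J_{47}$ [$9$; $\mathcal T_7\oplus\mathcal S_1^1$]: $e_1^2=e_1,\ e_1e_2=\frac12e_2,\ e_1e_3=\frac12e_3$; $\mathfrak J_{48}$ [$9$; Indec.]: $e_1^2=e_1,\ e_1e_2=\frac12e_2,\ e_1e_3=\frac12e_3,\ e_1f=f$; $\mathfrak J_{49}$ [$4$; Indec.]: $e_1^2=e_1,\ e_1e_2=\frac12e_2,\ e_1e_3=\frac12e_3,\ e_1f=\frac12f$; $\mathfrak J_{50}$ [$12$; $\mathcal T_8\oplus\mathcal S_1^1$]: $e_1^2=e_1,\ e_1e_2=\frac12e_2,\ e_2^2=e_3$; $\mathfrak J_{51}$ [$13$; Indec.]: $e_1^2=e_1,\ e_1e_2=\frac12e_2,\ e_2^2=e_3,\ e_1f=f$; $\mathfrak J_{52}$ [$11$; Indec.]: $e_1^2=e_1,\ e_1e_2=\frac12e_2,\ e_2^2=e_3,\ e_1f=\frac12f$; $\mathfrak J_{53}$ [$13$; $\mathcal T_9\oplus\mathcal S_1^1$]: $e_1^2=e_1,\ e_1e_2=\frac12e_2,\ e_2^2=e_3,\ e_1e_3=e_3$;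 $\mathfrak J_{54}$ [$12$; Indec.]: $e_1^2=e_1,\ e_1e_2=\frac12e_2,\ e_2^2=e_3,\ e_1e_3=e_3,\ e_1f=f$; $\mathfrak J_{55}$ [$11$; Indec.]: $e_1^2=e_1,\ e_1e_2=\frac12e_2,\ e_2^2=e_3,\ e_1e_3=e_3,\ e_1f=\frac12f$; $\mathfrak J_{56}$ [$13$; $\mathcal T_{10}\oplus\mathcal S_1^1$]: $e_1^2=e_1,\ e_2^2=e_2,\ e_1e_3=\frac12e_3,\ e_2e_3=\frac12e_3$; $\mathfrak J_{57}$ [$13$; Indec.]: $e_1^2=e_1,\ e_2^2=e_2,\ e_1e_3=\frac12e_3,\ e_2e_3=\frac12e_3,\ e_1f=f$; $\mathfrak J_{58}$ [$12$; Indec.]: $e_1^2=e_1,\ e_2^2=e_2,\ e_1e_3=\frac12e_3,\ e_2e_3=\frac12e_3,\ e_1f=\frac12f$; $\mathfrak J_{59}$ [$10$; Indec.]: $e_1^2=e_1,\ e_2^2=e_2,\ e_1e_3=\frac12e_3,\ e_2e_3=\frac12e_3,\ e_1f=\frac12f,\ e_2f=\frac12f$.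
   Context: All vector spaces are over $\mathbb C$. A superalgebra is a $\mathbb Z_2$-graded algebra $A=A_0\oplus A_1$ with $A_iA_j\subseteq A_{i+j}$; its type is $(\dim A_0,\dim A_1)$; $|x|=i$ for $x\in A_i$. It is a Jordan superalgebra if for all homogeneous $x,y,z,t$: $xy=(-1)^{|x||y|}yx$ and $$((xy)z)t+(-1)^{|y||z|+|y||t|+|z||t|}((xt)z)y+(-1)^{|x||y|+|x||z|+|x||t|+|z||t|}((yt)z)x=(xy)(zt)+(-1)^{|t|(|y|+|z|)}(xt)(yz)+(-1)^{|y||z|}(xz)(yt).$$ Isomorphisms are grading-preserving algebra isomorphisms. Multiplication tables list only nonzero products of basis vectors, up to supercommutativity ($e_ie_j=e_je_i$, $e_if=fe_i$, $f^2=0$); all unlisted products are zero. The orbit dimension is calculated by the formula $\dim O=n^2-\dim\mathrm{Der}(A)$, where $n=4$ is the dimension of the superalgebra and $\mathrm{Der}(A)$ is the Lie algebra of derivations, spanned by the homogeneous linear maps $D$ (with $|D|=0$ if $D$ preserves the grading and $|D|=1$ otherwise) satisfying $D(xy)=D(x)y+(-1)^{|D||x|}xD(y)$. The summands in the decompositions are the following indecomposable (super)algebras, with $e,e_1,e_2,e_3$ even and $f$ odd. One-dimensional: $\mathcal U_1$: $e^2=e$; $\mathcal U_2$: $e^2=0$; $\mathcal S_1^1$: $f^2=0$. Basis $e_1,e_2$: $\mathcal B_1$: $e_1^2=e_1,\ e_1e_2=e_2$; $\mathcal B_2$: $e_1^2=e_1,\ e_1e_2=\frac12e_2$; $\mathcal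 B_3$: $e_1^2=e_2$. Basis $e,f$: $\mathcal S_1^2$: $e^2=e,\ ef=\frac12f$; $\mathcal S_2^2$: $e^2=e,\ ef=f$. Basis $e_1,e_2,f$: $\mathcal S_9^3$: $e_1^2=e_1,\ e_1e_2=e_2,\ e_1f=\frac12f$; $\mathcal S_{10}^3$: $e_1^2=e_1,\ e_1e_2=e_2,\ e_1f=f$; $\mathcal S_{11}^3$: $e_1^2=e_1,\ e_1e_2=\frac12e_2,\ e_1f=\frac12f$; $\mathcal S_{12}^3$: $e_1^2=e_1,\ e_1e_2=\frac12e_2,\ e_1f=f$; $\mathcal S_{13}^3$: $e_1^2=e_1,\ e_2^2=e_2,\ e_1f=\frac12f,\ e_2f=\frac12f$. Basis $e_1,e_2,e_3$: $\mathcal T_1$: $e_1^2=e_1,\ e_2^2=e_3,\ e_1e_2=e_2,\ e_1e_3=e_3$; $\mathcal T_2$: $e_1^2=e_1,\ e_1e_2=e_2,\ e_1e_3=e_3$; $\mathcal T_3$: $e_1^2=e_2,\ e_1e_2=e_3$; $\mathcal T_4$: $e_1^2=e_2,\ e_1e_3=e_2$; $\mathcal T_5$: $e_1^2=e_1,\ e_2^2=e_2,\ e_3^2=e_1+e_2,\ e_1e_3=\frac12e_3,\ e_2e_3=\frac12e_3$; $\mathcal T_6$: $e_1^2=e_1,\ e_1e_2=\frac12e_2,\ e_1e_3=e_3$; $\mathcal T_7$: $e_1^2=e_1,\ e_1e_2=\frac12e_2,\ e_1e_3=\frac12e_3$; $\mathcal T_8$: $e_1^2=e_1,\ e_2^2=e_3,\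 e_1e_2=\frac12e_2$; $\mathcal T_9$: $e_1^2=e_1,\ e_2^2=e_3,\ e_1e_2=\frac12e_2,\ e_1e_3=e_3$; $\mathcal T_{10}$: $e_1^2=e_1,\ e_2^2=e_2,\ e_1e_3=\frac12e_3,\ e_2e_3=\frac12e_3$.
   Formalization: The superalgebra with all products zero, which is Jordan of type (3,1) but not in the list, is excluded from the 59; and the orbit dimension of J_11 is 10 instead of the printed 11, since dim Der(J_11)=6 and 16-6=10. *)

(* Defs.v *)
From mathcomp Require Import all_boot all_order all_algebra.
From mathcomp Require Import reals.
From mathcomp Require Import complex.

Set Implicit Arguments.
Unset Strict Implicit.
Unset Printing Implicit Defensive.

Import GRing.Theory.
Local Open Scope ring_scope.

(* [false] is the even degree, [true] the odd one, and [addb] is addition in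
   Z/2. *)
Record superalgebra (K : fieldType) := Superalgebra {
  carrier :> vectType K;
  part : bool -> {vspace carrier};
  smul : carrier -> carrier -> carrier;
  smul_bilinear : bilinear_for *:%R *:%R smul;
  part_direct : directv (part false + part true)%VS;
  part_full : (part false + part true)%VS = fullv;
  smul_part : forall i j x y,
    x \in part i -> y \in part j -> smul x y \in part (i (+) j)
}.

Arguments part {K} s i.
Arguments smul {K} s x y.

Notation "x ** y" := (smul _ x y) (at level 40, left associativity).

Section Notions.
Variable K : fieldType.
Implicit Types A B : superalgebra K.

Definition has_type A (m n : nat) :=
  \dim (part A false) = m /\ \dim (part A true) = n.

Definition supercommutative A :=
  forall i j (x y : A), x \in part A i -> y \in part A j ->
    x ** y = (-1) ^+ (i * j) *: (y ** x).

Definition jordan_identity A :=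
  forall i j k l (x y z t : A),
    x \in part A i -> y \in part A j -> z \in part A k -> t \in part A l ->
    ((x ** y) ** z) ** t
      + (-1) ^+ (j * k + j * l + k * l) *: (((x ** t) ** z) ** y)
      + (-1) ^+ (i * j + i * k + i * l + k * l) *: (((y ** t) ** z) ** x)
    = (x ** y) ** (z ** t)
      + (-1) ^+ (l * (j + k)) *: ((x ** t) ** (y ** z))
      + (-1) ^+ (j * k) *: ((x ** z) ** (y ** t)).

Definition jordan_superalgebra A := supercommutative A /\ jordan_identity A.

(* The superalgebra with zero product is trivially Jordan and is not counted
   among the 59 algebras of [rows] below. *)
Definition zero_product A := forall x y : A, x ** y = 0.

Definition isomorphic A B :=
  exists phi : 'Hom(A, B),
    [/\ bijective phi,
        forall x y, phi (x ** y) = phi x ** phi y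
      & forall i x, x \in part A i -> phi x \in part B i].

Definition homogeneous_derivation A (d : bool) (D : 'End(A)) :=
  (forall i x, x \in part A i -> D x \in part A (d (+) i)) /\
  (forall i x y, x \in part A i ->
     D (x ** y) = D x ** y + (-1) ^+ (d * i) *: (x ** D y)).

Definition is_Der A (U : {vspace 'End(A)}) :=
  (forall d D, homogeneous_derivation d D -> D \in U) /\
  (forall V : {vspace 'End(A)},
     (forall d D, homogeneous_derivation d D -> D \in V) -> (U <= V)%VS).

(* The subtraction is never truncated: [\dim U <= \dim {:A} ^ 2]. *)
Definition has_orbit_dim A (d : nat) :=
  exists2 U : {vspace 'End(A)}, is_Der U & d = (\dim {:A} ^ 2 - \dim U)%N.

End Notions.

Section PairSpace.
Variables (K : fieldType) (V W : vectType K).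

(* The subspace of the pairs [(x, y)] with [x \in X] and [y \in Y]. *)
Definition pairv (X : {vspace V}) (Y : {vspace W}) : {vspace (V * W)%type} :=
  (linfun (@fst V W) @^-1: X :&: linfun (@snd V W) @^-1: Y)%VS.

Lemma mem_pairv X Y u : (u \in pairv X Y) = (u.1 \in X) && (u.2 \in Y).
Proof. by rewrite memv_cap -!memv_preim !lfunE. Qed.

End PairSpace.

Section DirectSum.
Variables (K : fieldType) (A B : superalgebra K).

Definition dsum_mul (u v : A * B) : A * B := (u.1 ** v.1, u.2 ** v.2).
Definition dsum_part i := pairv (part A i) (part B i).

Fact dsum_bilinear : bilinear_for *:%R *:%R dsum_mul.
Proof.
have [Al Ar] := smul_bilinear A; have [Bl Br] := smul_bilinear B.
split=> [v a x y | u a x y]; rewrite /dsum_mul /=.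
  by have /= -> := Al v.1 a x.1 y.1; have /= -> := Bl v.2 a x.2 y.2.
by have /= -> := Ar u.1 a x.1 y.1; have /= -> := Br u.2 a x.2 y.2.
Qed.

Fact dsum_direct : directv (dsum_part false + dsum_part true)%VS.
Proof.
apply/directv_addP/eqP; rewrite -subv0; apply/subvP=> u.
rewrite memv_cap !mem_pairv => /andP[/andP[a0 b0] /andP[a1 b1]].
have /directv_addP dA := part_direct A; have /directv_addP dB := part_direct B.
have: u.1 \in (part A false :&: part A true)%VS by rewrite memv_cap a0.
have: u.2 \in (part B false :&: part B true)%VS by rewrite memv_cap b0.
by rewrite dA dB !memv0; case: u {a0 b0 a1 b1} => x y /= /eqP -> /eqP ->.
Qed.

Fact dsum_full : (dsum_part false + dsum_part true)%VS = fullv.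
Proof.
apply/eqP; rewrite eqEsubv subvf; apply/subvP=> -[x y] _.
have: x \in (part A false + part A true)%VS by rewrite part_full memvf.
case/memv_addP=> x0 x0P [x1 x1P ->].
have: y \in (part B false + part B true)%VS by rewrite part_full memvf.
case/memv_addP=> y0 y0P [y1 y1P ->].
apply/memv_addP; exists (x0, y0); first by rewrite mem_pairv /= x0P.
by exists (x1, y1); first by rewrite mem_pairv /= x1P.
Qed.

Fact dsum_mul_part i j u v :
  u \in dsum_part i -> v \in dsum_part j -> dsum_mul u v \in dsum_part (i (+) j).
Proof.
rewrite !mem_pairv => /andP[ui1 ui2] /andP[vj1 vj2] /=.
by rewrite !smul_part.
Qed.

Definition dsum : superalgebra K :=
  Superalgebra dsum_bilinear dsum_direct dsum_full dsum_mul_part.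

End DirectSum.

Definition indecomposable (K : fieldType) (A : superalgebra K) :=
  \dim {:A} <> 0%N /\
  forall B C : superalgebra K, isomorphic A (dsum B C) ->
    \dim {:B} = 0%N \/ \dim {:C} = 0%N.

(* A multiplication table in [n0] even and [n1] odd basis vectors.  An entry
   [(a, b, c, k)] says that [c] times the [k]-th basis vector is a term of the
   product of the [a]-th and the [b]-th ones, in either order.  In [tab0] all
   three basis vectors are even; in [tab1] the first is even, the other two are
   odd.  Products of two odd basis vectors are zero. *)
Record table (K : fieldType) := Table {
  n0 : nat;
  n1 : nat;
  tab0 : seq ('I_n0 * 'I_n0 * K * 'I_n0);
  tab1 : seq ('I_n0 * 'I_n1 * K * 'I_n1)
}.

Arguments Table {K} n0 n1 tab0 tab1.

Section TableAlgebra.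
Variables (K : fieldType) (t : table K).
Notation E := 'rV[K]_(n0 t).
Notation F := 'rV[K]_(n1 t).

Definition mul00 (x y : E) : E :=
  \sum_(p <- tab0 t) let: (a, b, c, k) := p in
    (c * (if a == b then x 0 a * y 0 a else x 0 a * y 0 b + x 0 b * y 0 a))
      *: delta_mx 0 k.

Definition mul01 (x : E) (y : F) : F :=
  \sum_(p <- tab1 t) let: (a, b, c, k) := p in
    (c * (x 0 a * y 0 b)) *: delta_mx 0 k.

Definition table_mul (u v : E * F) : E * F :=
  (mul00 u.1 v.1, mul01 u.1 v.2 + mul01 v.1 u.2).

Definition table_part (i : bool) : {vspace (E * F)%type} :=
  if i then pairv 0%VS fullv else pairv fullv 0%VS.

Fact mul00C x y : mul00 x y = mul00 y x.
Proof.
apply: eq_bigr => -[[[a b] c] k] _ /=; congr ((_ * _) *: _).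
case: ifP => _; first exact: mulrC.
by rewrite addrC mulrC [x 0 a * _]mulrC.
Qed.

Fact mul00_linear y a x x' : mul00 (a *: x + x') y = a *: mul00 x y + mul00 x' y.
Proof.
rewrite scaler_sumr -big_split; apply: eq_bigr => -[[[p q] c] k] _ /=.
rewrite !mxE scalerA -scalerDl; congr (_ *: _).
case: ifP => _; rewrite !mulrDl ?mulrDr -!mulrA !(mulrCA a) //.
by rewrite -!addrA; congr (_ + _); rewrite addrCA.
Qed.

Fact mul01_linear_l y a x x' : mul01 (a *: x + x') y = a *: mul01 x y + mul01 x' y.
Proof.
rewrite scaler_sumr -big_split; apply: eq_bigr => -[[[p q] c] k] _ /=.
rewrite !mxE scalerA -scalerDl; congr (_ *: _).
by rewrite !mulrDl mulrDr -!mulrA !(mulrCA a).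
Qed.

Fact mul01_linear_r x a y y' : mul01 x (a *: y + y') = a *: mul01 x y + mul01 x y'.
Proof.
rewrite scaler_sumr -big_split; apply: eq_bigr => -[[[p q] c] k] _ /=.
rewrite !mxE scalerA -scalerDl; congr (_ *: _).
by rewrite !mulrDr !(mulrCA a).
Qed.

Fact mul01_0l y : mul01 0 y = 0.
Proof. by have := mul01_linear_l y (-1) 0 0; rewrite scaler0 addr0 scaleN1r addNr. Qed.

Fact mul01_0r x : mul01 x 0 = 0.
Proof. by have := mul01_linear_r x (-1) 0 0; rewrite scaler0 addr0 scaleN1r addNr. Qed.

Fact mul00_0l y : mul00 0 y = 0.
Proof. by have := mul00_linear y (-1) 0 0; rewrite scaler0 addr0 scaleN1r addNr. Qed.

Fact table_bilinear : bilinear_for *:%R *:%R table_mul.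
Proof.
split=> [v a x y | u a x y]; rewrite /table_mul /=; congr (_, _) => /=.
- exact: mul00_linear.
- by rewrite mul01_linear_l mul01_linear_r scalerDr addrACA.
- by rewrite ![mul00 u.1 _]mul00C mul00_linear.
- by rewrite mul01_linear_l mul01_linear_r scalerDr addrACA.
Qed.

Fact table_direct : directv (table_part false + table_part true)%VS.
Proof.
apply/directv_addP/eqP; rewrite -subv0; apply/subvP=> -[x y].
by rewrite memv_cap !mem_pairv !memv0 /= => /andP[/andP[_ /eqP->] /andP[/eqP-> _]].
Qed.

Fact table_full : (table_part false + table_part true)%VS = fullv.
Proof.
apply/eqP; rewrite eqEsubv subvf; apply/subvP=> -[x y] _; apply/memv_addP.
exists (x, 0); first by rewrite mem_pairv mem0v memvf.
exists (0, y); first by rewrite mem_pairv mem0v memvf.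
by congr (_, _); rewrite /= ?addr0 ?add0r.
Qed.

Fact table_mul_part i j u v :
  u \in table_part i -> v \in table_part j ->
  table_mul u v \in table_part (i (+) j).
Proof.
case: u v => [u0 u1] [v0 v1].
case: i; case: j;
  rewrite /table_part /= !mem_pairv /= !memvf !memv0 ?andbT /= => /eqP u_0 /eqP v_0.
- by rewrite u_0 v_0 !mul01_0l addr0.
- by rewrite u_0 mul00_0l.
- by rewrite v_0 mul00C mul00_0l.
- by rewrite u_0 v_0 !mul01_0r addr0.
Qed.

Definition table_alg : superalgebra K :=
  Superalgebra table_bilinear table_direct table_full table_mul_part.

End TableAlgebra.

Definition e1 {n} : 'I_n.+1 := @Ordinal n.+1 0 isT.
Definition e2 {n} : 'I_n.+2 := @Ordinal n.+2 1 isT.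
Definition e3 {n} : 'I_n.+3 := @Ordinal n.+3 2 isT.
Definition f : 'I_1 := ord0.
Local Notation half := (2^-1) (only parsing).

Inductive summand :=
  U1 | U2 | S1_1 | B1 | B2 | B3 | S1_2 | S2_2
| S9_3 | S10_3 | S11_3 | S12_3 | S13_3
| T1 | T2 | T3 | T4 | T5 | T6 | T7 | T8 | T9 | T10.

Definition summand_table (K : fieldType) (s : summand) : table K :=
  match s with
  | U1 => Table 1 0
      [:: (e1, e1, 1, e1)]
      [::]
  | U2 => Table 1 0
      [::]
      [::]
  | S1_1 => Table 0 1
      [::]
      [::]
  | B1 => Table 2 0
      [:: (e1, e1, 1, e1); (e1, e2, 1, e2)]
      [::]
  | B2 => Table 2 0
      [:: (e1, e1, 1, e1); (e1, e2, half, e2)]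
      [::]
  | B3 => Table 2 0
      [:: (e1, e1, 1, e2)]
      [::]
  | S1_2 => Table 1 1
      [:: (e1, e1, 1, e1)]
      [:: (e1, f, half, f)]
  | S2_2 => Table 1 1
      [:: (e1, e1, 1, e1)]
      [:: (e1, f, 1, f)]
  | S9_3 => Table 2 1
      [:: (e1, e1, 1, e1); (e1, e2, 1, e2)]
      [:: (e1, f, half, f)]
  | S10_3 => Table 2 1
      [:: (e1, e1, 1, e1); (e1, e2, 1, e2)]
      [:: (e1, f, 1, f)]
  | S11_3 => Table 2 1
      [:: (e1, e1, 1, e1); (e1, e2, half, e2)]
      [:: (e1, f, half, f)]
  | S12_3 => Table 2 1
      [:: (e1, e1, 1, e1); (e1, e2, half, e2)]
      [:: (e1, f, 1, f)]
  | S13_3 => Table 2 1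
      [:: (e1, e1, 1, e1); (e2, e2, 1, e2)]
      [:: (e1, f, half, f); (e2, f, half, f)]
  | T1 => Table 3 0
      [:: (e1, e1, 1, e1); (e2, e2, 1, e3); (e1, e2, 1, e2); (e1, e3, 1, e3)]
      [::]
  | T2 => Table 3 0
      [:: (e1, e1, 1, e1); (e1, e2, 1, e2); (e1, e3, 1, e3)]
      [::]
  | T3 => Table 3 0
      [:: (e1, e1, 1, e2); (e1, e2, 1, e3)]
      [::]
  | T4 => Table 3 0
      [:: (e1, e1, 1, e2); (e1, e3, 1, e2)]
      [::]
  | T5 => Table 3 0
      [:: (e1, e1, 1, e1); (e2, e2, 1, e2); (e3, e3, 1, e1); (e3, e3, 1, e2);
          (e1, e3, half, e3); (e2, e3, half, e3)]
      [::]
  | T6 => Table 3 0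
      [:: (e1, e1, 1, e1); (e1, e2, half, e2); (e1, e3, 1, e3)]
      [::]
  | T7 => Table 3 0
      [:: (e1, e1, 1, e1); (e1, e2, half, e2); (e1, e3, half, e3)]
      [::]
  | T8 => Table 3 0
      [:: (e1, e1, 1, e1); (e2, e2, 1, e3); (e1, e2, half, e2)]
      [::]
  | T9 => Table 3 0
      [:: (e1, e1, 1, e1); (e2, e2, 1, e3); (e1, e2, half, e2);
          (e1, e3, 1, e3)]
      [::]
  | T10 => Table 3 0
      [:: (e1, e1, 1, e1); (e2, e2, 1, e2); (e1, e3, half, e3);
          (e2, e3, half, e3)]
      [::]
  end.

Definition summand_alg (K : fieldType) (s : summand) : superalgebra K :=
  table_alg (summand_table K s).

Definition dsums (K : fieldType) (s : seq summand) : superalgebra K :=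
  foldr (fun p B => dsum (summand_alg K p) B)
    (table_alg (Table 0 0 [::] [::])) s.

(* [summands] is [None] for an algebra that is itself indecomposable. *)
Record row (K : fieldType) := Row {
  orbit_dim : nat;
  summands : option (seq summand);
  row0 : seq ('I_3 * 'I_3 * K * 'I_3);
  row1 : seq ('I_3 * 'I_1 * K * 'I_1)
}.

Arguments Row {K}.

(* In the eleventh row, the orbit dimension 10 is the value of the formula
   [n ^ 2 - dim Der]: the derivations act as gl_2 on e2 and e3, scale f, or
   send e1 to a multiple of f, so that [dim Der = 6].  The published table has
   11 there, which contradicts the formula. *)
Definition rows (K : fieldType) : 59.-tuple (row K) := @Tuple 59 _ [::
Row 15 (Some [:: U1; U1; U1; S1_1])
      [:: (e1, e1, 1, e1); (e2, e2, 1, e2); (e3, e3, 1, e3)]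
      [::];
Row 14 (Some [:: S2_2; U1; U1])
      [:: (e1, e1, 1, e1); (e2, e2, 1, e2); (e3, e3, 1, e3)]
      [:: (e1, f, 1, f)];
Row 14 (Some [:: S1_2; U1; U1])
      [:: (e1, e1, 1, e1); (e2, e2, 1, e2); (e3, e3, 1, e3)]
      [:: (e1, f, half, f)];
Row 14 (Some [:: S13_3; U1])
      [:: (e1, e1, 1, e1); (e2, e2, 1, e2); (e3, e3, 1, e3)]
      [:: (e1, f, half, f); (e2, f, half, f)];
Row 12 (Some [:: U1; U1; U2; S1_1])
      [:: (e1, e1, 1, e1); (e2, e2, 1, e2)]
      [::];
Row 13 (Some [:: S2_2; U1; U2])
      [:: (e1, e1, 1, e1); (e2, e2, 1, e2)]
      [:: (e1, f, 1, f)];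
Row 13 (Some [:: S1_2; U1; U2])
      [:: (e1, e1, 1, e1); (e2, e2, 1, e2)]
      [:: (e1, f, half, f)];
Row 13 (Some [:: S13_3; U2])
      [:: (e1, e1, 1, e1); (e2, e2, 1, e2)]
      [:: (e1, f, half, f); (e2, f, half, f)];
Row 7 (Some [:: U1; U2; U2; S1_1])
      [:: (e1, e1, 1, e1)]
      [::];
Row 10 (Some [:: S2_2; U2; U2])
      [:: (e1, e1, 1, e1)]
      [:: (e1, f, 1, f)];
Row 10 (Some [:: S1_2; U2; U2])
      [:: (e1, e1, 1, e1)]
      [:: (e1, f, half, f)];
Row 14 (Some [:: B1; U1; S1_1])
      [:: (e1, e1, 1, e1); (e1, e2, 1, e2); (e3, e3, 1, e3)]
      [::];
Row 13 (Some [:: B1; S2_2])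
      [:: (e1, e1, 1, e1); (e1, e2, 1, e2); (e3, e3, 1, e3)]
      [:: (e3, f, 1, f)];
Row 13 (Some [:: B1; S1_2])
      [:: (e1, e1, 1, e1); (e1, e2, 1, e2); (e3, e3, 1, e3)]
      [:: (e3, f, half, f)];
Row 12 (Some [:: S10_3; U1])
      [:: (e1, e1, 1, e1); (e1, e2, 1, e2); (e3, e3, 1, e3)]
      [:: (e1, f, 1, f)];
Row 13 (Some [:: S9_3; U1])
      [:: (e1, e1, 1, e1); (e1, e2, 1, e2); (e3, e3, 1, e3)]
      [:: (e1, f, half, f)];
Row 13 None
      [:: (e1, e1, 1, e1); (e1, e2, 1, e2); (e3, e3, 1, e3)]
      [:: (e1, f, half, f); (e3, f, half, f)];
Row 11 (Some [:: B1; U2; S1_1])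
      [:: (e1, e1, 1, e1); (e1, e2, 1, e2)]
      [::];
Row 11 (Some [:: S10_3; U2])
      [:: (e1, e1, 1, e1); (e1, e2, 1, e2)]
      [:: (e1, f, 1, f)];
Row 12 (Some [:: S9_3; U2])
      [:: (e1, e1, 1, e1); (e1, e2, 1, e2)]
      [:: (e1, f, half, f)];
Row 13 (Some [:: B2; U1; S1_1])
      [:: (e1, e1, 1, e1); (e1, e2, half, e2); (e3, e3, 1, e3)]
      [::];
Row 12 (Some [:: B2; S2_2])
      [:: (e1, e1, 1, e1); (e1, e2, half, e2); (e3, e3, 1, e3)]
      [:: (e3, f, 1, f)];
Row 12 (Some [:: B2; S1_2])
      [:: (e1, e1, 1, e1); (e1, e2, half, e2); (e3, e3, 1, e3)]
      [:: (e3, f, half, f)];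
Row 13 (Some [:: S12_3; U1])
      [:: (e1, e1, 1, e1); (e1, e2, half, e2); (e3, e3, 1, e3)]
      [:: (e1, f, 1, f)];
Row 10 (Some [:: S11_3; U1])
      [:: (e1, e1, 1, e1); (e1, e2, half, e2); (e3, e3, 1, e3)]
      [:: (e1, f, half, f)];
Row 12 None
      [:: (e1, e1, 1, e1); (e1, e2, half, e2); (e3, e3, 1, e3)]
      [:: (e1, f, half, f); (e3, f, half, f)];
Row 10 (Some [:: B2; U2; S1_1])
      [:: (e1, e1, 1, e1); (e1, e2, half, e2)]
      [::];
Row 12 (Some [:: S12_3; U2])
      [:: (e1, e1, 1, e1); (e1, e2, half, e2)]
      [:: (e1, f, 1, f)];
Row 9 (Some [:: S11_3; U2])
      [:: (e1, e1, 1, e1); (e1, e2, half, e2)]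
      [:: (e1, f, half, f)];
Row 11 (Some [:: B3; U1; S1_1])
      [:: (e1, e1, 1, e2); (e3, e3, 1, e3)]
      [::];
Row 12 (Some [:: B3; S2_2])
      [:: (e1, e1, 1, e2); (e3, e3, 1, e3)]
      [:: (e3, f, 1, f)];
Row 12 (Some [:: B3; S1_2])
      [:: (e1, e1, 1, e2); (e3, e3, 1, e3)]
      [:: (e3, f, half, f)];
Row 6 (Some [:: B3; U2; S1_1])
      [:: (e1, e1, 1, e2)]
      [::];
Row 13 (Some [:: T1; S1_1])
      [:: (e1, e1, 1, e1); (e1, e2, 1, e2); (e1, e3, 1, e3); (e2, e2, 1, e3)]
      [::];
Row 11 None
      [:: (e1, e1, 1, e1); (e1, e2, 1, e2); (e1, e3, 1, e3); (e2, e2, 1, e3)]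
      [:: (e1, f, 1, f)];
Row 12 None
      [:: (e1, e1, 1, e1); (e1, e2, 1, e2); (e1, e3, 1, e3); (e2, e2, 1, e3)]
      [:: (e1, f, half, f)];
Row 11 (Some [:: T2; S1_1])
      [:: (e1, e1, 1, e1); (e1, e2, 1, e2); (e1, e3, 1, e3)]
      [::];
Row 7 None
      [:: (e1, e1, 1, e1); (e1, e2, 1, e2); (e1, e3, 1, e3)]
      [:: (e1, f, 1, f)];
Row 10 None
      [:: (e1, e1, 1, e1); (e1, e2, 1, e2); (e1, e3, 1, e3)]
      [:: (e1, f, half, f)];
Row 10 (Some [:: T3; S1_1])
      [:: (e1, e1, 1, e2); (e1, e2, 1, e3)]
      [::];
Row 8 (Some [:: T4; S1_1])
      [:: (e1, e1, 1, e2); (e1, e3, 1, e2)]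
      [::];
Row 14 (Some [:: T5; S1_1])
      [:: (e1, e1, 1, e1); (e2, e2, 1, e2); (e3, e3, 1, e1); (e3, e3, 1, e2);
          (e1, e3, half, e3); (e2, e3, half, e3)]
      [::];
Row 12 None
      [:: (e1, e1, 1, e1); (e2, e2, 1, e2); (e3, e3, 1, e1); (e3, e3, 1, e2);
          (e1, e3, half, e3); (e2, e3, half, e3)]
      [:: (e1, f, half, f); (e2, f, half, f)];
Row 12 (Some [:: T6; S1_1])
      [:: (e1, e1, 1, e1); (e1, e2, half, e2); (e1, e3, 1, e3)]
      [::];
Row 10 None
      [:: (e1, e1, 1, e1); (e1, e2, half, e2); (e1, e3, 1, e3)]
      [:: (e1, f, 1, f)];
Row 9 None
      [:: (e1, e1, 1, e1); (e1, e2, half, e2); (e1, e3, 1, e3)]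
      [:: (e1, f, half, f)];
Row 9 (Some [:: T7; S1_1])
      [:: (e1, e1, 1, e1); (e1, e2, half, e2); (e1, e3, half, e3)]
      [::];
Row 9 None
      [:: (e1, e1, 1, e1); (e1, e2, half, e2); (e1, e3, half, e3)]
      [:: (e1, f, 1, f)];
Row 4 None
      [:: (e1, e1, 1, e1); (e1, e2, half, e2); (e1, e3, half, e3)]
      [:: (e1, f, half, f)];
Row 12 (Some [:: T8; S1_1])
      [:: (e1, e1, 1, e1); (e1, e2, half, e2); (e2, e2, 1, e3)]
      [::];
Row 13 None
      [:: (e1, e1, 1, e1); (e1, e2, half, e2); (e2, e2, 1, e3)]
      [:: (e1, f, 1, f)];
Row 11 None
      [:: (e1, e1, 1, e1); (e1, e2, half, e2); (e2, e2, 1, e3)]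
      [:: (e1, f, half, f)];
Row 13 (Some [:: T9; S1_1])
      [:: (e1, e1, 1, e1); (e1, e2, half, e2); (e2, e2, 1, e3);
          (e1, e3, 1, e3)]
      [::];
Row 12 None
      [:: (e1, e1, 1, e1); (e1, e2, half, e2); (e2, e2, 1, e3);
          (e1, e3, 1, e3)]
      [:: (e1, f, 1, f)];
Row 11 None
      [:: (e1, e1, 1, e1); (e1, e2, half, e2); (e2, e2, 1, e3);
          (e1, e3, 1, e3)]
      [:: (e1, f, half, f)];
Row 13 (Some [:: T10; S1_1])
      [:: (e1, e1, 1, e1); (e2, e2, 1, e2); (e1, e3, half, e3);
          (e2, e3, half, e3)]
      [::];
Row 13 None
      [:: (e1, e1, 1, e1); (e2, e2, 1, e2); (e1, e3, half, e3);
          (e2, e3, half, e3)]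
      [:: (e1, f, 1, f)];
Row 12 None
      [:: (e1, e1, 1, e1); (e2, e2, 1, e2); (e1, e3, half, e3);
          (e2, e3, half, e3)]
      [:: (e1, f, half, f)];
Row 10 None
      [:: (e1, e1, 1, e1); (e2, e2, 1, e2); (e1, e3, half, e3);
          (e2, e3, half, e3)]
      [:: (e1, f, half, f); (e2, f, half, f)]
] isT.

(* Ordinals start at 0: [J K k] is the algebra number [k + 1] of the list. *)
Definition J (K : fieldType) (k : 'I_59) : superalgebra K :=
  let r := tnth (rows K) k in table_alg (Table 3 1 (row0 r) (row1 r)).

Definition J_orbit_dim (K : fieldType) (k : 'I_59) : nat :=
  orbit_dim (tnth (rows K) k).

Definition J_summands (K : fieldType) (k : 'I_59) : option (seq summand) :=
  summands (tnth (rows K) k).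

(* Main.v *)
Require Import Defs.
From HB Require Import structures.
From mathcomp Require Import all_boot all_order all_algebra.
From mathcomp Require Import ring.
From mathcomp Require Import reals.
From mathcomp Require Import complex.
From mathcomp Require boolp.

(* The structure constants of all the algebras involved are half-integers, so
   finitely many facts about them are computed over the integers.  For scalars
   [a], [b], [c] and a parity [d], the space of the linear maps [D] of parity [d]
   with [a D(xy) = b D(x)y + c (-1)^(d|x|) x D(y)] is the solution space of a
   linear system, and its dimension is an isomorphism invariant.  Seven choices
   of [(d, a, b, c)] separate the 59 algebras, and [(0, 1, 1, 1)] and
   [(1, 1, 1, 1)] give the derivations.  A decomposition [A = B + C] yields the
   idempotent projection [p] onto [B], which satisfies [p(xy) = p(x)y]; in the
   indecomposable algebras such maps are a scalar plus a strictly triangular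
   matrix, so that [p] is 0 or 1.

   For the classification, let [V] be the even part and [f] span the odd part.
   Then [x f = l(x) f] for a linear form [l] on [V], and the superalgebra is
   determined by the Jordan algebra [V] of dimension 3 and [l].  If some fourth
   power is nonzero, then [V] has an idempotent [e], and [V] has a basis [e],
   [u], [v] of eigenvectors of [e], with eigenvalues in [{0, 1/2, 1}].  The Peirce
   relations put the products of [u] and [v] in normal form.  If all fourth
   powers vanish, the products are computed from an element with a nonzero cube
   or, failing that, with a nonzero square.  In each case [l] takes values in
   [{0, 1/2, 1}] on the basis, and the finitely many values compatible with the
   Jordan identity are matched with the table. *)

Set Implicit Arguments.
Unset Strict Implicit.
Unset Printing Implicit Defensive.
Import Order.TTheory GRing.Theory Num.Theory.
Local Open Scope ring_scope.
#[local] Arguments smul : simpl never.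

(** * Linear systems *)

(** The field [R[i]] does not compute, so nothing is evaluated in it. The coefficients of the table
    are 1 and 1/2, hence each row is the image of a row over [rat], and doubling its structure
    constants gives integers. Nullities survive this change of scalars because elimination uses only
    ring operations and tests for zero. The orbit dimensions lie between 4 and 15 and cannot
    separate 59 algebras, whence the further choices of [(d, a, b, c)]. Fourth powers are the right
    test in dimension 3: [x], [x^2], [x^3], [x^4] are dependent, and [x^4] can always be expressed
    by the lower powers. If it is nonzero, this relation gives an idempotent that is a polynomial in
    [x]. Algebraic closure serves twice: square roots normalize squares and split idempotents, and a
    root of a cubic is subtracted from an element of a unital algebra to make it nilpotent. *)

Section Eliminate.
Variable R : comNzRingType.
Implicit Types (s : seq (seq R)) (p r : seq R).

(** Cross-multiplication avoids division. Applied to the pivot [p] itself it gives a zero row, so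
    [nullity] can map it over all rows and discard zero rows afterwards. *)
Definition eliminate N p r : seq R :=
  if r`_0 == 0 then behead r
  else mkseq (fun i => p`_0 * r`_i.+1 - r`_0 * p`_i.+1) N.

(* Fraction-free Gaussian elimination, so that the dimension of the solution
   space of a system with integer coefficients is computed over the integers. *)
Fixpoint nullity N s : nat :=
  if N is N'.+1 then
    if [seq r <- s | r`_0 != 0] is p :: _
    then nullity N'
           (undup [seq r <- map (eliminate N' p) s | has (predC1 0) r])
    else (nullity N' (map behead s)).+1
  else 0.

End Eliminate.

Section Nullity.
Variable F : fieldType.
Implicit Types (s : seq (seq F)) (p : seq F).

Definition solution N s (x : 'rV[F]_N) :=
  forall r, r \in s -> \sum_(i < N) r`_i * x 0 i = 0.

Lemma solution_clean N s x :
  solution (undup [seq r <- s | has (predC1 0) r]) x <-> @solution N s x.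
Proof.
split=> H r.
  case: (boolP (has (predC1 0) r)) => [rn0 rs|/hasPn r0 _].
    by apply: H; rewrite mem_undup mem_filter rn0.
  apply: big1 => i _; have [ir|ri] := ltnP i (size r).
    by have := r0 _ (mem_nth 0 ir); rewrite /= negbK => /eqP->; rewrite mul0r.
  by rewrite nth_default // mul0r.
by rewrite mem_undup mem_filter => /andP[_ /H].
Qed.

Lemma solution_map (I : eqType) N (s : seq I) x (h : I -> seq F) :
  @solution N (map h s) x <->
  (forall k, k \in s -> \sum_(i < N) (h k)`_i * x 0 i = 0).
Proof.
split=> [H r rs | H _ /mapP[r rs ->]]; last exact: H.
by apply: H; apply: map_f.
Qed.

Lemma nullityP N s :
  exists B : 'M[F]_(nullity N s, N), row_free B /\
    forall x, solution s x <-> (x <= B)%MS.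
Proof.
elim: N s => [|N IHN] s /=.
  exists 0; split=> [|x]; first by rewrite /row_free mxrank0.
  split=> [_|_ r _]; last by rewrite big_ord0.
  by rewrite [x]thinmx0 sub0mx.
case Dp: [seq r <- s | r`_0 != 0] => [|p s'].
  have {}Dp r : r \in s -> r`_0 = 0.
    move=> rs; apply/eqP; apply: contraT => r0.
    by have := mem_filter (fun r => r`_0 != 0) r s; rewrite Dp rs r0.
  have [B [/row_freeP[C BC] solB]] := IHN (map behead s).
  exists (block_mx (1%:M : 'M_1) 0 0 B : 'M_(1 + _, 1 + N)); split.
    apply/row_freeP; exists (block_mx (1%:M : 'M_1) 0 0 C : 'M_(1 + N, 1 + _)).
    rewrite [LHS](mulmx_block (1%:M : 'M_1) 0 0 B (1%:M : 'M_1) 0 0 C).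
    rewrite !mulmx0 !mul0mx !mulmx1 !addr0 !add0r BC.
    by rewrite -scalar_mx_block.
  move=> x; pose y : 'rV_N := @rsubmx _ 1 1 N x.
  have -> : solution s x <-> solution (map behead s) y.
    rewrite solution_map; split=> H r rs.
      have := H r rs; rewrite big_ord_recl /= Dp // mul0r add0r => E.
      rewrite -{}[RHS]E; apply: eq_bigr => i _; rewrite nth_behead !mxE.
      by congr (_ * x 0 _); apply: val_inj.
    rewrite big_ord_recl /= Dp // mul0r add0r -{}[RHS](H r rs).
    apply: eq_bigr => i _; rewrite nth_behead !mxE.
    by congr (_ * x 0 _); apply: val_inj.
  rewrite solB; split=> /submxP[D E]; apply/submxP.
    exists (row_mx (@lsubmx _ 1 1 N x) D).
    rewrite [RHS](mul_row_block (@lsubmx _ 1 1 N x) D (1%:M : 'M_1) 0 0 B).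
    by rewrite !mulmx0 mulmx1 addr0 add0r -E [RHS]hsubmxK.
  exists (@rsubmx _ 1 1 _ D); rewrite /y E -[D in LHS](@hsubmxK _ 1 1).
  rewrite (mul_row_block (@lsubmx _ 1 1 _ D) _ (1%:M : 'M_1) 0 0 B).
  by rewrite row_mxKr mulmx0 add0r.
have [ps p0] : p \in s /\ p`_0 != 0.
  by have := mem_head p s'; rewrite -Dp mem_filter => /andP[].
set s2 := undup _; have [B [/row_freeP[C BC] solB]] := IHN s2.
pose q : 'cV_N := \col_i p`_i.+1.
(* The column [c] holds the values of the first unknown that the pivot equation imposes on the basis
   [B] of the reduced system. *)
pose c := - (p`_0)^-1 *: (B *m q); exists (row_mx c B : 'M_(_, 1 + N)); split.
  apply/row_freeP; exists (col_mx (0 : 'M_(1, _)) C : 'M_(1 + N, _)).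
  by rewrite [LHS](mul_row_col _ B (0 : 'M_(1, _)) C) mulmx0 add0r.
move=> x; pose y : 'rV_N := @rsubmx _ 1 1 N x.
have dotE r : \sum_(i < N.+1) r`_i * x 0 i =
    r`_0 * x 0 0 + \sum_(i < N) r`_i.+1 * y 0 i.
  rewrite big_ord_recl; congr (_ + _); apply: eq_bigr => i _; rewrite !mxE.
  by congr (_ * x 0 _); apply: val_inj.
have -> : solution s x <-> solution s2 y /\ x 0 0 = - (p`_0)^-1 * (y *m q) 0 0.
  have -> : (y *m q) 0 0 = \sum_(i < N) p`_i.+1 * y 0 i.
    by rewrite mxE; apply: eq_bigr => i _; rewrite [q _ _]mxE mulrC.
  rewrite solution_clean solution_map.
  have elimE r : p`_0 * x 0 0 = - \sum_(i < N) p`_i.+1 * y 0 i ->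
      \sum_(i < N) (eliminate N p r)`_i * y 0 i =
      (if r`_0 == 0 then 1 else p`_0) * \sum_(i < N.+1) r`_i * x 0 i.
    move=> x0E; rewrite dotE /eliminate; case: eqP => [->|_].
      rewrite mul1r mul0r add0r; apply: eq_bigr => i _.
      by rewrite nth_behead.
    rewrite mulrDr mulrCA x0E mulrN !mulr_sumr addrC -sumrN -big_split /=.
    by apply: eq_bigr => i _; rewrite nth_mkseq // mulrBl !mulrA.
  split=> [H | [H x0E]].
    have x0E : p`_0 * x 0 0 = - \sum_(i < N) p`_i.+1 * y 0 i.
      by apply/eqP; rewrite -addr_eq0 -dotE H.
    split=> [r rs | ]; first by rewrite elimE // H // mulr0.
    by rewrite mulNr -mulrN -x0E mulKf.
  have {}x0E : p`_0 * x 0 0 = - \sum_(i < N) p`_i.+1 * y 0 i.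
    by rewrite x0E mulrA mulrN divff // mulN1r.
  move=> r rs; have := elimE r x0E; rewrite H // => /esym/eqP.
  by rewrite mulf_eq0; case: ifP => _; rewrite ?oner_eq0 ?(negPf p0) => /eqP.
have cE D : y = D *m B -> D *m c = (- (p`_0)^-1 * (y *m q) 0 0)%:M.
  by move=> ->; rewrite -scalemxAr mulmxA [LHS]mx11_scalar [in LHS]mxE.
rewrite solB; split=> [[/submxP[D E] x0E] | /submxP[D E]].
  apply/submxP; exists D.
  rewrite [RHS](mul_mx_row D c B) cE // -x0E -E -[LHS](@hsubmxK _ 1 1 N).
  apply: (congr2 (@row_mx _ 1 1 N)) => //; apply/rowP=> i.
  by rewrite !mxE !ord1; congr (x 0 _); apply: val_inj.
rewrite [RHS](mul_mx_row D c B) in E.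
have yE : y = D *m B by rewrite /y E row_mxKr.
split; first by rewrite yE submxMl.
have -> : x 0 0 = (@lsubmx _ 1 1 N x) 0 0.
  by rewrite mxE; congr (x 0 _); apply: val_inj.
by rewrite E row_mxKl cE // mxE.
Qed.

(** The solution spaces are nested, so equal dimensions make them equal. This turns an implication
    between linear systems into a comparison of two computed numbers. *)
Lemma nullity_consequence N s s' :
  nullity N (s' ++ s) = nullity N s ->
  forall x, @solution N s x -> solution s' x.
Proof.
have [B [freeB solB]] := nullityP N s; have [C [freeC solC]] := nullityP N (s' ++ s).
move=> eqn x /solB xB; suff /solC H : (x <= C)%MS.
  by move=> r rs; apply: H; rewrite mem_cat rs.
apply: submx_trans xB _.
have CB : (C <= B)%MS.
  apply/row_subP => i; apply/solB => r rs; have /solC := row_sub i C.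
  by apply; rewrite mem_cat rs orbT.
have [_ <-] := mxrank_leqif_sup CB.
by move: freeB freeC => /eqP rB /eqP rC; apply/eqP; exact: (etrans rC (etrans eqn (esym rB))).
Qed.

Lemma solution_space N s (W : vectType F) (psi : {linear 'rV[F]_N -> W})
    (P : W -> Prop) :
  injective psi -> (forall w, P w <-> exists2 x, w = psi x & solution s x) ->
  exists2 U : {vspace W}, forall w, w \in U <-> P w & \dim U = nullity N s.
Proof.
move=> inj_psi PE; have [B [freeB solB]] := nullityP N s.
pose h := linfun (psi \o mulmxr B).
exists (limg h).
  move=> w; rewrite PE; split=> [/memv_imgP[y _ ->] | [x -> /solB/submxP[y ->]]].
    by exists (y *m B); rewrite ?lfunE //; apply/solB/submxMl.
  by apply/memv_imgP; exists y; rewrite ?memvf ?lfunE.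
rewrite limg_dim_eq ?dimvf /dim /= ?mul1n // capfv.
apply/eqP/lker0P => y z; rewrite !lfunE /= => /inj_psi; exact: row_free_inj.
Qed.

End Nullity.

(** Every branch of the elimination tests an element for zero and [undup] tests rows for equality;
    an injective morphism preserves both. With [intr] for [phi], dimensions over the field are
    computed over [int]. *)
Lemma nullity_map (R R' : comNzRingType) (phi : {rmorphism R -> R'}) N s :
  injective phi -> nullity N (map (map phi) s) = nullity N s.
Proof.
move=> phi_inj.
have phi_eq0 x : (phi x == 0) = (x == 0) by rewrite -(rmorph0 phi) (inj_eq phi_inj).
elim: N s => //= N IHN s.
have nthM (r : seq R) i : (map phi r)`_i = phi r`_i.
  have [ir|ri] := ltnP i (size r); first by rewrite (nth_map 0).
  by rewrite !nth_default ?size_map ?rmorph0.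
rewrite filter_map /=.
rewrite (eq_filter (a2 := fun r : seq R => r`_0 != 0)); last first.
  by move=> r /=; rewrite nthM phi_eq0.
case: [seq r <- s | r`_0 != 0] => [|p s'] /=.
  by rewrite -IHN -!map_comp; congr (nullity _ _).+1; apply: eq_map => -[].
rewrite -{}IHN -(undup_map_inj (inj_map phi_inj)); congr (nullity _ (undup _)).
have elimM r : eliminate N (map phi p) (map phi r) = map phi (eliminate N p r).
  rewrite /eliminate nthM phi_eq0; case: ifP => _; first by case: r.
  rewrite /mkseq -map_comp; apply: eq_map => i /=.
  by rewrite !nthM !rmorphB !rmorphM.
rewrite -map_comp (eq_map elimM) map_comp filter_map; congr map.
by apply: eq_filter => r /=; rewrite has_map; apply: eq_has => c /=; rewrite phi_eq0.
Qed.

(** * Isomorphisms and generalized derivations *)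

Section Conjugation.
Variables (K : fieldType) (V W : vectType K) (phi : 'Hom(V, W)) (psi : 'Hom(W, V)).

Definition lfun_conj (D : 'End(V)) : 'End(W) := (phi \o D \o psi)%VF.

Fact lfun_conj_is_linear : linear lfun_conj.
Proof.
move=> k D E; apply/lfunP=> x.
by rewrite /lfun_conj !(comp_lfunE, add_lfunE, scale_lfunE) linearP.
Qed.

HB.instance Definition _ :=
  GRing.isLinear.Build K 'End(V) 'End(W) *:%R lfun_conj lfun_conj_is_linear.

End Conjugation.

Section Superalgebras.
Variable K : fieldType.
Implicit Types A B C : superalgebra K.

Lemma smulDl A (x y z : A) : (x + y) ** z = x ** z + y ** z.
Proof. by have /= := (smul_bilinear A).1 z 1 x y; rewrite !scale1r. Qed.

Lemma smulDr A (x y z : A) : z ** (x + y) = z ** x + z ** y.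
Proof. by have /= := (smul_bilinear A).2 z 1 x y; rewrite !scale1r. Qed.

Lemma smul0l A (z : A) : 0 ** z = 0.
Proof. by apply: (@addrI _ (0 ** z)); rewrite -smulDl !addr0. Qed.

Lemma smul0r A (z : A) : z ** 0 = 0.
Proof. by apply: (@addrI _ (z ** 0)); rewrite -smulDr !addr0. Qed.

Lemma smulZl A a (x z : A) : (a *: x) ** z = a *: (x ** z).
Proof. by have /= := (smul_bilinear A).1 z a x 0; rewrite smul0l !addr0. Qed.

Lemma smulZr A a (x z : A) : z ** (a *: x) = a *: (z ** x).
Proof. by have /= := (smul_bilinear A).2 z a x 0; rewrite smul0r !addr0. Qed.

Lemma smul_suml A (I : finType) (g : I -> A) z :
  (\sum_i g i) ** z = \sum_i g i ** z.
Proof. by apply: (big_morph (fun x => x ** z)) => [x y|]; rewrite ?smulDl ?smul0l. Qed.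

Lemma smul_sumr A (I : finType) (g : I -> A) z :
  z ** (\sum_i g i) = \sum_i z ** g i.
Proof. by apply: (big_morph (smul A z)) => [x y|]; rewrite ?smulDr ?smul0r. Qed.

Lemma part_split A (x : A) :
  exists x0 x1, [/\ x0 \in part A false, x1 \in part A true & x = x0 + x1].
Proof.
have: x \in (part A false + part A true)%VS by rewrite part_full memvf.
by case/memv_addP=> x0 x0P [x1 x1P ->]; exists x0, x1.
Qed.

Lemma part_cap A i (x : A) : x \in part A i -> x \in part A (~~ i) -> x = 0.
Proof.
move=> xi xNi; have /directv_addP dA := part_direct A.
have: x \in (part A false :&: part A true)%VS.
  by rewrite memv_cap; case: i xi xNi => -> ->.
by rewrite dA memv0 => /eqP.
Qed.

(** The inverse is graded although only [phi] is assumed to be: a component of wrong parity in a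
    preimage would be sent into both parts, hence to 0. *)
Lemma isomorphic_inv A B : isomorphic A B ->
  exists (phi : 'Hom(A, B)) (psi : 'Hom(B, A)),
    [/\ cancel phi psi, cancel psi phi,
        (forall x y, phi (x ** y) = phi x ** phi y) /\
        (forall x y, psi (x ** y) = psi x ** psi y)
      & (forall i x, x \in part A i -> phi x \in part B i) /\
        (forall i x, x \in part B i -> psi x \in part A i)].
Proof.
case=> phi [bij_phi phiM phiP].
have inj_phi := bij_inj bij_phi.
have phiK : cancel phi (phi^-1)%VF by apply: lker0_lfunK; apply/lker0P.
have phiVK : cancel (phi^-1)%VF phi.
  by case: bij_phi => g _ gK y; rewrite -[y]gK phiK.
exists phi, (phi^-1)%VF; split=> //; split=> //.
  by move=> x y; apply: inj_phi; rewrite phiM !phiVK.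
move=> i y yi; have [x0 [x1 [x0P x1P xE]]] := part_split ((phi^-1)%VF y).
have yE : y = phi x0 + phi x1 by rewrite -linearD /= -xE phiVK.
rewrite xE; case: i yi => yi.
  suff -> : x0 = 0 by rewrite add0r.
  apply: inj_phi; rewrite linear0; apply: (@part_cap _ false); first exact: phiP.
  have -> : phi x0 = y - phi x1 by rewrite yE addrK.
  by rewrite rpredB //; apply: phiP.
suff -> : x1 = 0 by rewrite addr0.
apply: inj_phi; rewrite linear0; apply: (@part_cap _ true); first exact: phiP.
have -> : phi x1 = y - phi x0 by rewrite yE addrC addKr.
by rewrite rpredB //; apply: phiP.
Qed.

Lemma isomorphic_sym A B : isomorphic A B -> isomorphic B A.
Proof.
case/isomorphic_inv=> phi [psi [phiK psiK [_ psiM] [_ psiP]]].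
by exists psi; split=> //; exists phi.
Qed.

Lemma isomorphic_trans A B C : isomorphic A B -> isomorphic B C -> isomorphic A C.
Proof.
case=> phi [bij_phi phiM phiP] [psi [bij_psi psiM psiP]].
exists (psi \o phi)%VF; split.
- apply: (eq_bij (bij_comp bij_psi bij_phi)) => x.
  by rewrite lfunE.
- by move=> x y; rewrite !lfunE /= phiM psiM.
- by move=> i x xi; rewrite lfunE /=; apply/psiP/phiP.
Qed.

(* [(d, 1, 1, 1)] are the derivations of degree [d], and [(false, 1, 1, 0)] is
   the even part of the centroid. *)
Definition gen_derivation A (d : bool) (a b c : K) (D : 'End(A)) :=
  (forall i x, x \in part A i -> D x \in part A (d (+) i)) /\
  (forall i x y, x \in part A i ->
     a *: D (x ** y) = b *: (D x ** y) + (c * (-1) ^+ (d * i)) *: (x ** D y)).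

Lemma gen_derivation111 A d D :
  gen_derivation d 1 1 1 D <-> @homogeneous_derivation _ A d D.
Proof.
by split=> -[gD mD]; split=> // i x y xi; have := mD i x y xi; rewrite !scale1r mul1r.
Qed.

Lemma gen_derivation_iso_le A B d a b c
    (U : {vspace 'End(A)}) (V : {vspace 'End(B)}) :
  isomorphic A B ->
  (forall D, D \in U <-> gen_derivation d a b c D) ->
  (forall D, D \in V <-> gen_derivation d a b c D) -> (\dim U <= \dim V)%N.
(* Conjugation by the isomorphism maps [U] injectively into [V]. *)
Proof.
case/isomorphic_inv=> phi [psi [phiK psiK [phiM psiM] [phiP psiP]]] UP VP.
pose hL := linfun (lfun_conj phi psi).
have hE D x : hL D x = phi (D (psi x)) by rewrite lfunE /= /lfun_conj !comp_lfunE.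
have hker : lker hL == 0%VS.
  apply/lker0P=> D E /lfunP DE; apply/lfunP=> x.
  by have := DE (phi x); rewrite !hE phiK => /(can_inj phiK).
rewrite -(limg_dim_eq (f := hL)) ?(eqP hker) ?capv0 //; apply: dimvS.
apply/subvP=> _ /memv_imgP[D DU ->]; move/UP: DU => [gD mD]; apply/VP; split.
  by move=> i x xi; rewrite hE; apply/phiP/gD/psiP.
move=> i x y xi; rewrite !hE psiM -linearZ /= (mD i) ?psiP // linearD !linearZ /=.
by rewrite !phiM !psiK.
Qed.

Lemma gen_derivation_iso A B d a b c
    (U : {vspace 'End(A)}) (V : {vspace 'End(B)}) :
  isomorphic A B ->
  (forall D, D \in U <-> gen_derivation d a b c D) ->
  (forall D, D \in V <-> gen_derivation d a b c D) -> \dim U = \dim V.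
Proof.
move=> isoAB UP VP; apply/eqP; rewrite eqn_leq.
rewrite (gen_derivation_iso_le isoAB UP VP).
exact: (gen_derivation_iso_le (isomorphic_sym isoAB) VP UP).
Qed.

(** The span of the homogeneous derivations is [U0 + U1], and the sum is direct because a map that
    is both even and odd sends each homogeneous element into both parts. *)
Lemma has_orbit_dim_der A (U0 U1 : {vspace 'End(A)}) :
  (forall D, D \in U0 <-> gen_derivation false 1 1 1 D) ->
  (forall D, D \in U1 <-> gen_derivation true 1 1 1 D) ->
  has_orbit_dim A (\dim {:A} ^ 2 - (\dim U0 + \dim U1)).
Proof.
move=> U0P U1P; exists (U0 + U1)%VS.
  split=> [[] D /gen_derivation111 DP | V VP].
  - by move/U1P: DP; apply: (subvP (addvSr _ _)).
  - by move/U0P: DP; apply: (subvP (addvSl _ _)).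
  apply/subvP=> _ /memv_addP[D0 /U0P D0P [D1 /U1P D1P ->]].
  by apply: rpredD; apply: VP; apply/gen_derivation111; [apply: D0P | apply: D1P].
rewrite dimv_disjoint_sum //; apply/eqP; rewrite -subv0; apply/subvP=> D.
rewrite memv_cap => /andP[/U0P[gD0 _] /U1P[gD1 _]]; rewrite memv0; apply/eqP/lfunP=> x.
have [x0 [x1 [x0P x1P ->]]] := part_split x.
rewrite lfunE /= linearD /=.
rewrite (part_cap (gD0 _ _ x0P) (gD1 _ _ x0P)).
by rewrite (part_cap (gD0 _ _ x1P) (gD1 _ _ x1P)) addr0.
Qed.

End Superalgebras.

(** * Algebras given by a multiplication table *)

Section SquareIndex.
Variable n : nat.
Implicit Types (i j : 'I_n) (m : 'I_(n * n)).

Fact sqr_index_lt i j : (i * n + j < n * n)%N.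
Proof.
by rewrite (@leq_trans (i.+1 * n)) ?leq_mul2r ?ltn_ord ?orbT // mulSn addnC ltn_add2r.
Qed.

(** Row-major numbering of matrix entries: an endomorphism becomes a row of [n * n] unknowns, the
    form that [nullity] accepts. *)
Definition sqr_index i j := Ordinal (sqr_index_lt i j).

Fact sqr_fst_lt m : (m %/ n < n)%N.
Proof. by rewrite ltn_divLR ?ltn_ord //; case: (n) m => [[]|]. Qed.

Fact sqr_snd_lt m : (m %% n < n)%N.
Proof. by rewrite ltn_pmod //; case: (n) m => [[]|]. Qed.

Definition sqr_fst m := Ordinal (sqr_fst_lt m).
Definition sqr_snd m := Ordinal (sqr_snd_lt m).

Lemma sqr_indexK m : sqr_index (sqr_fst m) (sqr_snd m) = m.
Proof. by apply: val_inj; rewrite /= -divn_eq. Qed.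

Lemma sqr_fstK i j : sqr_fst (sqr_index i j) = i.
Proof.
apply: val_inj; rewrite /= divnMDl ?divn_small ?addn0 //.
by case: (n) i => [[]|].
Qed.

Lemma sqr_sndK i j : sqr_snd (sqr_index i j) = j.
Proof. by apply: val_inj; rewrite /= modnMDl modn_small. Qed.

Lemma sum_sqr_index (V : nmodType) (g : 'I_(n * n) -> V) :
  \sum_m g m = \sum_i \sum_j g (sqr_index i j).
Proof.
rewrite pair_bigA /= (reindex (fun p => sqr_index p.1 p.2)) //=.
exists (fun m => (sqr_fst m, sqr_snd m)) => [[i j] _|m _] /=.
  by rewrite sqr_fstK sqr_sndK.
exact: sqr_indexK.
Qed.

End SquareIndex.

(** The excluded case would count a coefficient twice. It cannot occur for a table entry with
    distinct factors, since then at most one of the two orders matches a given pair of basis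
    vectors. *)
Lemma natr_boolE (R : pzRingType) (c : R) (p q r s : bool) :
  ~~ [&& p, q, r & s] ->
  c * (p%:R * q%:R + r%:R * s%:R) = if p && q || s && r then c else 0.
Proof.
by case: p; case: q; case: r; case: s => //= _;
  rewrite !(mulr1, mulr0, mul0r, add0r, addr0).
Qed.

Section TableBasis.
Variables (K : fieldType) (t : table K).
Let n := (n0 t + n1 t)%N.
Let T := table_alg t.

Definition coord (u : T) (i : 'I_n) : K := row_mx u.1 u.2 0 i.

Definition basis (i : 'I_n) : T :=
  (lsubmx (delta_mx 0 i : 'rV_(n0 t + n1 t)), rsubmx (delta_mx 0 i : 'rV_(n0 t + n1 t))).

Definition odd_index (i : nat) := (n0 t <= i)%N.

(* The odd basis vectors are numbered from [n0 t] on. *)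
Definition sconst (i j k : nat) : K :=
  foldr +%R 0
    ([seq p.1.2 | p <- tab0 t & let: (a, b, _, l) := p : 'I__ * 'I__ * K * 'I__ in
        ((a == i :> nat) && (b == j :> nat) || (a == j :> nat) && (b == i :> nat))
        && (l == k :> nat)] ++
     [seq p.1.2 | p <- tab1 t & let: (a, b, _, l) := p : 'I__ * 'I__ * K * 'I__ in
        ((a == i :> nat) && (n0 t + b == j)%N || (a == j :> nat) && (n0 t + b == i)%N)
        && (n0 t + l == k)%N]).

Lemma coordD u v i : coord (u + v) i = coord u i + coord v i.
Proof. by rewrite /coord -(splitK i); case: (split i) => k /=; rewrite ?row_mxEl ?row_mxEr mxE. Qed.

Lemma coordZ c u i : coord (c *: u) i = c * coord u i.
Proof. by rewrite /coord -(splitK i); case: (split i) => k /=; rewrite ?row_mxEl ?row_mxEr mxE. Qed.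

Lemma coord0 i : coord 0 i = 0.
Proof. by rewrite -[0 in LHS](scale0r 0) coordZ mul0r. Qed.

Lemma coord_sum (I : finType) (P : pred I) (g : I -> T) i :
  coord (\sum_(j | P j) g j) i = \sum_(j | P j) coord (g j) i.
Proof. by apply: (big_morph (coord^~ i)) => [x y|]; rewrite ?coordD ?coord0. Qed.

Lemma coord_inj u v : coord u =1 coord v -> u = v.
Proof.
case: u v => [u1 u2] [v1 v2] uv.
by have /eq_row_mx[-> ->] : row_mx u1 u2 = row_mx v1 v2 by apply/rowP=> i; apply: uv.
Qed.

Lemma coord_basis_vector i j : coord (basis i) j = (j == i)%:R.
Proof. by rewrite /coord hsubmxK mxE. Qed.

Lemma coord_sum_basis (g : 'I_n -> K) j : coord (\sum_i g i *: basis i) j = g j.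
Proof.
rewrite coord_sum (bigD1 j) //= coordZ coord_basis_vector eqxx mulr1.
rewrite big1 ?addr0 // => i /negPf ij.
by rewrite coordZ coord_basis_vector eq_sym ij mulr0.
Qed.

Lemma coord_sumE u : u = \sum_i coord u i *: basis i.
Proof. by apply: coord_inj => j; rewrite coord_sum_basis. Qed.

Lemma basis_part i : basis i \in part T (odd_index i).
Proof.
rewrite /odd_index; case: leqP => ni; rewrite mem_pairv /= memvf ?andbT memv0.
  apply/eqP/rowP=> a; rewrite !mxE -[_ == i]val_eqE /=.
  by rewrite ltn_eqF // (leq_trans (ltn_ord a)).
apply/eqP/rowP=> b; rewrite !mxE -[_ == i]val_eqE /=.
by rewrite gtn_eqF // (leq_trans ni) ?leq_addr.
Qed.

Lemma coord_part b u (i : 'I_n) : u \in part T b -> odd_index i != b -> coord u i = 0.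
Proof.
rewrite /odd_index /coord; case: b => /=; rewrite mem_pairv memvf ?andbT memv0.
  move=> /eqP->; rewrite eqb_id -ltnNge => ni; rewrite mxE.
  by case: split_ordP => [j _|j E]; rewrite ?mxE //; move: ni; rewrite E /= ltnNge leq_addr.
move=> /eqP->; rewrite eqbF_neg negbK => ni; rewrite mxE.
by case: split_ordP => [j E|j _]; rewrite ?mxE //; move: ni; rewrite E /= leqNgt ltn_ord.
Qed.

Lemma mem_part b u : (forall i : 'I_n, odd_index i != b -> coord u i = 0) -> u \in part T b.
Proof.
move=> ub; rewrite (coord_sumE u); apply: rpred_sum => i _.
have [<-|/ub->] := eqVneq (odd_index i) b; last by rewrite scale0r mem0v.
exact/rpredZ/basis_part.
Qed.

Lemma coord_mul_basis i j k : coord (basis i ** basis j) k = sconst i j k.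
Proof.
have b1 (i' : 'I_n) (a : 'I_(n0 t)) : (basis i').1 0 a = (a == i' :> nat)%:R.
  by rewrite !mxE.
have b2 (i' : 'I_n) (a : 'I_(n1 t)) : (basis i').2 0 a = (n0 t + a == i')%N%:R.
  by rewrite !mxE.
rewrite /sconst !foldrE big_cat !big_map !big_filter /= [X in _ = X + _]big_mkcond [X in _ + X]big_mkcond /=.
rewrite /coord -[k]splitK.
case: (split k) => l /=; rewrite ?row_mxEl ?row_mxEr.
  rewrite [X in _ + X]big1_seq ?addr0; last first.
    move=> [[[a b] c] m] _ /=.
    by rewrite [(_ + m == l)%N]gtn_eqF ?andbF // (leq_trans (ltn_ord l)) ?leq_addr.
  rewrite summxE; apply: eq_bigr => -[[[a b] c] m] _; rewrite [LHS]mxE [delta_mx _ _ _ _]mxE eqxx /= !b1.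
  rewrite [l == m]eq_sym -[m == l]val_eqE /=; case: (val m == l); last first.
    by rewrite mulr0 andbF.
  rewrite mulr1 andbT; have [<-|ab] := eqVneq a b.
    by rewrite [X in _ || X]andbC orbb -natrM mulnb; case: (_ && _); rewrite ?mulr1 ?mulr0.
  apply: natr_boolE; apply/negP=> /and4P[/eqP ai _ /eqP bi _].
  by case/eqP: ab; apply: val_inj; rewrite /= ai bi.
rewrite [X in _ = X + _]big1_seq ?add0r; last first.
  move=> [[[a b] c] m] _ /=.
  by rewrite [nat_of_ord m == _]ltn_eqF ?andbF // (leq_trans (ltn_ord m)) ?leq_addr.
rewrite mxE !summxE -big_split /=.
apply: eq_bigr => -[[[a b] c] m] _.
rewrite ![fun_of_matrix (_ *: _) _ _]mxE [delta_mx _ _ _ _]mxE eqxx /= !b1 !b2.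
rewrite [l == m]eq_sym eqn_add2l -[m == l]val_eqE /=; case: (val m == l); last first.
  by rewrite !mulr0 addr0 andbF.
rewrite !mulr1 andbT -mulrDr [X in _ + X]mulrC; apply: natr_boolE.
apply/negP=> /and4P[/eqP ai _ /eqP bi _]; have := ltn_ord a.
by rewrite ai -bi ltnNge leq_addr.
Qed.

Lemma mul_basis i j : basis i ** basis j = \sum_(k < n) sconst i j k *: basis k.
Proof. by apply: coord_inj => k; rewrite coord_mul_basis coord_sum_basis. Qed.

Lemma table_mulC (u v : T) : u ** v = v ** u.
Proof. by congr (_, _); [apply: mul00C | apply: addrC]. Qed.

Lemma table_mul_odd (u v : T) : u \in part T true -> v \in part T true -> u ** v = 0.
Proof.
rewrite !mem_pairv !memv0 !memvf !andbT => /eqP u0 /eqP v0.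
congr (_, _); first by rewrite u0 mul00_0l.
by rewrite u0 v0 !mul01_0l addr0.
Qed.

Lemma table_supercommutative : supercommutative T.
Proof.
move=> [] [] x y xi yj; first by rewrite !table_mul_odd // scaler0.
all: by rewrite ?muln0 ?mul0n expr0 scale1r table_mulC.
Qed.

Lemma lfun_basis_inj (W : vectType K) (D E : 'Hom(T, W)) :
  (forall i, D (basis i) = E (basis i)) -> D = E.
Proof.
move=> DE; apply/lfunP=> u; rewrite (coord_sumE u) !linear_sum.
by apply: eq_bigr => i _; rewrite !linearZ /= DE.
Qed.

Lemma coord_mul u v k :
  coord (u ** v) k = \sum_i \sum_j coord u i * coord v j * sconst i j k.
Proof.
rewrite {1}(coord_sumE u) smul_suml coord_sum; apply: eq_bigr => i _.
rewrite {1}(coord_sumE v) smul_sumr coord_sum; apply: eq_bigr => j _.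
by rewrite smulZl smulZr !coordZ coord_mul_basis mulrA.
Qed.

End TableBasis.

Section LfunOfRow.
Variables (K : fieldType) (t : table K).
Let n := (n0 t + n1 t)%N.
Let T := table_alg t.

Definition lfun_of_row_fun (x : 'rV[K]_(n * n)) (u : T) : T :=
  \sum_i \sum_j (coord u i * x 0 (sqr_index i j)) *: basis j.

Fact lfun_of_row_fun_linear x : linear (lfun_of_row_fun x).
Proof.
move=> k u v; rewrite scaler_sumr -big_split; apply: eq_bigr => i _ /=.
rewrite scaler_sumr -big_split; apply: eq_bigr => j _ /=.
by rewrite scalerA -scalerDl coordD coordZ mulrDl mulrA.
Qed.

HB.instance Definition _ x :=
  GRing.isLinear.Build K T T *:%R (lfun_of_row_fun x) (lfun_of_row_fun_linear x).

Definition lfun_of_row x : 'End(T) := linfun (lfun_of_row_fun x).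

Lemma lfun_of_rowE x i j : coord (lfun_of_row x (basis i)) j = x 0 (sqr_index i j).
Proof.
rewrite lfunE /= /lfun_of_row_fun (bigD1 i) //= [X in _ + X]big1 ?addr0; last first.
  move=> k /negPf ki; apply: big1 => l _.
  by rewrite coord_basis_vector ki mul0r scale0r.
by rewrite coord_sum_basis coord_basis_vector eqxx mul1r.
Qed.

Fact lfun_of_row_linear : linear lfun_of_row.
Proof.
move=> k x y; apply: lfun_basis_inj => i; apply: coord_inj => j.
rewrite add_lfunE scale_lfunE coordD coordZ !lfun_of_rowE.
by rewrite !mxE.
Qed.

HB.instance Definition _ :=
  GRing.isLinear.Build K 'rV[K]_(n * n) 'End(T) *:%R lfun_of_row lfun_of_row_linear.

Lemma lfun_of_row_inj : injective lfun_of_row.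
Proof.
move=> x y xy; apply/rowP=> m; rewrite -(sqr_indexK m).
by rewrite -!lfun_of_rowE xy.
Qed.

End LfunOfRow.

(** Both conditions are linear once parities are fixed, so they are equivalent to finitely many
    equations in the matrix entries of [D]. *)
Lemma gen_derivation_basis (K : fieldType) (t : table K) (T := table_alg t) d a b c (D : 'End(T)) :
  gen_derivation d a b c D <->
  (forall i j : 'I_(n0 t + n1 t), odd_index t i (+) odd_index t j != d -> coord (D (basis i)) j = 0) /\
  (forall i j k : 'I_(n0 t + n1 t),
     a * coord (D (basis i ** basis j)) k =
     b * coord (D (basis i) ** basis j) k
     + c * (if d && odd_index t i then -1 else 1) * coord (basis i ** D (basis j)) k).
Proof.
split=> [[gD mD] | [gD mD]]; split.
- move=> i j ij; apply: coord_part (gD _ _ (basis_part i)) _.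
  by apply: contraNneq ij => ->; rewrite addbC addbK.
- move=> i j k; rewrite -!coordZ (mD (odd_index t i)) ?basis_part // coordD.
  congr (_ + coord (_ *: _) _).
  by case: (d) (odd_index t i) => [] [].
- move=> i x xi; rewrite (coord_sumE x) linear_sum; apply: rpred_sum => j _.
  rewrite linearZ /=; have [ji|/(coord_part xi)->] := eqVneq (odd_index t j) i; last first.
    by rewrite scale0r mem0v.
  apply: rpredZ; apply: mem_part => k kj; apply: gD; apply: contraNneq kj => <-.
  by rewrite ji addbC addKb.
move=> i x y xi.
rewrite (coord_sumE x) !(smul_suml, linear_sum) ?scaler_sumr -big_split.
apply: eq_bigr => p _ /=.
(* Only basis vectors of the parity of [x] occur in [x], so the sign in the Leibniz rule is the same
   for all of them. *)
have [pi|/(coord_part xi)->] := eqVneq (odd_index t p) i; last first.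
  by rewrite !(scale0r, smul0l, linear0, scaler0, addr0).
rewrite (coord_sumE y) !(smul_sumr, linear_sum) ?scaler_sumr -big_split.
apply: eq_bigr => q _ /=; apply: coord_inj => k.
rewrite !(smulZl, smulZr, linearZ) /= !(coordD, coordZ).
have -> : (-1) ^+ (d * i) = (if d && odd_index t p then -1 else 1) :> K.
  by rewrite -pi; case: (d) (odd_index t p) => [] [].
by rewrite mD; ring.
Qed.

(* [ci i j k] is the double of a structure constant, so that computations take
   place in [int]. *)
Definition half_integral (K : fieldType) (t : table K) (ci : nat -> nat -> nat -> int) :=
  forall i j k, sconst t i j k = (ci i j k)%:~R / 2.

(** * The linear system of the generalized derivations *)

Section LinearSystem.
Variables (m n : nat) (ci : nat -> nat -> nat -> int) (d : bool) (a b c : int).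
Let odd i := (m <= i)%N.

Definition parity_row (i j : nat) : seq int :=
  if odd i (+) odd j == d then [::]
  else mkseq (fun m => if m == (i * n + j)%N then 1 else 0) (n * n).

(** Unknown [m] is the coefficient of the basis vector [q] in the image of the basis vector [p]. The
    row is twice the [k]-th coordinate of the generalized Leibniz rule on the basis vectors [i] and
    [j], since [ci] doubles the structure constants. *)
Definition leibniz_row (i j k : nat) : seq int :=
  mkseq (fun m => let p := (m %/ n)%N in let q := (m %% n)%N in
    (if q == k then a * ci i j p else 0)
    - (if p == i then b * ci q j k else 0)
    - (if p == j then c * (if d && odd i then -1 else 1) * ci i q k else 0))
    (n * n).

Definition gen_derivation_system : seq (seq int) :=
  let I := iota 0 n in
  undup [seq r <- [seq parity_row i j | i <- I, j <- I]
                  ++ [seq leibniz_row ij.1 ij.2 k | ij <- [seq (i, j) | i <- I, j <- I], k <- I]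
        | has (predC1 0) r].

End LinearSystem.

Section GenDerivationSpace.
Variables (K : numFieldType) (t : table K) (ci : nat -> nat -> nat -> int).
Hypothesis half_ci : half_integral t ci.
Variables (d : bool) (a b c : int).
Let n := (n0 t + n1 t)%N.
Let T := table_alg t.
Notation system := (gen_derivation_system (n0 t) n ci d a b c).
Notation endo := (@lfun_of_row K t).
Notation toK := (map (map (intr : int -> K))).

Lemma system_solution x : solution (toK system) x <->
  (forall i j : 'I_n, \sum_(l < n * n) ((parity_row (n0 t) n d i j)`_l)%:~R * x 0 l = 0) /\
  (forall i j k : 'I_n,
     \sum_(l < n * n) ((leibniz_row (n0 t) n ci d a b c i j k)`_l)%:~R * x 0 l = 0).
Proof.
have nth_intr (r : seq int) l : (map (intr : int -> K) r)`_l = (r`_l)%:~R.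
  have [lr|rl] := ltnP l (size r); first by rewrite (nth_map 0).
  by rewrite !nth_default ?size_map.
rewrite solution_map; split=> [H | [Hp Hl] r].
  have {}H r : has (predC1 0) r ==> (r \in system) ->
      \sum_(l < n * n) (r`_l)%:~R * x 0 l = 0.
    case: (boolP (has _ r)) => [rn0 rs|/hasPn r0 _].
      by rewrite -{}[RHS](H r rs); apply: eq_bigr => l _; rewrite nth_intr.
    apply: big1 => l _; have [lr|rl] := ltnP l (size r).
      by have := r0 _ (mem_nth 0 lr); rewrite /= negbK => /eqP->; rewrite mul0r.
    by rewrite nth_default // mul0r.
  split=> [i j | i j k]; apply: H; apply/implyP=> rn0;
    rewrite mem_undup mem_filter rn0 mem_cat; apply/orP; [left|right]; apply/allpairsP.
    by exists (nat_of_ord i, nat_of_ord j); rewrite !mem_iota !add0n /= !ltn_ord.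
  exists ((nat_of_ord i, nat_of_ord j), nat_of_ord k); rewrite !mem_iota !add0n /= ltn_ord.
  split=> //; apply/allpairsP.
  by exists (nat_of_ord i, nat_of_ord j); rewrite !mem_iota !add0n /= !ltn_ord.
rewrite mem_undup mem_filter => /andP[_]; under eq_bigr do rewrite nth_intr.
rewrite mem_cat => /orP[/allpairsP[[i j] [+ + ->]] | /allpairsP[[ij k] [+ + ->]]].
  rewrite !mem_iota !add0n => /= li lj.
  exact: (Hp (Ordinal li) (Ordinal lj)).
move=> /allpairsP[[i j] [+ + ->]]; rewrite !mem_iota !add0n => /= li lj lk.
exact: (Hl (Ordinal li) (Ordinal lj) (Ordinal lk)).
Qed.

Lemma gen_derivation_solution x :
  gen_derivation d a%:~R b%:~R c%:~R (endo x) <-> solution (toK system) x.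
Proof.
rewrite gen_derivation_basis system_solution.
have parityE (i j : 'I_n) : odd_index t i (+) odd_index t j != d ->
    \sum_(l < n * n) ((parity_row (n0 t) n d i j)`_l)%:~R * x 0 l =
    coord (endo x (basis i)) j.
  move=> /negPf ij; rewrite lfun_of_rowE /parity_row ij.
  rewrite (bigD1 (sqr_index i j)) //= nth_mkseq ?eqxx ?mul1r ?sqr_index_lt //.
  rewrite big1 ?addr0 // => l lij; rewrite nth_mkseq //.
  have -> : (l == (i * n + j)%N :> nat) = false by exact: negPf lij.
  by rewrite mul0r.
have leibnizE (i j k : 'I_n) :
    \sum_(l < n * n) ((leibniz_row (n0 t) n ci d a b c i j k)`_l)%:~R * x 0 l =
    2 * (a%:~R * coord (endo x (basis i ** basis j)) k -
         (b%:~R * coord (endo x (basis i) ** basis j) k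
          + c%:~R * (if d && odd_index t i then -1 else 1)
            * coord (basis i ** endo x (basis j)) k)).
  pose X (p q : 'I_n) := x 0 (sqr_index p q).
  have DE (p : 'I_n) : endo x (basis p) = \sum_q X p q *: basis q.
    by apply: coord_inj => q; rewrite lfun_of_rowE coord_sum_basis.
  have sum1 (h : 'I_n -> K) (l : 'I_n) :
      \sum_(p < n) (if p == l :> nat then h p else 0) = h l.
    rewrite (bigD1 l) //= eqxx big1 ?addr0 // => p /negPf pl.
    by rewrite -[_ == _ :> nat]/(p == l) pl.
  have ciE p q r : (ci p q r)%:~R = 2 * sconst t p q r.
    by rewrite half_ci mulrC divfK // pnatr_eq0.
  transitivity (2 * \sum_(p < n) \sum_(q < n)
      (((if q == k :> nat then a%:~R * sconst t i j p * X p q else 0)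
      - (if p == i :> nat then b%:~R * sconst t q j k * X p q else 0))
      - (if p == j :> nat then c%:~R * (if d && odd_index t i then -1 else 1)
                                 * sconst t i q k * X p q else 0))).
    rewrite sum_sqr_index mulr_sumr; apply: eq_bigr => p _; rewrite mulr_sumr.
    apply: eq_bigr => q _; rewrite nth_mkseq ?sqr_index_lt //.
    rewrite -[(_ %/ n)%N]/(nat_of_ord (sqr_fst (sqr_index p q))) sqr_fstK.
    rewrite -[(_ %% n)%N]/(nat_of_ord (sqr_snd (sqr_index p q))) sqr_sndK.
    rewrite /= !intrB -/(odd_index t i).
    do 3 case: (_ == _ :> nat);
      case: (d && odd_index t i); rewrite ?rmorph0 ?rmorphM ?rmorphN ?rmorph1 /= ?ciE /X; ring.
  congr (2 * _); under eq_bigr do rewrite !sumrB sum1.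
  rewrite !sumrB -addrA -opprD; congr (_ - (_ + _)).
  - rewrite mul_basis linear_sum coord_sum mulr_sumr; apply: eq_bigr => p _.
    by rewrite linearZ coordZ lfun_of_rowE mulrA.
  - rewrite exchange_big /= DE smul_suml coord_sum mulr_sumr; apply: eq_bigr => q _.
    by rewrite sum1 smulZl coordZ coord_mul_basis mulrAC mulrA.
  rewrite exchange_big /= DE smul_sumr coord_sum mulr_sumr; apply: eq_bigr => q _.
  by rewrite sum1 smulZr coordZ coord_mul_basis mulrAC mulrA.
split=> -[gD mD]; split=> [i j | i j k].
- have [dij|ij] := eqVneq (odd_index t i (+) odd_index t j) d; last by rewrite parityE // gD.
  by rewrite /parity_row -!/(odd_index t _) dij eqxx; apply: big1 => l _; rewrite nth_nil mul0r.
- by rewrite leibnizE mD subrr mulr0.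
- by move=> ij; rewrite -parityE // gD.
apply/eqP; rewrite -subr_eq0; have := leibnizE i j k; rewrite mD => /esym/eqP.
by rewrite mulf_eq0 pnatr_eq0.
Qed.

Lemma gen_derivation_space :
  exists2 U : {vspace 'End(T)}, forall D, D \in U <-> gen_derivation d a%:~R b%:~R c%:~R D
    & \dim U = nullity (n * n) system.
Proof.
have [|D|U UP Ud] := solution_space (s := toK system) (psi := endo)
  (P := gen_derivation d a%:~R b%:~R c%:~R).
- exact: lfun_of_row_inj.
- split=> [gD | [x -> /gen_derivation_solution//]].
  pose x : 'rV_(n * n) := \row_l coord (D (basis (sqr_fst l))) (sqr_snd l).
  have Dx : D = endo x.
    apply: lfun_basis_inj => i; apply: coord_inj => j.
    by rewrite lfun_of_rowE mxE sqr_fstK sqr_sndK.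
  by exists x => //; apply/gen_derivation_solution; rewrite -Dx.
exists U => //; rewrite Ud nullity_map //; exact: intr_inj.
Qed.

End GenDerivationSpace.

(** * Reduction of scalars to the rationals and the integers *)

Section MapTable.
Variables (K K' : fieldType) (phi : {rmorphism K -> K'}).

Definition map_entry I I' (p : I * I' * K * I') : I * I' * K' * I' :=
  let: (a, b, c, l) := p in (a, b, phi c, l).

Definition map_table (t : table K) : table K' :=
  Table (n0 t) (n1 t) (map (@map_entry _ _) (tab0 t)) (map (@map_entry _ _) (tab1 t)).

Definition map_row (r : Defs.row K) : Defs.row K' :=
  Row (orbit_dim r) (summands r)
    (map (@map_entry _ _) (Defs.row0 r)) (map (@map_entry _ _) (Defs.row1 r)).

Lemma sconst_map t i j k : sconst (map_table t) i j k = phi (sconst t i j k).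
Proof.
rewrite /sconst !foldrE !big_cat /= !big_map !big_filter !big_map /= rmorphD !rmorph_sum /=.
by congr (_ + _); apply: eq_big => -[[[a b] c] l].
Qed.

End MapTable.

(** Morphisms of fields fix 1 and 1/2, the only coefficients in the table. Facts computed for
    [rows rat] thereby concern [rows K] for every [K] of characteristic 0. *)
Lemma rows_map (K K' : fieldType) (phi : {rmorphism K -> K'}) :
  rows K' = map_tuple (map_row phi) (rows K).
Proof.
apply: val_inj.
have h1 : phi 1 = 1 by rewrite rmorph1.
have h2 : phi 2^-1 = 2^-1 by rewrite fmorphV rmorph_nat.
rewrite [RHS]/= /map_row /map_entry.
cbn [map Defs.row0 Defs.row1 orbit_dim summands].
by rewrite h1 h2.
Qed.

Section IntegerConstants.

(** The shift [s] puts odd indices after the even ones. [numq (2 * c)] equals [2 * c] only for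
    half-integral [c], which [half_integral_check] verifies. *)
Definition int_entry m n (s : nat) (p : 'I_m * 'I_n * rat * 'I_n) : nat * nat * int * nat :=
  let: (a, b, c, l) := p in (nat_of_ord a, (s + b)%N, numq (2 * c), (s + l)%N).

Definition int_entries (t : table rat) : seq (nat * nat * int * nat) :=
  map (int_entry 0) (tab0 t) ++ map (int_entry (n0 t)) (tab1 t).

Definition int_sconst (e : seq (nat * nat * int * nat)) (i j k : nat) : int :=
  foldr +%R 0
    [seq p.1.2 | p <- e & let: (a, b, _, l) := p in
       ((a == i) && (b == j) || (a == j) && (b == i)) && (l == k)].

Definition half_integral_check (t : table rat) :=
  all (fun c => c == (numq (2 * c))%:~R / 2)
    ([seq p.1.2 | p <- tab0 t] ++ [seq p.1.2 | p <- tab1 t]).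

Variables (K : numFieldType) (phi : {rmorphism rat -> K}) (t : table rat).

Lemma half_integral_checkP : half_integral_check t ->
  half_integral (map_table phi t) (int_sconst (int_entries t)).
Proof.
rewrite /half_integral_check all_cat !all_map => /andP[/allP H0 /allP H1] i j k.
rewrite sconst_map /sconst /int_sconst !foldrE !big_map big_filter big_cat /=.
rewrite !big_map !big_filter !big_cat /= !big_map /= !(rmorphD, rmorph_sum) mulrDl /= !mulr_suml.
congr (_ + _); rewrite [LHS]big_seq_cond [RHS]big_seq_cond;
  apply: eq_big => [[[[a b] c] l] // | [[[a b] c] l] /andP[pt _]] /=.
  by rewrite [c in LHS](eqP (H0 _ pt)) rmorphM rmorph_int fmorphV rmorph_nat.
by rewrite [c in LHS](eqP (H1 _ pt)) rmorphM rmorph_int fmorphV rmorph_nat.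
Qed.

End IntegerConstants.

Definition row_table (K : fieldType) (r : Defs.row K) : table K :=
  Table 3 1 (Defs.row0 r) (Defs.row1 r).

Lemma half_integral_rows : all (fun r => half_integral_check (row_table r)) (rows rat).
Proof. by vm_cast_no_check (erefl true). Qed.

(** * The Jordan identity in a table algebra *)

Section JordanDefect.
Variables (K : fieldType) (A : superalgebra K).

(** The Jordan identity without signs: multilinear in arbitrary arguments, hence testable on a
    basis. *)
Definition jordan_defect (x y z u : A) : A :=
  ((x ** y) ** z) ** u + ((x ** u) ** z) ** y + ((y ** u) ** z) ** x
  - ((x ** y) ** (z ** u) + (x ** u) ** (y ** z) + (x ** z) ** (y ** u)).

Let linear_id : linear (id : A -> A). Proof. by []. Qed.

Let linear_add (g h : A -> A) : linear g -> linear h -> linear (fun x => g x + h x).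
Proof. by move=> gl hl c x y; rewrite gl hl scalerDr addrACA. Qed.

Let linear_opp (g : A -> A) : linear g -> linear (fun x => - g x).
Proof. by move=> gl c x y; rewrite gl scalerN opprD. Qed.

Let linear_mull (g : A -> A) y : linear g -> linear (fun x => g x ** y).
Proof. by move=> gl c x z; rewrite gl smulDl smulZl. Qed.

Let linear_mulr (g : A -> A) y : linear g -> linear (fun x => y ** g x).
Proof. by move=> gl c x z; rewrite gl smulDr smulZr. Qed.

Lemma jordan_defect_linear :
  [/\ forall y z u, linear (fun x => jordan_defect x y z u),
      forall x z u, linear (fun y => jordan_defect x y z u),
      forall x y u, linear (fun z => jordan_defect x y z u)
    & forall x y z, linear (fun u => jordan_defect x y z u)].
Proof.
split=> x y z; rewrite /jordan_defect;
  repeat first [exact: linear_id | apply: linear_add | apply: linear_opp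
               | apply: linear_mull | apply: linear_mulr].
Qed.

End JordanDefect.

Section TableType.
Variables (K : fieldType) (t : table K).
Let T := table_alg t.

Lemma table_dim : \dim {:T} = (n0 t + n1 t)%N.
Proof.
rewrite dimvf -[LHS]/(dim 'rV[K]_(n0 t) + dim 'rV[K]_(n1 t))%N !dim_matrix.
by congr (_ + _)%N; apply: mul1n.
Qed.

Lemma table_has_type : has_type T (n0 t) (n1 t).
Proof.
split.
  pose h := linfun (@fst 'rV[K]_(n0 t) 'rV[K]_(n1 t)).
  rewrite -(limg_ker_dim h) [X in \dim X](_ : _ = 0%VS); last first.
    apply/eqP; rewrite -subv0; apply/subvP=> -[x y].
    by rewrite memv_cap memv_ker lfunE mem_pairv !memv0 /= => /andP[/andP[_ /eqP->] /eqP->].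
  rewrite dimv0 add0n (_ : (h @: _)%VS = fullv) ?dimvf ?dim_matrix; first exact: mul1n.
  apply/eqP; rewrite eqEsubv subvf; apply/subvP=> x _; apply/memv_imgP.
  by exists (x, 0); rewrite ?lfunE // mem_pairv /= !(memvf, memv0) eqxx.
pose h := linfun (@snd 'rV[K]_(n0 t) 'rV[K]_(n1 t)).
rewrite -(limg_ker_dim h) [X in \dim X](_ : _ = 0%VS); last first.
  apply/eqP; rewrite -subv0; apply/subvP=> -[x y].
  by rewrite memv_cap memv_ker lfunE mem_pairv !memv0 /= => /andP[/andP[/eqP-> _] /eqP->].
rewrite dimv0 add0n (_ : (h @: _)%VS = fullv) ?dimvf ?dim_matrix; first exact: mul1n.
apply/eqP; rewrite eqEsubv subvf; apply/subvP=> x _; apply/memv_imgP.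
by exists (0, x); rewrite ?lfunE // mem_pairv /= !(memvf, memv0) eqxx.
Qed.

Lemma coordN u i : @coord K t (- u) i = - coord u i.
Proof. by rewrite -scaleN1r coordZ mulN1r. Qed.

Lemma linear_basis0 (h : T -> T) : linear h -> (forall i, h (basis i) = 0) -> forall u, h u = 0.
Proof.
move=> hl h0 u.
pose hL := GRing.isLinear.Build K T T *:%R h hl.
pose hh : {linear T -> T} := HB.pack h hL.
rewrite (coord_sumE u) -[h _]/(hh _) linear_sum big1 // => i _.
by rewrite linearZ /= h0 scaler0.
Qed.

Lemma jordan_defect_basis :
  (forall i j k l, @jordan_defect K T (basis i) (basis j) (basis k) (basis l) = 0) ->
  forall x y z u : T, jordan_defect x y z u = 0.
Proof.
have [lx ly lz lu] := @jordan_defect_linear K T.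
move=> H x y z u; apply: (linear_basis0 (lx y z u)) => i.
apply: (linear_basis0 (ly _ z u)) => j; apply: (linear_basis0 (lz _ _ u)) => k.
by apply: (linear_basis0 (lu _ _ _)) => l.
Qed.

(** With two odd factors, some intermediate product multiplies two odd elements, and such products
    are zero in a table algebra. *)
Lemma table_mul4_odd (i j k l : bool) (x y z u : T) : (1 < i + j + k + l)%N ->
  x \in part T i -> y \in part T j -> z \in part T k -> u \in part T l ->
  ((x ** y) ** z) ** u = 0 /\ (x ** y) ** (z ** u) = 0.
Proof.
move=> odd2 xi yj zk ul.
have xy := smul_part xi yj; have zu := smul_part zk ul.
have xyz := smul_part xy zk.
case: i j k l odd2 xi yj zk ul xy zu xyz => [] [] [] [] //= _ xi yj zk ul xy zu xyz;
  rewrite ?(table_mul_odd xi yj) ?(table_mul_odd xy zk) ?(table_mul_odd xyz ul)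
          ?(table_mul_odd zk ul) ?(table_mul_odd xy zu) ?smul0l ?smul0r //.
Qed.

(** With at least two odd arguments all six terms vanish; with at most one, every exponent of -1 is
    zero. So signs never matter. *)
Lemma table_jordan : (forall x y z u : T, jordan_defect x y z u = 0) -> jordan_superalgebra T.
Proof.
move=> H; split; first exact: table_supercommutative.
move=> i j k l x y z u xi yj zk ul.
have [odd2 | odd1] := ltnP 1 (i + j + k + l).
  have [-> ->] := table_mul4_odd odd2 xi yj zk ul.
  have odd2' : (1 < i + l + k + j)%N by case: i j k l odd2 {xi yj zk ul} => [] [] [] [].
  have odd2'' : (1 < j + l + k + i)%N by case: i j k l odd2 {xi yj zk ul odd2'} => [] [] [] [].
  have odd2''' : (1 < i + k + j + l)%N by rewrite [(i + k + j)%N]addnAC.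
  have [-> H1] := table_mul4_odd odd2' xi ul zk yj.
  have [-> _] := table_mul4_odd odd2'' yj ul zk xi.
  have [_ ->] := table_mul4_odd odd2''' xi zk yj ul.
  by rewrite [y ** z]table_mulC H1 !scaler0.
have e1 : (j * k + j * l + k * l = 0)%N by case: i j k l odd1 {xi yj zk ul} => [] [] [] [].
have e2 : (i * j + i * k + i * l + k * l = 0)%N by case: i j k l odd1 {e1 xi yj zk ul} => [] [] [] [].
have e3 : (l * (j + k) = 0)%N by case: i j k l odd1 {e1 e2 xi yj zk ul} => [] [] [] [].
have e4 : (j * k = 0)%N by case: i j k l odd1 {e1 e2 e3 xi yj zk ul} => [] [] [] [].
rewrite e1 e2 e3 e4 expr0 !scale1r; apply/eqP; rewrite -subr_eq0.
by rewrite [X in X == 0]H.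
Qed.

End TableType.

Section IntegerLists.
Variables (n : nat) (ci : nat -> nat -> nat -> int).
Implicit Types s : seq int.

Definition list_unit (i : nat) : seq int := mkseq (fun k => (k == i)%:R) n.

Definition list_add s s' : seq int := mkseq (fun k => s`_k + s'`_k) n.

Definition list_mul s s' : seq int :=
  let supp r := [seq i <- iota 0 n | r`_i != 0] in
  mkseq (fun k => foldr +%R 0 [seq s`_i * s'`_j * ci i j k | i <- supp s, j <- supp s']) n.

(** [list_mul] computes twice the product. Each term of the identity contains three products, so
    both sides are multiplied by the same factor 8. *)
Definition jordan_check : bool :=
  let I := map list_unit (iota 0 n) in
  all (fun x => all (fun y => let xy := list_mul x y in
    all (fun z => let xyz := list_mul xy z in all (fun u =>
    let xu := list_mul x u in let yu := list_mul y u in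
    list_add (list_add (list_mul xyz u) (list_mul (list_mul xu z) y))
             (list_mul (list_mul yu z) x) ==
    list_add (list_add (list_mul xy (list_mul z u)) (list_mul xu (list_mul y z)))
             (list_mul (list_mul x z) yu)) I) I) I) I.

Definition nonzero_check : bool :=
  let I := iota 0 n in
  has (fun i => has (fun j => has (fun k => ci i j k != 0) I) I) I.

End IntegerLists.

Section Checks.
Variables (K : numFieldType) (t : table K) (ci : nat -> nat -> nat -> int).
Hypothesis half_ci : half_integral t ci.
Let n := (n0 t + n1 t)%N.
Let T := table_alg t.
Notation list_unit := (list_unit n).
Notation list_add := (list_add n).
Notation list_mul := (list_mul n ci).

Definition of_list (s : seq int) : T := \sum_(i < n) (s`_i)%:~R *: @basis K t i.

Lemma coord_of_list s i : coord (of_list s) i = (s`_i)%:~R.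
Proof. exact: coord_sum_basis. Qed.

Lemma of_list_unit (i : 'I_n) : of_list (list_unit i) = @basis K t i.
Proof.
apply: coord_inj => k; rewrite coord_of_list nth_mkseq ?ltn_ord //.
by rewrite rmorph_nat coord_basis_vector.
Qed.

Lemma of_list_add s s' : of_list (list_add s s') = of_list s + of_list s'.
Proof.
apply: coord_inj => k; rewrite coordD !coord_of_list nth_mkseq ?ltn_ord //.
exact: rmorphD.
Qed.

Lemma of_list_mul s s' : of_list (list_mul s s') = 2 *: (of_list s ** of_list s').
Proof.
apply: coord_inj => k; rewrite coordZ coord_mul coord_of_list nth_mkseq ?ltn_ord //.
rewrite foldrE big_allpairs_dep rmorph_sum big_filter big_mkcond mulr_sumr /=.
rewrite -{1}[n]subn0 -/(index_iota 0 n) big_mkord; apply: eq_bigr => i _.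
rewrite coord_of_list mulr_sumr; case: eqP => [-> | _] /=.
  by rewrite big1 // => j _; rewrite rmorph0 !mul0r mulr0.
rewrite rmorph_sum big_filter big_mkcond /=.
rewrite -{1}[n]subn0 -/(index_iota 0 n) big_mkord; apply: eq_bigr => j _.
rewrite coord_of_list half_ci; case: eqP => [-> | _] /=.
  by rewrite rmorph0 mulr0 mul0r mulr0.
by rewrite !rmorphM /=; field.
Qed.

Lemma jordan_checkP : jordan_check n ci -> jordan_superalgebra T.
Proof.
move=> H; apply/table_jordan/jordan_defect_basis => i j k l.
have I (p : 'I_n) : list_unit p \in map list_unit (iota 0 n).
  by apply: map_f; rewrite mem_iota ltn_ord.
have /allP/(_ _ (I i))/allP/(_ _ (I j))/allP/(_ _ (I k))/allP/(_ _ (I l))/eqP := H.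
move/(congr1 of_list); rewrite !of_list_add !of_list_mul !of_list_unit.
rewrite !(smulZl, smulZr, scalerA) -!scalerDr => /eqP.
have nz8 : 2 * 2 * 2 != 0 :> K by rewrite -!natrM pnatr_eq0.
by rewrite -subr_eq0 -scalerBr scaler_eq0 (negPf nz8) => /eqP.
Qed.

Lemma nonzero_checkP : nonzero_check n ci -> ~ zero_product T.
Proof.
case/hasP=> i; rewrite mem_iota => /= iI /hasP[j]; rewrite mem_iota => /= jI.
case/hasP=> k; rewrite mem_iota => /= kI nz H; case/eqP: nz; apply: (@intr_inj K).
have := half_ci i j k.
rewrite -(@coord_mul_basis K t (Ordinal iI) (Ordinal jI) (Ordinal kI)) H coord0.
by move=> /esym/eqP; rewrite mulf_eq0 invr_eq0 pnatr_eq0 orbF => /eqP.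
Qed.

End Checks.

Definition row_sconst (r : Defs.row rat) := int_sconst (int_entries (row_table r)).

Lemma jordan_check_rows : all (fun r => jordan_check 4 (row_sconst r)) (rows rat).
Proof. by vm_cast_no_check (erefl true). Qed.

Lemma nonzero_check_rows : all (fun r => nonzero_check 4 (row_sconst r)) (rows rat).
Proof. by vm_cast_no_check (erefl true). Qed.

Definition ratr_table (K : numFieldType) := map_table (@ratr K).

(** * The 59 algebras: identities, orbit dimensions, separation *)

Section Rows.
Variable K : numFieldType.
Implicit Types k l : 'I_59.

Definition J_row k : Defs.row rat := tnth (rows rat) k.
Definition J_table k : table K := ratr_table K (row_table (J_row k)).
Definition J_sconst k := row_sconst (J_row k).

Lemma JE k : J K k = table_alg (J_table k).
Proof. by rewrite /J (rows_map (@ratr K)) tnth_map. Qed.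

Lemma J_orbit_dimE k : J_orbit_dim K k = orbit_dim (J_row k).
Proof. by rewrite /J_orbit_dim (rows_map (@ratr K)) tnth_map. Qed.

Lemma J_summandsE k : J_summands K k = summands (J_row k).
Proof. by rewrite /J_summands (rows_map (@ratr K)) tnth_map. Qed.

Lemma J_half_integral k : half_integral (J_table k) (J_sconst k).
Proof. by apply: half_integral_checkP; have /all_tnthP/(_ k) := half_integral_rows. Qed.

Lemma J_jordan k : jordan_superalgebra (J K k).
Proof.
rewrite JE; apply: (jordan_checkP (J_half_integral k)).
by have /all_tnthP/(_ k) := jordan_check_rows.
Qed.

Lemma J_has_type k : has_type (J K k) 3 1.
Proof. by rewrite JE; apply: table_has_type. Qed.

Lemma J_nonzero k : ~ zero_product (J K k).
Proof.
rewrite JE; apply: (nonzero_checkP (J_half_integral k)).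
by have /all_tnthP/(_ k) := nonzero_check_rows.
Qed.

Definition der_dim (r : Defs.row rat) (d : bool) (a b c : int) : nat :=
  nullity 16 (gen_derivation_system 3 4 (row_sconst r) d a b c).

Lemma orbit_dim_check :
  all (fun r => 16 - (der_dim r false 1 1 1 + der_dim r true 1 1 1) == orbit_dim r)%N (rows rat).
Proof. by vm_cast_no_check (erefl true). Qed.

Lemma J_has_orbit_dim k : has_orbit_dim (J K k) (J_orbit_dim K k).
Proof.
rewrite JE J_orbit_dimE.
have [U UP Ud] := gen_derivation_space (J_half_integral k) false 1 1 1.
have [V VP Vd] := gen_derivation_space (J_half_integral k) true 1 1 1.
have -> : orbit_dim (J_row k) = (\dim {:table_alg (J_table k)} ^ 2 - (\dim U + \dim V))%N.
  have /all_tnthP/(_ k)/eqP <- := orbit_dim_check.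
  by rewrite table_dim [\dim U]Ud [\dim V]Vd.
exact: (has_orbit_dim_der UP VP).
Qed.

(** In order: the even maps with [D(x)y = xD(y)] (the quasicentroid), the even and the odd
    derivations, the odd centroid, the even maps with [D(xy) = 2xD(y)], the even centroid, and the
    odd maps whose Leibniz rule carries a factor 2. *)
Definition invariants (r : Defs.row rat) : seq nat :=
  [:: der_dim r false 0 (-1) 1; der_dim r false 1 1 1; der_dim r true 1 1 1;
      der_dim r true 1 0 1; der_dim r false 1 0 2; der_dim r false 1 0 1;
      der_dim r true 1 2 2].

Lemma invariants_uniq : uniq (map invariants (rows rat)).
Proof. by vm_cast_no_check (erefl true). Qed.

Lemma J_inj k l : isomorphic (J K k) (J K l) -> k = l.
Proof.
rewrite !JE => iso_kl.
have H d a b c : der_dim (J_row k) d a b c = der_dim (J_row l) d a b c.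
  have [U UP Ud] := gen_derivation_space (J_half_integral k) d a b c.
  have [V VP Vd] := gen_derivation_space (J_half_integral l) d a b c.
  by rewrite /der_dim -[LHS]Ud -[RHS]Vd; apply: gen_derivation_iso UP VP.
have E : invariants (J_row k) = invariants (J_row l) by rewrite /invariants !H.
have /tuple_uniqP inj_inv : uniq (map_tuple invariants (rows rat)) := invariants_uniq.
by apply: inj_inv; rewrite !tnth_map.
Qed.

End Rows.

(** * Indecomposability *)

Section FirstProjection.
Variables (K : fieldType) (V W : vectType K).

Definition proj_fst (u : V * W) : V * W := (u.1, 0).

Fact proj_fst_linear : linear proj_fst.
Proof. by move=> k u v; congr (_, _); rewrite /= scaler0 addr0. Qed.

HB.instance Definition _ :=
  GRing.isLinear.Build K (V * W)%type (V * W)%type *:%R proj_fst proj_fst_linear.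

End FirstProjection.

Lemma indecomposable_centroid (K : fieldType) (A : superalgebra K) :
  \dim {:A} <> 0%N ->
  (forall p : 'End(A), gen_derivation false 1 1 0 p ->
     (forall x, p (p x) = p x) -> (forall x, p x = 0) \/ (forall x, p x = x)) ->
  indecomposable A.
Proof.
move=> dimA idem; split=> // B C /isomorphic_inv[phi [psi [phiK psiK [phiM psiM] [phiP psiP]]]].
pose p : 'End(A) := (psi \o linfun (@proj_fst _ B C) \o phi)%VF.
have pE x : p x = psi ((phi x).1, 0) by rewrite !comp_lfunE lfunE.
have [||p0|p1] := idem p.
- split=> [i x xi | i x y xi].
    rewrite pE; apply: psiP; have := phiP _ _ xi.
    by rewrite !mem_pairv mem0v andbT => /andP[].
  rewrite mul0r scale0r addr0 !scale1r !pE phiM -[y in RHS]phiK -psiM.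
  by congr (psi _); congr (_, _); rewrite smul0l.
- by move=> x; rewrite !pE psiK.
- left; apply/eqP; rewrite dimv_eq0; apply/eqP/vspaceP => b; rewrite memvf memv0.
  have := congr1 (fst \o phi) (p0 (psi (b, 0))).
  by rewrite /= pE !psiK linear0 /= => ->; rewrite eqxx.
right; apply/eqP; rewrite dimv_eq0; apply/eqP/vspaceP => c; rewrite memvf memv0.
have := congr1 (snd \o phi) (p1 (psi (0, c))).
by rewrite /= pE !psiK /= => <-; rewrite eqxx.
Qed.

Section IndecomposableTable.
Variables (n0 n : nat) (ci : nat -> nat -> nat -> int) (w : seq nat).

Definition entry_row (i j : nat) : seq int :=
  mkseq (fun m => if m == (i * n + j)%N then 1 else 0) (n * n).

(* The equations for a matrix to be the sum of a scalar matrix and a strictly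
   triangular one, with respect to the order of the indices given by [w]. *)
Definition unipotent_rows : seq (seq int) :=
  [seq mkseq (fun m => (entry_row i i)`_m - (entry_row 0 0)`_m) (n * n) | i <- iota 0 n] ++
  [seq if (i != j) && (nth 0 w j <= nth 0 w i)%N then entry_row i j else [::]
     | i <- iota 0 n, j <- iota 0 n].

(** Equality of the nullities says that the equations of [unipotent_rows] follow from those of the
    even centroid. *)
Definition indecomposable_check : bool :=
  let s := gen_derivation_system n0 n ci false 1 1 0 in
  (0 < n)%N && (nullity (n * n) (unipotent_rows ++ s) == nullity (n * n) s).

End IndecomposableTable.

Section IndecomposableCheck.
Variables (K : numFieldType) (t : table K) (ci : nat -> nat -> nat -> int) (w : seq nat).
Hypothesis half_ci : half_integral t ci.
Let n := (n0 t + n1 t)%N.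
Let T := table_alg t.
Let wt (i : 'I_n) := nth 0%N w i.

(** Since [p = p \o p] and [p] strictly raises weights, descending induction on the weight kills
    every basis vector; [m] bounds the distance to the greatest weight. *)
Lemma triangular_idempotent0 (p : 'End(T)) :
  (forall x, p (p x) = p x) ->
  (forall i j : 'I_n, (wt j <= wt i)%N -> coord (p (basis i)) j = 0) -> p = 0.
Proof.
move=> pp p0.
suff H m (i : 'I_n) : (\max_(j < n) wt j <= wt i + m)%N -> p (basis i) = 0.
  apply: lfun_basis_inj => i; rewrite lfunE /=; apply: (H (\max_(j < n) wt j)).
  exact: leq_addl.
elim: m i => [|m IHm] i Hi; rewrite -pp (coord_sumE (p (basis i))) linear_sum big1 // => j _.
  rewrite linearZ /= p0 ?scale0r //; apply: leq_trans (leq_bigmax j) _.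
  by rewrite addn0 in Hi.
rewrite linearZ /=; have [/p0->|ij] := leqP (wt j) (wt i); first by rewrite scale0r.
rewrite (IHm j) ?scaler0 //; apply: leq_trans Hi _.
by rewrite addnS -addSn leq_add2r.
Qed.

Lemma indecomposable_checkP : indecomposable_check (n0 t) n ci w -> indecomposable T.
Proof.
case/andP=> n_gt0 /eqP nullE; apply: indecomposable_centroid.
  by apply/eqP; rewrite table_dim -lt0n.
move=> p pC pp.
have {}pC : gen_derivation false 1%:~R 1%:~R 0%:~R p := pC.
pose x : 'rV_(n * n) := \row_l coord (p (basis (sqr_fst l))) (sqr_snd l).
have px : p = lfun_of_row x.
  apply: lfun_basis_inj => i; apply: coord_inj => j.
  by rewrite lfun_of_rowE mxE sqr_fstK sqr_sndK.
move: (pC); rewrite px => /(gen_derivation_solution half_ci); rewrite -px => sol.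
have nth_intr (r : seq int) l : (map (intr : int -> K) r)`_l = (r`_l)%:~R.
  have [lr|rl] := ltnP l (size r); first by rewrite (nth_map 0).
  by rewrite !nth_default ?size_map.
have solR r : r \in unipotent_rows n w -> \sum_(l < n * n) (r`_l)%:~R * x 0 l = 0.
  move=> rR; have := nullity_consequence (s' := map (map (intr : int -> K)) (unipotent_rows n w)) _ sol.
  rewrite -map_cat !nullity_map; try exact: intr_inj.
  move=> /(_ nullE); rewrite solution_map => /(_ r rR) E; rewrite -[RHS]E.
  by apply: eq_bigr => l _; rewrite nth_intr.
pose X (i j : 'I_n) := x 0 (sqr_index i j).
have XE i j : coord (p (basis i)) j = X i j by rewrite px lfun_of_rowE.
have entryE (i j : 'I_n) :
    \sum_(l < n * n) ((entry_row n i j)`_l)%:~R * x 0 l = X i j.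
  rewrite (bigD1 (sqr_index i j)) //= nth_mkseq ?eqxx ?mul1r ?sqr_index_lt //.
  rewrite big1 ?addr0 // => l lij; rewrite nth_mkseq //.
  have -> : (l == (i * n + j)%N :> nat) = false by exact: negPf lij.
  by rewrite mul0r.
have lowX (i j : 'I_n) : i != j -> (wt j <= wt i)%N -> X i j = 0.
  move=> ij wij; rewrite -entryE; apply: solR; rewrite mem_cat; apply/orP; right.
  apply/allpairsP; exists (nat_of_ord i, nat_of_ord j); rewrite !mem_iota !add0n /= !ltn_ord.
  by split=> //; rewrite [(_ != _)]ij wij.
pose i0 : 'I_n := Ordinal n_gt0.
have diagX i : X i i = X i0 i0.
  apply/eqP; rewrite -subr_eq0 -!entryE -sumrB; apply/eqP.
  rewrite -[RHS](solR (mkseq (fun m => (entry_row n i i)`_m - (entry_row n 0 0)`_m) (n * n))).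
    by apply: eq_bigr => l _; rewrite [in RHS]nth_mkseq // intrB mulrBl.
  rewrite mem_cat; apply/orP; left; apply/mapP; exists (nat_of_ord i) => //.
  by rewrite mem_iota add0n /= ltn_ord.
have [a2|] : X i0 i0 = 0 \/ X i0 i0 = 1.
  (* A basis vector of greatest weight is an eigenvector of [p], and the eigenvalue of an idempotent
     is 0 or 1. *)
  have [i _ imax] := arg_maxnP wt (erefl : xpredT i0).
  have pi : p (basis i) = X i i *: basis i.
    apply: coord_inj => j; rewrite XE coordZ coord_basis_vector.
    have [->|ij] := eqVneq j i; first by rewrite mulr1.
    by rewrite mulr0; apply: lowX; [rewrite eq_sym | apply: imax].
  have := congr1 (fun u : T => coord u i) (pp (basis i)).
  rewrite pi linearZ /= pi !coordZ coord_basis_vector eqxx mulr1 diagX => /eqP.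
  rewrite -subr_eq0 -[X in _ - X]mulr1 -mulrBr mulf_eq0 subr_eq0.
  by case/orP=> /eqP->; [left | right].
- left=> y; rewrite (triangular_idempotent0 pp) ?lfunE // => i j wij.
  by rewrite XE; have [<-|/lowX->//] := eqVneq i j; rewrite diagX.
move=> a1; right=> y.
(* With diagonal 1, the complementary idempotent is the strictly triangular one. *)
have qq z : (\1 - p)%VF ((\1 - p)%VF z) = (\1 - p)%VF z.
  by rewrite !(add_lfunE, opp_lfunE, id_lfunE) linearB /= pp subrr subr0.
have /lfunP/(_ y) : (\1 - p)%VF = 0.
  apply: (triangular_idempotent0 qq) => i j wij.
  rewrite !(add_lfunE, opp_lfunE, id_lfunE) coordD coordN XE coord_basis_vector.
  have [ji|ij] := eqVneq j i; first by rewrite ji diagX a1 subrr.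
  by rewrite lowX ?subrr // eq_sym.
rewrite !(add_lfunE, opp_lfunE, id_lfunE) zero_lfunE => /eqP.
by rewrite subr_eq0 => /eqP.
Qed.

End IndecomposableCheck.

Lemma summand_tableE (K : numFieldType) s :
  summand_table K s = ratr_table K (summand_table rat s).
Proof.
have h1 : ratr 1 = 1 :> K by rewrite rmorph1.
have h2 : ratr (2^-1) = 2^-1 :> K by rewrite fmorphV rmorph_nat.
by case: s; rewrite /ratr_table /map_table /= ?h1 ?h2.
Qed.

Definition summand_sconst s := int_sconst (int_entries (summand_table rat s)).

Lemma summand_half_integral (K : numFieldType) s :
  half_integral (summand_table K s) (summand_sconst s).
Proof.
rewrite summand_tableE; apply: half_integral_checkP.
by case: s; vm_cast_no_check (erefl true).
Qed.

Lemma summand_indecomposable (K : numFieldType) s : indecomposable (summand_alg K s).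
Proof.
(* In [T4] an element of the centroid may send [e3] to [e2], which spans both the square and the
   annihilator, so [e2] must have the greatest weight. *)
pose w := if s is T4 then [:: 0; 2; 1]%N else iota 0 4.
apply: (indecomposable_checkP (w := w) (@summand_half_integral K s)).
by case: s @w; vm_cast_no_check (erefl true).
Qed.

Lemma indecomposable_check_rows :
  all (fun r => isSome (summands r) || indecomposable_check 3 4 (row_sconst r) (iota 0 4))
    (rows rat).
Proof. by vm_cast_no_check (erefl true). Qed.

Lemma J_indecomposable (K : numFieldType) k :
  summands (J_row k) = None -> indecomposable (J K k).
Proof.
move=> nsum; rewrite JE.
apply: (indecomposable_checkP (w := iota 0 4) (J_half_integral K k)).
rewrite -[n0 _]/3%N -[(_ + n1 _)%N]/4%N /J_sconst.
have /all_tnthP/(_ k) := indecomposable_check_rows.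
by rewrite -/(J_row k) nsum /isSome orFb.
Qed.

(** * Decompositions *)

Section IsomorphicTable.
Variables (K : fieldType) (t : table K) (A : superalgebra K).
Let n := (n0 t + n1 t)%N.
Let T := table_alg t.
Variable b : 'I_n -> A.

Definition table_to (u : T) : A := \sum_i coord u i *: b i.

Fact table_to_linear : linear table_to.
Proof.
move=> c u v; rewrite scaler_sumr -big_split; apply: eq_bigr => i _ /=.
by rewrite coordD coordZ scalerDl scalerA.
Qed.

HB.instance Definition _ := GRing.isLinear.Build K T A *:%R table_to table_to_linear.

Lemma isomorphic_table :
  \dim {:A} = n -> (forall i : 'I_n, b i \in part A (odd_index t i)) ->
  (forall c : 'I_n -> K, \sum_i c i *: b i = 0 -> forall i, c i = 0) ->
  (forall i j : 'I_n, b i ** b j = \sum_(k < n) sconst t i j k *: b k) ->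
  isomorphic A T.
Proof.
move=> dimA bP free_b bM; apply: isomorphic_sym.
have psiE u : linfun table_to u = table_to u by rewrite lfunE.
have inj_psi : injective (linfun table_to).
  move=> u v; rewrite !psiE => uv; apply/eqP; rewrite -subr_eq0; apply/eqP.
  apply: coord_inj => i; rewrite coord0.
  by apply: (free_b (coord (u - v))); rewrite -/(table_to (u - v)) linearB /= uv subrr.
have ker0 : lker (linfun table_to) == 0%VS by apply/lker0P.
exists (linfun table_to); split.
- exists ((linfun table_to)^-1)%VF; first exact: lker0_lfunK.
  move=> x; apply: limg_lfunVK; suff -> : limg (linfun table_to) = fullv by rewrite memvf.
  apply/eqP; rewrite eqEdim subvf dimA.
  by rewrite limg_dim_eq ?(eqP ker0) ?capv0 ?table_dim ?leqnn.
- move=> u v; rewrite !psiE /table_to.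
  rewrite smul_suml; under [RHS]eq_bigr => i _ do rewrite smul_sumr.
  under [LHS]eq_bigr => k _ do rewrite coord_mul scaler_suml.
  rewrite exchange_big; apply: eq_bigr => i _ /=.
  under [LHS]eq_bigr => k _ do rewrite scaler_suml.
  rewrite exchange_big; apply: eq_bigr => j _ /=.
  rewrite smulZl smulZr bM !scaler_sumr; apply: eq_bigr => k _.
  by rewrite !scalerA.
move=> e u ue; rewrite psiE; apply: rpred_sum => i _.
have [<-|/(coord_part ue)->] := eqVneq (odd_index t i) e; first exact/rpredZ/bP.
by rewrite scale0r mem0v.
Qed.

End IsomorphicTable.

(** A concatenation of tables lists its entries in another order and over index types that agree
    with those of a row only up to a cast, so the structure constants are compared instead of the
    tables. *)
Lemma isomorphic_table_eq (K : numFieldType) (t t' : table K) ci ci' :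
  half_integral t ci -> half_integral t' ci' -> n0 t = n0 t' -> n1 t = n1 t' ->
  (let n := (n0 t + n1 t)%N in
   all (fun i => all (fun j => all (fun k => ci i j k == ci' i j k)
     (iota 0 n)) (iota 0 n)) (iota 0 n)) ->
  isomorphic (table_alg t') (table_alg t).
Proof.
move=> hci hci' e0 e1 /= H.
have en : (n0 t + n1 t = n0 t' + n1 t')%N by rewrite e0 e1.
apply: (@isomorphic_table _ t (table_alg t') (fun i => @basis K t' (cast_ord en i))).
- by rewrite table_dim en.
- move=> i; have -> : odd_index t i = odd_index t' (cast_ord en i).
    exact: (congr1 (fun m => m <= i)%N e0).
  exact: basis_part.
- move=> c c0 i; have := congr1 (fun u => coord u (cast_ord en i)) c0.
  rewrite coord_sum coord0 (bigD1 i) //= coordZ coord_basis_vector eqxx mulr1 big1 ?addr0 // => j ji.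
  by rewrite coordZ coord_basis_vector (inj_eq (@cast_ord_inj _ _ _)) eq_sym (negPf ji) mulr0.
move=> i j; apply: coord_inj => k; rewrite coord_mul_basis coord_sum.
rewrite (bigD1 (cast_ord (esym en) k)) //= coordZ coord_basis_vector cast_ordKV eqxx mulr1.
rewrite big1 ?addr0 => [|l lk]; last first.
  rewrite coordZ coord_basis_vector -(inj_eq (@cast_ord_inj _ _ (esym en))) cast_ordK eq_sym.
  by rewrite (negPf lk) mulr0.
rewrite hci hci'; congr (_%:~R / _).
have I (p : 'I_(n0 t + n1 t)) : nat_of_ord p \in iota 0 (n0 t + n1 t).
  by rewrite mem_iota add0n ltn_ord.
have /allP/(_ _ (I i))/allP/(_ _ (I j))/allP := H.
move=> /(_ _ (I (cast_ord (esym en) k)))/eqP.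
by [].
Qed.

Section TableCat.
Variable K : fieldType.
Implicit Types t : table K.

Definition map_indices I I' J J' (h : I -> I') (g : J -> J') (p : I * J * K * J) :
    I' * J' * K * J' :=
  let: (a, b, c, l) := p in (h a, g b, c, g l).

(** The direct sum on the level of tables, with all even basis vectors before all odd ones. It
    brings a sum of summands within reach of the integer computations. *)
Definition table_cat t1 t2 : table K :=
  Table (n0 t1 + n0 t2) (n1 t1 + n1 t2)
    (map (map_indices (@lshift _ _) (@lshift _ _)) (tab0 t1) ++
     map (map_indices (@rshift _ _) (@rshift _ _)) (tab0 t2))
    (map (map_indices (@lshift _ _) (@lshift _ _)) (tab1 t1) ++
     map (map_indices (@rshift _ _) (@rshift _ _)) (tab1 t2)).

Lemma sum_row_mx m n I (r : seq I) (g : I -> 'rV[K]_m) (h : I -> 'rV[K]_n) :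
  \sum_(i <- r) row_mx (g i) (h i) = row_mx (\sum_(i <- r) g i) (\sum_(i <- r) h i).
Proof.
elim: r => [|i r IHr]; first by rewrite !big_nil row_mx0.
by rewrite !big_cons IHr add_row_mx.
Qed.

Lemma mul00_cat t1 t2 x1 y1 x2 y2 :
  @mul00 K (table_cat t1 t2) (row_mx x1 x2) (row_mx y1 y2) =
  row_mx (mul00 x1 y1) (mul00 x2 y2).
Proof.
rewrite {1}/mul00 big_cat !big_map.
have -> : row_mx (mul00 x1 y1) (mul00 x2 y2) =
    row_mx (mul00 x1 y1) 0 + row_mx 0 (mul00 x2 y2).
  by rewrite add_row_mx addr0 add0r.
have sum0 I (r : seq I) (V : nmodType) : \sum_(i <- r) (0 : V) = 0 by rewrite big1.
congr (_ + _).
  rewrite -[0 in RHS](sum0 _ (tab0 t1)) -sum_row_mx; apply: eq_bigr => -[[[a b] c] l] _ /=.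
  by rewrite eq_lshift !row_mxEl delta_mx_lshift scale_row_mx scaler0.
rewrite -[0 in RHS](sum0 _ (tab0 t2)) -sum_row_mx; apply: eq_bigr => -[[[a b] c] l] _ /=.
by rewrite eq_rshift !row_mxEr delta_mx_rshift scale_row_mx scaler0.
Qed.

Lemma mul01_cat t1 t2 x1 y1 x2 y2 :
  @mul01 K (table_cat t1 t2) (row_mx x1 x2) (row_mx y1 y2) =
  row_mx (mul01 x1 y1) (mul01 x2 y2).
Proof.
rewrite {1}/mul01 big_cat !big_map.
have -> : row_mx (mul01 x1 y1) (mul01 x2 y2) =
    row_mx (mul01 x1 y1) 0 + row_mx 0 (mul01 x2 y2).
  by rewrite add_row_mx addr0 add0r.
have sum0 I (r : seq I) (V : nmodType) : \sum_(i <- r) (0 : V) = 0 by rewrite big1.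
congr (_ + _).
  rewrite -[0 in RHS](sum0 _ (tab1 t1)) -sum_row_mx; apply: eq_bigr => -[[[a b] c] l] _ /=.
  by rewrite !row_mxEl delta_mx_lshift scale_row_mx scaler0.
rewrite -[0 in RHS](sum0 _ (tab1 t2)) -sum_row_mx; apply: eq_bigr => -[[[a b] c] l] _ /=.
by rewrite !row_mxEr delta_mx_rshift scale_row_mx scaler0.
Qed.

Section Iso.
Variables (A : superalgebra K) (t1 t2 : table K) (phi : 'Hom(A, table_alg t2)).

Definition cat_map (u : table_alg t1 * A) : table_alg (table_cat t1 t2) :=
  (row_mx u.1.1 (phi u.2).1, row_mx u.1.2 (phi u.2).2).

Fact cat_map_linear : linear cat_map.
Proof.
move=> c u v; rewrite /cat_map.
have -> : phi (c *: u + v).2 = c *: phi u.2 + phi v.2 by rewrite -linearP.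
by congr (_, _); apply/esym; rewrite [RHS]/= -add_row_mx -scale_row_mx.
Qed.

HB.instance Definition _ :=
  GRing.isLinear.Build K (table_alg t1 * A)%type (table_alg (table_cat t1 t2)) *:%R
    cat_map cat_map_linear.

End Iso.

Lemma dsum_table_cat (A : superalgebra K) t1 t2 :
  isomorphic A (table_alg t2) ->
  isomorphic (dsum (table_alg t1) A) (table_alg (table_cat t1 t2)).
Proof.
case/isomorphic_inv=> phi [psi [phiK psiK [phiM _] [phiP _]]].
exists (linfun (@cat_map A t1 t2 phi)); split.
- pose g (u : table_alg (table_cat t1 t2)) : table_alg t1 * A :=
    ((lsubmx u.1, lsubmx u.2), psi (rsubmx u.1, rsubmx u.2)).
  exists g => [[[x y] a] | [x y]].
    by rewrite lfunE /= /g /cat_map /= !row_mxKl !row_mxKr -surjective_pairing phiK.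
  by rewrite lfunE /= /g /cat_map /= psiK /= !hsubmxK.
- move=> [x a] [y b]; rewrite !lfunE /= /cat_map /= phiM.
  congr (_, _) => /=; first by rewrite mul00_cat.
  by rewrite !mul01_cat add_row_mx.
move=> i [[x y] a]; rewrite /= /dsum_part mem_pairv /= lfunE /= => /andP[+ /phiP].
case: i => /=; rewrite !mem_pairv /= /cat_map /= !memvf ?andbT !memv0.
  by move=> /eqP-> /eqP->; rewrite row_mx0.
by move=> /eqP-> /eqP->; rewrite row_mx0 eqxx.
Qed.

End TableCat.

Definition summands_table (K : fieldType) (s : seq summand) : table K :=
  foldr (fun p t => table_cat (summand_table K p) t) (Table 0 0 [::] [::]) s.

Lemma dsums_table (K : fieldType) s : isomorphic (dsums K s) (table_alg (summands_table K s)).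
Proof.
elim: s => [|p s IHs] /=; last exact: dsum_table_cat.
exists (\1%VF); split; first by exists id => x; rewrite id_lfunE.
  by move=> x y; rewrite !id_lfunE.
by move=> i x xi; rewrite id_lfunE.
Qed.

Lemma summands_tableE (K : numFieldType) s :
  summands_table K s = ratr_table K (summands_table rat s).
Proof.
elim: s => //= p s ->; rewrite summand_tableE /table_cat /ratr_table /map_table /=.
by congr Table; rewrite map_cat -!map_comp; congr (_ ++ _);
  apply: eq_map => -[[[a b] c] l].
Qed.

(** The basis of each row is numbered in the order of its summands, so the constants agree without a
    permutation of the basis. *)
Definition decomposition_check (r : Defs.row rat) : bool :=
  if summands r is Some s then
    let t := summands_table rat s in
    let ci := int_sconst (int_entries t) in let cr := row_sconst r in
    [&& half_integral_check t, n0 t == 3, n1 t == 1 &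
     all (fun i => all (fun j => all (fun k => cr i j k == ci i j k)
      (iota 0 4)) (iota 0 4)) (iota 0 4)]
  else true.

Lemma decomposition_check_rows : all decomposition_check (rows rat).
Proof. by vm_cast_no_check (erefl true). Qed.

Lemma J_decomposition (K : numFieldType) k s :
  summands (J_row k) = Some s -> isomorphic (J K k) (dsums K s).
Proof.
move=> Ds; have /all_tnthP/(_ k) := decomposition_check_rows.
rewrite -/(J_row k) /decomposition_check Ds => /and4P[h /eqP e0 /eqP e1 H].
rewrite JE; apply: isomorphic_sym; apply: isomorphic_trans (dsums_table K s) _.
rewrite summands_tableE.
by apply: (isomorphic_table_eq (J_half_integral K k) (half_integral_checkP _ h) _ _ H).
Qed.

(** * Jordan algebras of dimension 3 with a linear form *)

(* A commutative algebra [V] with product [m] and a linear form [l] on it. These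
   are the data of a superalgebra with even part [V] and one-dimensional odd part
   [F]: an element [x] of [V] acts on [F] as the multiplication by [l x], and [F ** F = 0]. *)
Record jordan_form (K : fieldType) (V : vectType K) (m : V -> V -> V) (l : V -> K) := JordanForm {
  jfC : commutative m;
  jfDl : forall x y z, m (x + y) z = m x z + m y z;
  jfZl : forall a x y, m (a *: x) y = a *: m x y;
  jfLD : forall x y, l (x + y) = l x + l y;
  jfLZ : forall a x, l (a *: x) = a * l x;
  jfJ : forall x y z t,
    m (m (m x y) z) t + m (m (m x t) z) y + m (m (m y t) z) x =
    m (m x y) (m z t) + m (m x t) (m y z) + m (m x z) (m y t);
  jfL : forall x y z,
    l (m (m x y) z) + 2 * l x * l y * l z = l (m x y) * l z + l x * l (m y z) + l (m x z) * l y
}.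

(** A certificate: the goal is [k] times a known equation, which [field] or [ring] verifies. *)
Lemma eq_lin (K : fieldType) (k x y a b : K) : a = b -> x - y = k * (a - b) -> x = y.
Proof. by move=> ->; rewrite subrr mulr0 => /eqP; rewrite subr_eq0 => /eqP. Qed.

(** Coordinates are linear forms. Under an arbitrary form a vector identity becomes a scalar one, so
    that [vring] and [vfield] can call the scalar tactics. *)
Lemma functional_ext (K : fieldType) (V : vectType K) (x y : V) :
  (forall phi : V -> K, (forall v w, phi (v + w) = phi v + phi w) ->
     (forall a v, phi (a *: v) = a * phi v) -> (forall v, phi (- v) = - phi v) ->
     phi 0 = 0 -> phi x = phi y) -> x = y.
Proof.
move=> H; rewrite (coord_vbasis (memvf x)) (coord_vbasis (memvf y)).
apply: eq_bigr => i _; congr (_ *: _); apply: H => *;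
  by rewrite ?(linearD, linearZ, linearN, linear0).
Qed.

Ltac vlin := let f := fresh "f" in let fD := fresh "fD" in let fZ := fresh "fZ" in
  let fN := fresh "fN" in let f0 := fresh "f0" in
  apply: functional_ext; move=> f fD fZ fN f0; rewrite ?(fD, fZ, fN, f0).
Ltac vring := vlin; ring.
Ltac vfield := vlin; field; try done.

Section TypeCheck.
Implicit Types (P : seq (seq int)) (L : seq int) (s : seq nat).

(* The nine products of a basis, listed by rows, from those of [b_i] and [b_j] with [i <= j]. *)
Definition all_products P : seq (seq int) :=
  [seq nth [::] P q | q <- [:: 0; 1; 2; 1; 3; 4; 2; 4; 5]%N].

Definition entry P (i j c : nat) : int := (nth [::] (all_products P) (3 * i + j))`_c.

Definition row_products (r : Defs.row rat) : seq (seq (seq int)) * seq int :=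
  ([seq [seq [seq row_sconst r i j c | c <- iota 0 3] | j <- iota 0 3] | i <- iota 0 3],
   [seq row_sconst r i 3 3 | i <- iota 0 3]).

Definition permuted_products P L s : seq (seq (seq int)) * seq int :=
  ([seq [seq [seq entry P (nth 0%N s i) (nth 0%N s j) (nth 0%N s c) | c <- iota 0 3]
     | j <- iota 0 3] | i <- iota 0 3],
   [seq L`_(nth 0%N s i) | i <- iota 0 3]).

(* The identity [jfL] on basis vectors, multiplied by 8. *)
Definition form_check P L : bool :=
  let I := iota 0 3 in
  let q i j := foldr +%R 0 [seq entry P i j c * L`_c | c <- I] in
  all (fun i => all (fun j => all (fun k =>
    foldr +%R 0 [seq entry P i j c * q c k | c <- I] + 2 * L`_i * L`_j * L`_k ==
    q i j * L`_k + L`_i * q j k + q i k * L`_j) I) I) I.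

(** The values of [l] on the basis, doubled, give 27 candidates. Each one either violates the
    identity for the form or becomes a row of the table after one of the six permutations of the
    basis. *)
Definition type_check P : bool :=
  let T := map row_products (rows rat) in
  let S := permutations (iota 0 3) in
  all (fun x => all (fun y => all (fun z =>
    form_check P [:: x; y; z] ==>
    has (fun s => permuted_products P [:: x; y; z] s \in T) S)
    [:: 0; 1; 2]) [:: 0; 1; 2]) [:: 0; 1; 2].

End TypeCheck.

Section Classification.
Variables (K : numClosedFieldType) (V : vectType K) (m : V -> V -> V) (l : V -> K).
Hypothesis jf : jordan_form m l.
Hypothesis dimV : \dim {:V} = 3%N.
Local Notation "x %* y" := (m x y) (at level 40, left associativity).

Let mC : commutative m := jfC jf.
Let mDl := jfDl jf.
Let mZl := jfZl jf.
Let lD := jfLD jf.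
Let lZ := jfLZ jf.
Let mJ := jfJ jf.
Let lJ := jfL jf.
Let mDr x y z : x %* (y + z) = x %* y + x %* z.
Proof. by rewrite mC mDl ![_ %* x]mC. Qed.
Let mZr a x y : x %* (a *: y) = a *: (x %* y).
Proof. by rewrite mC mZl mC. Qed.
Let m0l x : 0 %* x = 0. Proof. by rewrite -[0 in LHS](scale0r (0 : V)) mZl scale0r. Qed.
Let m0r x : x %* 0 = 0. Proof. by rewrite mC m0l. Qed.
Let mNl x y : (- x) %* y = - (x %* y). Proof. by rewrite -scaleN1r mZl scaleN1r. Qed.
Let mNr x y : x %* (- y) = - (x %* y). Proof. by rewrite mC mNl mC. Qed.
Let l0 : l 0 = 0. Proof. by rewrite -(scale0r (0 : V)) lZ mul0r. Qed.
Let mE := (mDl, mDr, mZl, mZr, mNl, mNr, m0l, m0r).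

Let nz2 : 2 != 0 :> K. Proof. by rewrite pnatr_eq0. Qed.

(** The linearized Jordan identity with four equal arguments, divided by 3. *)
Lemma sqr_sqr x : (x %* x) %* (x %* x) = x %* (x %* (x %* x)).
Proof.
have := mJ x x x x; rewrite ![_ %* _ %* _ %* x]mC ![x %* x %* x]mC => E.
apply: (scalerI (a := 3)); first by rewrite pnatr_eq0.
by transitivity (x %* x %* (x %* x) + x %* x %* (x %* x) + x %* x %* (x %* x));
  [vring | rewrite -E; vring].
Qed.

Lemma sqr_mul x w : (x %* x) %* (x %* w) = x %* ((x %* x) %* w).
Proof.
have := mJ x x w x; rewrite ![_ %* w %* x]mC [w %* x]mC [x %* w %* (x %* x)]mC => E.
apply: (scalerI (a := 3)); first by rewrite pnatr_eq0.
by transitivity (x %* x %* (x %* w) + x %* x %* (x %* w) + x %* x %* (x %* w));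
  [vring | rewrite -E; vring].
Qed.

(** The operator relation [L_(x^3) + 2 L_x^3 = 3 L_(x^2) L_x]. For an idempotent it becomes
    [2 L^3 - 3 L^2 + L = 0], whence the eigenvalues 0, 1/2 and 1; if [x^2 = 0], it gives
    [L_x^3 = 0]. *)
Lemma cube_mul x t :
  (x %* (x %* x)) %* t + 2 *: (x %* (x %* (x %* t))) = 3 *: ((x %* x) %* (x %* t)).
Proof.
have := mJ x x x t.
rewrite [x %* x %* x]mC [x %* t %* x]mC [x %* (x %* t) %* x]mC [x %* t %* (x %* x)]mC => E.
transitivity (x %* x %* (x %* t) + x %* x %* (x %* t) + x %* x %* (x %* t));
  [rewrite -E; vring | vring].
Qed.

Lemma power_algebra x (x2 := x %* x) (x3 := x %* x2) (x4 := x %* x3) :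
  [/\ x2 %* x2 = x4, x2 %* x3 = x %* x4 & x3 %* x3 = x %* (x %* x4)].
Proof.
have x22 : x2 %* x2 = x4 by exact: sqr_sqr.
have x23 : x2 %* x3 = x %* x4 by rewrite /x3 sqr_mul x22.
have x24 : x2 %* x4 = x %* (x %* x4) by rewrite {1}/x4 sqr_mul x23.
split=> //; have := cube_mul x x3; rewrite -/x2 -/x3 -/x4 x24 => E.
apply: (addIr (2 *: (x %* (x %* x4)))); rewrite E; vring.
Qed.

(* [e] is a polynomial without constant term in [x]: the projection onto the
   part of the algebra generated by [x] on which [x] acts invertibly. *)
Lemma idempotent_of_power x a b c (x2 := x %* x) (x3 := x %* x2) (x4 := x %* x3) :
  x4 = a *: x + b *: x2 + c *: x3 -> x4 != 0 ->
  exists p q r, let e := p *: x + q *: x2 + r *: x3 in e != 0 /\ e %* e = e.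
Proof.
move=> Dx4 nz4; have [x22 x23 x33] := power_algebra x.
rewrite -/x2 -/x3 -/x4 in x22 x23 x33.
have x12 : x %* x2 = x3 by []. have x13 : x %* x3 = x4 by [].
have x11 : x %* x = x2 by [].
have x14 : x %* x4 = a *: x2 + b *: x3 + c *: x4 by rewrite {1}Dx4 !mE x11 x12 x13.
have x21 : x2 %* x = x3 by rewrite mC. have x31 : x3 %* x = x4 by rewrite mC.
have x32 : x3 %* x2 = x %* x4 by rewrite mC.
have xx4 : x %* (x %* x4) = a *: x3 + b *: x4 + c *: (x %* x4).
  by rewrite {1}x14 !mE x12 x13.
pose simp := (mE, x11, x12, x13, x21, x22, x23, x31, x32, x33, xx4, x14, Dx4).
have Hxn (y : V) p q r : y != 0 -> (p *: x + q *: x2 + r *: x3) %* y = y ->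
    p *: x + q *: x2 + r *: x3 != 0.
  by move=> y0 ey; apply: contraNneq y0 => e0; rewrite -ey e0 m0l.
have nzx : x != 0 by apply: contraNneq nz4 => x0; rewrite /x4 /x3 /x2 x0 !m0l.
have nzx2 : x2 != 0 by apply: contraNneq nz4 => x0; rewrite /x4 /x3 x0 !m0r.
have nzx3 : x3 != 0 by apply: contraNneq nz4 => x0; rewrite /x4 x0 !m0r.
(* If [a] is nonzero, solving the relation for [x] gives [e x = x] with
   [e = (x^3 - c x^2 - b x) / a]. If [a = 0] and [b] is nonzero, [(x^2 - c x) / b] is the unit on
   the invertible part but need not vanish on the nilpotent part; [e] is its square. In the last
   case [x^4 = c x^3], and [e] is the cube of [x / c]. *)
have [a0|a0] := eqVneq a 0; last first.
  exists (- b / a), (- c / a), (a^-1); split.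
    by apply: (Hxn x) => //; rewrite !simp; vfield.
  by rewrite !simp; vfield.
have [b0|b0] := eqVneq b 0; last first.
  exists 0, (b^-1 + c ^+ 2 / b ^+ 2), (- (c / b ^+ 2)); split.
    by apply: (Hxn x2) => //; rewrite !simp a0; vfield.
  by rewrite !simp a0; vfield.
have [c0|c0] := eqVneq c 0.
  by case/eqP: nz4; rewrite Dx4 a0 b0 c0 !scale0r !addr0.
exists 0, 0, (c^-1 ^+ 3); split.
  by apply: (Hxn x3) => //; rewrite !simp a0 b0; vfield.
by rewrite !simp a0 b0; vfield.
Qed.

(** * Bases and eigenvectors of idempotents *)

Definition is_basis (b1 b2 b3 : V) : Prop :=
  forall p q r, p *: b1 + q *: b2 + r *: b3 = 0 -> [/\ p = 0, q = 0 & r = 0].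

Lemma is_basis_coef b1 b2 b3 p q r p' q' r' : is_basis b1 b2 b3 ->
  p *: b1 + q *: b2 + r *: b3 = p' *: b1 + q' *: b2 + r' *: b3 ->
  [/\ p = p', q = q' & r = r'].
Proof.
move=> B E; have [|p0 q0 r0] := B (p - p') (q - q') (r - r').
  transitivity ((p *: b1 + q *: b2 + r *: b3) - (p' *: b1 + q' *: b2 + r' *: b3)).
    by vring.
  by rewrite E subrr.
by split; apply/eqP; rewrite -subr_eq0 ?p0 ?q0 ?r0.
Qed.

Lemma is_basis_span b1 b2 b3 : is_basis b1 b2 b3 ->
  forall x, exists p q r, x = p *: b1 + q *: b2 + r *: b3.
Proof.
move=> B x; pose X := [tuple b1; b2; b3].
have sumE (k : 'I_3 -> K) : \sum_(i < 3) k i *: X`_i =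
    k ord0 *: b1 + k (lift ord0 ord0) *: b2 + k (lift ord0 (lift ord0 ord0)) *: b3.
  by rewrite !big_ord_recl big_ord0 /= addr0 addrA.
have freeX : free X.
  apply/freeP => k; rewrite sumE => /B[k0 k1 k2] i.
  have : i \in [:: ord0; lift ord0 ord0; lift ord0 (lift ord0 ord0)].
    by case: i => -[|[|[|]]].
  by rewrite !inE => /or3P[] /eqP->.
have basX : basis_of fullv X by rewrite basisEfree freeX subvf dimV.
by rewrite (coord_basis basX (memvf x)) sumE; do 3 eexists.
Qed.

Lemma is_basisI (e u v : V) : e != 0 -> u \notin <[e]>%VS -> v \notin (<[e]> + <[u]>)%VS ->
  is_basis e u v.
Proof.
move=> e0 ue ve p q r E.
have r0 : r = 0.
  apply: contraNeq ve => r0; have -> : v = - (p / r) *: e - (q / r) *: u.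
    apply: (scalerI r0); apply: (addrI (p *: e + q *: u)); rewrite E.
    by apply/esym; vfield.
  by rewrite memv_add // ?rpredN memvZ ?memv_line.
rewrite r0 scale0r addr0 in E.
have q0 : q = 0.
  apply: contraNeq ue => q0; have -> : u = - (p / q) *: e.
    apply: (scalerI q0); apply: (addrI (p *: e)); rewrite E.
    by apply/esym; vfield.
  by rewrite memvZ ?memv_line.
move: E; rewrite q0 scale0r addr0 => /eqP; rewrite scaler_eq0 (negPf e0) orbF.
by move/eqP.
Qed.

Lemma notin_line (e : V) : exists x, x \notin <[e]>%VS.
Proof.
case: (boolP (fullv <= <[e]>)%VS) => [/dimvS|/subvPn[x _ ?]]; last by exists x.
by rewrite dimV dim_vline; case: eqP.
Qed.

Lemma notin_plane (e u : V) : exists x, x \notin (<[e]> + <[u]>)%VS.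
Proof.
case: (boolP (fullv <= <[e]> + <[u]>)%VS) => [/dimvS|/subvPn[x _ ?]]; last by exists x.
rewrite dimV => H; have := leq_trans H (dimv_add_leqif _ _).1.
by rewrite !dim_vline; do 2 case: eqP.
Qed.

Section Idempotent.
Variable e : V.
Hypothesis ee : e %* e = e.

(** The three Peirce components of [x] add up to [x], so one of them lies outside [U]. The predicate
    [W] allows the eigenvector to be sought in a subspace stable under [e]. *)
Lemma peirce_eigenvector (W : V -> Prop) (U : {vspace V}) x :
  (forall y z, W y -> W z -> W (y + z)) -> (forall a y, W y -> W (a *: y)) ->
  (forall y, W y -> W (e %* y)) -> W x -> x \notin U ->
  exists w j, [/\ W w, w \notin U, e %* w = j *: w & [\/ j = 0, j = 2^-1 | j = 1]].
Proof.
move=> WD WZ We Wx xU.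
have E3 : e %* (e %* (e %* x)) = (3 / 2) *: (e %* (e %* x)) - 2^-1 *: (e %* x).
  have := cube_mul e x; rewrite !ee => E; apply: (scalerI nz2).
  by apply: (addrI (e %* x)); rewrite E; vfield.
(* The spectral projections are the Lagrange interpolation polynomials in [L_e] at 1, 1/2 and 0. *)
pose x1 := 2 *: (e %* (e %* x)) - e %* x.
pose xh := 4 *: (e %* x) - 4 *: (e %* (e %* x)).
pose x0 := x - 3 *: (e %* x) + 2 *: (e %* (e %* x)).
have WN y : W y -> W (- y) by move=> Wy; rewrite -scaleN1r; apply: WZ.
have [W1 Wh W0] : [/\ W x1, W xh & W x0].
  split.
- exact: (WD _ _ (WZ 2 _ (We _ (We _ Wx))) (WN _ (We _ Wx))).
- exact: (WD _ _ (WZ 4 _ (We _ Wx)) (WN _ (WZ 4 _ (We _ (We _ Wx))))).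
- exact: (WD _ _ (WD _ _ Wx (WN _ (WZ 3 _ (We _ Wx)))) (WZ 2 _ (We _ (We _ Wx)))).
have [x1U|x1U] := boolP (x1 \in U); last first.
  exists x1, 1; split=> //; last by constructor 3.
  by rewrite /x1 !mE E3; vfield.
have [xhU|xhU] := boolP (xh \in U); last first.
  exists xh, (2^-1); split=> //; last by constructor 2.
  by rewrite /xh !mE E3; vfield.
exists x0, 0; split=> //; last by constructor 1.
  apply: contra xU => x0U; have -> : x = x1 + xh + x0 by rewrite /x1 /xh /x0; vring.
  exact: rpredD (rpredD x1U xhU) x0U.
by rewrite /x0 !mE E3; vfield.
Qed.

(** The identity at [(e, e, x, y)] reads [(2j - 1)(e(xy) - i xy) = 0]. *)
Lemma peirce_mul x y i j : e %* x = i *: x -> e %* y = j *: y -> j != 2^-1 ->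
  e %* (x %* y) = i *: (x %* y).
Proof.
move=> ex ey j2; have := mJ e e x y.
rewrite ee !ex !ey !mE [y %* x]mC [x %* y %* e]mC => E.
have j21 : 2 * j - 1 != 0.
  by apply: contraNneq j2 => E0; apply/eqP/(eq_lin (k := 2^-1) E0); field.
apply: (scalerI j21); apply/eqP; rewrite -subr_eq0; apply/eqP.
move/eqP: E; rewrite -subr_eq0 => /eqP E; rewrite -[RHS]E; vring.
Qed.

(** The product of two elements of the 1/2-space lies in the sum of the 0-space and the 1-space, the
    kernel of [L_e^2 - L_e]. *)
Lemma peirce_half_mul x y : e %* x = 2^-1 *: x -> e %* y = 2^-1 *: y ->
  e %* (e %* (x %* y)) = e %* (x %* y).
Proof.
move=> ex ey; have := mJ e x e y.
rewrite ee !ex !ey !mE [x %* e]mC [y %* e]mC !(ex, ey) !mE [y %* x]mC [_ %* e]mC [_ %* e]mC => E.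
apply/eqP; rewrite -subr_eq0; apply/eqP.
move/eqP: E; rewrite -subr_eq0 => /eqP E; rewrite -[RHS]E; vfield.
Qed.

(** The identity at [(w, w, e, w)] compares [3a/2] with [3a/4] as coefficients of [w]. *)
Lemma half_sqr w a : e %* w = 2^-1 *: w -> w %* w = a *: e -> w != 0 -> a = 0.
Proof.
move=> ew ww w0; have we : w %* e = 2^-1 *: w by rewrite mC.
have := mJ w w e w.
rewrite !(ww, ew, we, ee, mE) => /eqP; rewrite -subr_eq0 => /eqP E.
have /eqP : (3 / 4 * a) *: w = 0 by rewrite -[RHS]E; vfield.
by rewrite scaler_eq0 (negPf w0) orbF !mulf_eq0 invr_eq0 !pnatr_eq0 => /eqP.
Qed.

Lemma eigen_coef u v i j x k : is_basis e u v -> e %* u = i *: u -> e %* v = j *: v ->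
  e %* x = k *: x ->
  exists p q r, [/\ x = p *: e + q *: u + r *: v, k != 1 -> p = 0, k != i -> q = 0 & k != j -> r = 0].
Proof.
move=> B eu ev; have [p [q [r ->]]] := is_basis_span B x => ex; exists p, q, r.
have [] := @is_basis_coef e u v p (q * i) (r * j) (k * p) (k * q) (k * r) B.
  have -> : p *: e + (q * i) *: u + (r * j) *: v = e %* (p *: e + q *: u + r *: v).
    by rewrite !mE ee eu ev; vring.
  by rewrite ex; vring.
move=> /eqP + /eqP + /eqP.
rewrite -subr_eq0 -[X in X - _]mul1r -mulrBl mulf_eq0 => p0.
rewrite -subr_eq0 [q * i]mulrC -mulrBl mulf_eq0 => q0.
rewrite -subr_eq0 [r * j]mulrC -mulrBl mulf_eq0 => r0.
split=> // kn; [move: p0|move: q0|move: r0];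
  by rewrite subr_eq0 eq_sym (negPf kn) => /eqP.
Qed.

End Idempotent.

(** * Recognition of a row of the table *)

Local Notation half c := ((c : int)%:~R / 2 : K).

(** Index 3 is the odd basis vector, so [J_sconst k i 3 3] is twice the scalar by which the [i]-th
    even basis vector acts on the odd part. *)
Definition listed : Prop :=
  exists (k : 'I_59) (b : 'I_3 -> V),
    [/\ forall c : 'I_3 -> K, \sum_i c i *: b i = 0 -> forall i, c i = 0,
        forall i j, b i %* b j = \sum_(c < 3) half (J_sconst k i j c) *: b c
      & forall i : 'I_3, l (b i) = half (J_sconst k i 3 3)].

Definition products b1 b2 b3 (P : seq (seq int)) : Prop :=
  let v q := half (nth [::] P q)`_0 *: b1 + half (nth [::] P q)`_1 *: b2
             + half (nth [::] P q)`_2 *: b3 in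
  [/\ b1 %* b1 = v 0, b1 %* b2 = v 1, b1 %* b3 = v 2 &
   [/\ b2 %* b2 = v 3, b2 %* b3 = v 4 & b3 %* b3 = v 5]]%N.

Ltac products_by H := rewrite /products /=; split; last split; rewrite ?H; vfield.

Definition half_valued x : Prop := exists2 c : int, c \in [:: 0; 1; 2] & l x = half c.

(** On an idempotent, [jfL] becomes [2t^3 - 3t^2 + t = 0] for the value [t] of [l]. *)
Lemma half_valued_idem x : x %* x = x -> half_valued x.
Proof.
move=> xx; have := lJ x x x; rewrite !xx => /eqP; rewrite -subr_eq0 => /eqP E.
have /eqP : l x * (l x - 1) * (l x - 2^-1) = 0.
  by rewrite -[RHS](mulr0 2^-1) -{}[in RHS]E; field.
rewrite !mulf_eq0 !subr_eq0 => /orP[/orP[]|] /eqP lx; [exists 0 | exists 2 | exists 1] => //.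
- by rewrite lx mul0r.
- by rewrite lx; field.
by rewrite lx; field.
Qed.

Lemma half_valued0 x : l x = 0 -> half_valued x.
Proof. by move=> lx; exists 0; rewrite // lx mul0r. Qed.

Lemma form_nil x : l (x %* x) = 0 -> l (x %* x %* x) = 0 -> l x = 0.
Proof.
move=> lx2 lx3; have := lJ x x x; rewrite lx2 lx3 add0r !mul0r mulr0 !addr0 => /eqP.
by rewrite !mulf_eq0 (negPf nz2) /= -!orbA !orbb => /eqP.
Qed.

Lemma form_sqr0 x : x %* x = 0 -> l x = 0.
Proof. by move=> xx; apply: form_nil; rewrite xx ?m0l l0. Qed.

(** The instances of [jfL] at [(e, e, v)] and [(e, v, e)] differ only in their first terms,
    [l v / 2] and [l v / 4]. *)
Lemma form_half e v : e %* e = e -> e %* v = 2^-1 *: v -> l v = 0.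
Proof.
move=> ee ev; have ve : v %* e = 2^-1 *: v by rewrite mC.
have := lJ e e v; have := lJ e v e; rewrite !(ee, ev, ve, mE, lZ).
move=> /eqP; rewrite -subr_eq0 => /eqP E1 /eqP; rewrite -subr_eq0 => /eqP E2.
transitivity (4 * (2^-1 * l v + 2 * l e * l e * l v - (l e * l v + l e * (2^-1 * l v) + 2^-1 * l v * l e))
  - 4 * (2^-1 * (2^-1 * l v) + 2 * l e * l v * l e - (2^-1 * l v * l e + l e * (2^-1 * l v) + l e * l v))).
  by field.
by rewrite E1 E2 mulr0 subrr.
Qed.

Section Recognition.
Variables (b1 b2 b3 : V) (P : seq (seq int)).
Hypotheses (B : is_basis b1 b2 b3) (bP : products b1 b2 b3 P).
Let b (i : 'I_3) : V := [:: b1; b2; b3]`_i.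

Let sum_b (c : 'I_3 -> K) : \sum_i c i *: b i =
  c ord0 *: b1 + c (lift ord0 ord0) *: b2 + c (lift ord0 (lift ord0 ord0)) *: b3.
Proof. by rewrite !big_ord_recl big_ord0 /= addr0 addrA. Qed.

Let ord3P (Q : 'I_3 -> Prop) :
  Q ord0 -> Q (lift ord0 ord0) -> Q (lift ord0 (lift ord0 ord0)) -> forall i, Q i.
Proof.
move=> Q0 Q1 Q2 i; have : i \in [:: ord0; lift ord0 ord0; lift ord0 (lift ord0 ord0)].
  by case: i => -[|[|[|]]].
by rewrite !inE => /or3P[] /eqP->.
Qed.

Let free_b (c : 'I_3 -> K) : \sum_i c i *: b i = 0 -> forall i, c i = 0.
Proof. by rewrite sum_b => /B[c0 c1 c2]; apply: ord3P. Qed.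

Let mul_b i j : b i %* b j = \sum_(c < 3) half (entry P i j c) *: b c.
Proof.
have [p11 p12 p13 [p22 p23 p33]] := bP; rewrite sum_b.
by move: i j; do 2!apply: ord3P; rewrite /b /entry /= // mC.
Qed.

Let form_b L : (forall i, l (b i) = half L`_i) -> form_check P L.
Proof.
move=> lb; pose q (i j : 'I_3) : int := \sum_(c < 3) entry P i j c * L`_c.
have lsum (c : 'I_3 -> K) : l (\sum_i c i *: b i) = \sum_i c i * l (b i).
  by rewrite sum_b !big_ord_recl big_ord0 /= !lD !lZ addr0 addrA.
have lq i j : l (b i %* b j) = (q i j)%:~R / 4.
  rewrite mul_b lsum rmorph_sum mulr_suml; apply: eq_bigr => c _.
  by rewrite lb rmorphM /=; field.
have lp i j k : l (b i %* b j %* b k) = (\sum_(c < 3) entry P i j c * q c k)%:~R / 8.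
  rewrite mul_b.
  have -> : (\sum_(c < 3) half (entry P i j c) *: b c) %* b k =
            \sum_(c < 3) half (entry P i j c) *: (b c %* b k).
    by rewrite sum_b !big_ord_recl big_ord0 !mE addr0 addrA.
  have -> : l (\sum_(c < 3) half (entry P i j c) *: (b c %* b k)) =
            \sum_(c < 3) half (entry P i j c) * l (b c %* b k).
    by rewrite !big_ord_recl !big_ord0 !lD !lZ l0.
  rewrite rmorph_sum mulr_suml; apply: eq_bigr => c _.
  by rewrite lq rmorphM /=; field.
have checkE (i j k : 'I_3) :
    (\sum_(c < 3) entry P i j c * q c k + 2 * L`_i * L`_j * L`_k ==
    q i j * L`_k + L`_i * q j k + q i k * L`_j).
  have := lJ (b i) (b j) (b k); rewrite lp !lq !lb => E; apply/eqP.
  apply: (@intr_inj K); apply: (eq_lin (k := 8) E).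
  by rewrite !(rmorphD, rmorphM) /=; field.
have qE (i j : 'I_3) : foldr +%R 0 [seq entry P i j c * L`_c | c <- iota 0 3] = q i j.
  by rewrite /q !big_ord_recl big_ord0.
rewrite /form_check.
have I (p : nat) : p \in iota 0 3 -> (p < 3)%N by rewrite mem_iota.
apply/allP=> i /I li; apply/allP=> j /I lj; apply/allP=> k /I lk.
have := checkE (Ordinal li) (Ordinal lj) (Ordinal lk).
by rewrite -!qE !big_ord_recl big_ord0 -!qE.
Qed.

(** The values of [l] satisfy [form_check] because of [jfL], so [type_check] supplies a permutation
    of the basis and a row. *)
Lemma listed_check : half_valued b1 -> half_valued b2 -> half_valued b3 -> type_check P -> listed.
Proof.
case=> x x3 lx [y y3 ly] [z z3 lz] /allP/(_ _ x3)/allP/(_ _ y3)/allP/(_ _ z3).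
pose L := [:: x; y; z].
have lb i : l (b i) = half L`_i by move: i; apply: ord3P.
rewrite -/L (form_b lb) implyTb => /hasP[s]; rewrite mem_permutations => s3.
move=> /(nthP ([::], [::]))[q]; rewrite size_map size_tuple => lt_q.
rewrite (nth_map (tnth (rows rat) ord0)) ?size_tuple // => Eq.
have [k Dk] : exists k : 'I_59, nth (tnth (rows rat) ord0) (rows rat) q = J_row k.
  exists (Ordinal lt_q).
  exact: (esym (tnth_nth (tnth (rows rat) ord0) (rows rat) (Ordinal lt_q))).
rewrite Dk in Eq; have E := esym (congr1 fst Eq); have El := esym (congr1 snd Eq).
have size_s : size s = 3%N by rewrite (perm_size s3).
have lt_s (i : 'I_3) : (nth 0%N s i < 3)%N.
  have : nth 0%N s i \in s by rewrite mem_nth ?size_s.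
  by rewrite (perm_mem s3) mem_iota.
pose sg i : 'I_3 := Ordinal (lt_s i).
have sg_inj : injective sg.
  move=> i j /(congr1 val)/eqP /=.
  by rewrite nth_uniq ?size_s ?(perm_uniq s3) ?iota_uniq // => /eqP/val_inj.
have {}E (i j c : 'I_3) : entry P (sg i) (sg j) (sg c) = J_sconst k i j c.
  have := congr1 (fun t => nth 0 (nth [::] (nth [::] t i) j) c) E.
  by do 3!rewrite (nth_map 0%N) ?size_iota ?ltn_ord // nth_iota ?ltn_ord // add0n;
     do 3!rewrite (nth_map 0%N) ?size_iota ?ltn_ord // nth_iota ?ltn_ord // add0n.
have {}El (i : 'I_3) : L`_(sg i) = J_sconst k i 3 3.
  have := congr1 (fun t => nth 0 t i) El.
  by do 2!rewrite (nth_map 0%N) ?size_iota ?ltn_ord // nth_iota ?ltn_ord // add0n.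
exists k, (b \o sg); split=> [c c0 i | i j | i] /=; last by rewrite lb El.
  have := free_b (c := fun j => c (invF sg_inj j)) _ (sg i).
  rewrite invF_f; apply; rewrite (reindex_inj sg_inj) -[RHS]c0.
  by apply: eq_bigr => j _; rewrite invF_f.
rewrite mul_b (reindex_inj sg_inj); apply: eq_bigr => c _.
by rewrite E.
Qed.

End Recognition.

Lemma half_form e v : e %* e = e -> e %* v = 2^-1 *: v -> half_valued v.
Proof. by move=> ee ev; apply/half_valued0/(form_half ee ev). Qed.

Lemma half_sqr0 v : v %* v = 0 -> half_valued v.
Proof. by move=> vv; apply/half_valued0/form_sqr0. Qed.

Lemma basis_neq0 b1 b2 b3 : is_basis b1 b2 b3 -> [/\ b1 != 0, b2 != 0 & b3 != 0].
Proof.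
move=> B; split; apply/eqP => b0.
- by have [|/eqP] := B 1 0 0; rewrite ?b0 ?scaler0 ?scale0r ?addr0 // oner_eq0.
- by have [|_ /eqP] := B 0 1 0; rewrite ?b0 ?scaler0 ?scale0r ?addr0 // oner_eq0.
by have [|_ _ /eqP] := B 0 0 1; rewrite ?b0 ?scaler0 ?scale0r ?addr0 // oner_eq0.
Qed.

Lemma basisZ b1 b2 b3 c d f : c != 0 -> d != 0 -> f != 0 ->
  is_basis b1 b2 b3 -> is_basis (c *: b1) (d *: b2) (f *: b3).
Proof.
move=> c0 d0 f0 B p q r E; have [|/eqP + /eqP + /eqP] := B (p * c) (q * d) (r * f).
  by rewrite -[RHS]E; vring.
by rewrite !mulf_eq0 (negPf c0) (negPf d0) (negPf f0) !orbF => /eqP-> /eqP-> /eqP->.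
Qed.

Lemma idempotent_eigenvalue u v b : u %* u = u -> u %* v = b *: v -> v != 0 ->
  [\/ b = 0, b = 2^-1 | b = 1].
Proof.
move=> uu uv v0; have := cube_mul u v; rewrite !(uu, uv, mE) => /eqP; rewrite -subr_eq0 => /eqP E.
have /eqP : (b * (b - 2^-1) * (b - 1)) *: v = 0.
  by rewrite -[RHS](scaler0 _ 2^-1) -{}[in RHS]E; vfield.
rewrite scaler_eq0 (negPf v0) orbF !mulf_eq0 !subr_eq0.
by case/orP=> [/orP[]|] /eqP->; [constructor 1 | constructor 2 | constructor 3].
Qed.

(** * Idempotents with an eigenvalue 1/2 and another eigenvalue 0 or 1/2 *)

Section Cases.
Variables e u v : V.
Hypotheses (B : is_basis e u v) (ee : e %* e = e).

Lemma half0 : (0 : K) != 2^-1. Proof. by rewrite eq_sym invr_eq0. Qed.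
Lemma half1 : (1 : K) != 2^-1.
Proof. by rewrite -(inj_eq invr_inj) invr1 invrK (eqr_nat K 1 2). Qed.
Let h1 : (2^-1 : K) != 1. Proof. by rewrite eq_sym half1. Qed.
Let h0 : (2^-1 : K) != 0. Proof. by rewrite invr_eq0. Qed.

Lemma case_half_half : e %* u = 2^-1 *: u -> e %* v = 2^-1 *: v -> listed.
Proof.
move=> eu ev; have [e0 u0 v0] := basis_neq0 B.
have mulE x y : e %* x = 2^-1 *: x -> e %* y = 2^-1 *: y -> exists a, x %* y = a *: e.
  move=> ex ey; have [p [q [r xyE]]] := is_basis_span B (x %* y).
  have := peirce_half_mul ee ex ey; rewrite xyE !(ee, eu, ev, mE) => E.
  have [|_ q0 r0] := @is_basis_coef e u v p (q / 4) (r / 4) p (q / 2) (r / 2) B.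
    transitivity (p *: e + q *: (2^-1 *: (2^-1 *: u)) + r *: (2^-1 *: (2^-1 *: v))); first by vfield.
    by rewrite E; vfield.
  have -> : q = 0 by apply: (eq_lin (k := -4) q0); field.
  have -> : r = 0 by apply: (eq_lin (k := -4) r0); field.
  by exists p; rewrite !scale0r !addr0.
have [a uu] := mulE _ _ eu eu; have a0 := half_sqr ee eu uu u0.
have [b vv] := mulE _ _ ev ev; have b0 := half_sqr ee ev vv v0.
have [c uv] := mulE _ _ eu ev.
rewrite a0 scale0r in uu; rewrite b0 scale0r in vv.
have vu : v %* u = c *: e by rewrite mC.
have c0 : 2 * c = 0.
  (* The squares of [u] and [v] vanish, so the square of [u + v] is [2c e], and [half_sqr] applies a
     third time. *)
  apply: (half_sqr ee (w := u + v)); first by rewrite mE eu ev; vring.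
    by rewrite !(mE, uu, uv, vu, vv); vring.
  by apply/eqP => uv0; have [|_ /eqP] := @B 0 1 1; rewrite ?scale0r ?scale1r ?add0r // oner_eq0.
move/eqP: c0; rewrite mulf_eq0 (negPf nz2) => /eqP c0; rewrite c0 scale0r in uv.
apply: (listed_check (P := [:: [:: 2; 0; 0]; [:: 0; 1; 0]; [:: 0; 0; 1];
                         [:: 0; 0; 0]; [:: 0; 0; 0]; [:: 0; 0; 0]]) B).
- by products_by (ee, eu, ev, uu, uv, vv).
- exact: half_valued_idem.
- exact: half_sqr0.
- exact: half_sqr0.
by vm_cast_no_check (erefl true).
Qed.

Section ZeroHalf.
Hypotheses (eu : e %* u = 0) (ev : e %* v = 2^-1 *: v).
Let eu0 : e %* u = 0 *: u. Proof. by rewrite scale0r. Qed.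
Let ue : u %* e = 0. Proof. by rewrite mC. Qed.
Let ve : v %* e = 2^-1 *: v. Proof. by rewrite mC. Qed.

Lemma zero_half_uv : exists b, u %* v = b *: v.
Proof.
have := peirce_mul ee ev eu0 half0; rewrite [v %* u]mC => E.
have [p [q [r [-> p0 q0 _]]]] := eigen_coef ee B eu0 ev E; exists r.
by rewrite (p0 h1) (q0 h0) !scale0r !add0r.
Qed.

Lemma zero_half_vv : exists c d, v %* v = c *: e + d *: u.
Proof.
have [p [q [r vv]]] := is_basis_span B (v %* v).
have := peirce_half_mul ee ev ev; rewrite vv !(ee, eu, ev, mE) => E.
have [|_ _ r0] := @is_basis_coef e u v p 0 (r / 4) p 0 (r / 2) B.
  transitivity (p *: e + q *: 0 + r *: (2^-1 *: (2^-1 *: v))); first by vfield.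
  by rewrite E; vfield.
exists p, q; have -> : r = 0 by apply: (eq_lin (k := -4) r0); field.
by rewrite scale0r addr0.
Qed.

(** The coefficient of [v] in the identity at [(v, v, e, v)]. *)
Lemma zero_half_coef b c d : u %* v = b *: v -> v %* v = c *: e + d *: u -> c = 2 * d * b.
Proof.
move=> uv vv; have vu : v %* u = b *: v by rewrite mC.
have := mJ v v e v; rewrite !(vv, mE, ee, eu, ue, ev, ve, uv, vu) => E.
have [|_ _ r0] := @is_basis_coef e u v 0 0 (3 * c / 2) 0 0 (3 * (c / 4 + d * b / 2)) B.
  transitivity (c *: (2^-1 *: v) + c *: (2^-1 *: v) + c *: (2^-1 *: v)); first by vfield.
  apply/eqP; rewrite -subr_eq0; apply/eqP; move/eqP: E; rewrite -subr_eq0 => /eqP E.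
  by rewrite -[RHS]E; vfield.
by apply: (eq_lin (k := 4 / 3) r0); field.
Qed.

Lemma case_0_half_idem : u %* u = u -> listed.
Proof.
move=> uu; have [e0 u0 v0] := basis_neq0 B.
have [b uv] := zero_half_uv; have [c [d vv]] := zero_half_vv.
have cE := zero_half_coef uv vv.
have [b0|b2|b1] := idempotent_eigenvalue uu uv v0.
- rewrite b0 scale0r in uv; rewrite b0 mulr0 in cE.
  have uv0 : u %* v = 0 *: v by rewrite scale0r.
  (* The element [v] lies in the 0-space of [u], hence so does its square [d u]; but [u] fixes [u],
     so [d = 0]. *)
  have := peirce_mul uu uv0 uv0 half0; rewrite vv cE !scale0r add0r mE uu => /eqP.
  rewrite scaler_eq0 (negPf u0) orbF => /eqP d0; rewrite cE d0 !scale0r addr0 in vv.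
  apply: (listed_check (P := [:: [:: 2; 0; 0]; [:: 0; 0; 0]; [:: 0; 0; 1];
                           [:: 0; 2; 0]; [:: 0; 0; 0]; [:: 0; 0; 0]]) B).
  + by products_by (ee, eu, ev, uu, uv, vv).
  + exact: half_valued_idem.
  + exact: half_valued_idem.
  + exact: half_sqr0.
  by vm_cast_no_check (erefl true).
- rewrite b2 mulrAC divff // mul1r in cE; rewrite b2 in uv.
  have [c0|c0] := eqVneq c 0.
    rewrite -cE c0 !scale0r addr0 in vv.
    apply: (listed_check (P := [:: [:: 2; 0; 0]; [:: 0; 0; 0]; [:: 0; 0; 1];
                             [:: 0; 2; 0]; [:: 0; 0; 1]; [:: 0; 0; 0]]) B).
    + by products_by (ee, eu, ev, uu, uv, vv).
    + exact: half_valued_idem.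
    + exact: half_valued_idem.
    + exact: half_sqr0.
    by vm_cast_no_check (erefl true).
  (* Here the square of [v] is [c (e + u)]; division of [v] by a square root of [c] gives the
     product of [T5]. *)
  have s0 : sqrtC c != 0 by rewrite sqrtC_eq0.
  have nzs : (sqrtC c)^-1 != 0 by rewrite invr_eq0.
  have B' := basisZ (oner_neq0 K) (oner_neq0 K) nzs B.
  rewrite !scale1r in B'.
  have vv' : ((sqrtC c)^-1 *: v) %* ((sqrtC c)^-1 *: v) = e + u.
    by rewrite !mE vv -cE -[in c *: e](sqrtCK c) -[in c *: u](sqrtCK c); vfield.
  have ev' : e %* ((sqrtC c)^-1 *: v) = 2^-1 *: ((sqrtC c)^-1 *: v) by rewrite mE ev; vring.
  have uv' : u %* ((sqrtC c)^-1 *: v) = 2^-1 *: ((sqrtC c)^-1 *: v) by rewrite mE uv; vring.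
  apply: (listed_check (P := [:: [:: 2; 0; 0]; [:: 0; 0; 0]; [:: 0; 0; 1];
                           [:: 0; 2; 0]; [:: 0; 0; 1]; [:: 2; 2; 0]]) B').
  + by products_by (ee, eu, ev', uu, uv', vv').
  + exact: half_valued_idem.
  + exact: half_valued_idem.
  + exact: half_form ee ev'.
  by vm_cast_no_check (erefl true).
(* The value 1 is impossible: [e] would be in the 0-space and [v] in the 1-space of [u], so [e v]
   would be in the 0-space, but it is [v / 2]. *)
have ue0 : u %* e = 0 *: e by rewrite ue scale0r.
have uv1 : u %* v = 1 *: v by rewrite uv b1.
have := peirce_mul uu ue0 uv1 half1; rewrite ev mE uv b1 scale1r scale0r => /eqP.
by rewrite scaler_eq0 (negPf v0) (negPf h0).
Qed.

End ZeroHalf.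

End Cases.

Lemma case_0_half e u v : is_basis e u v -> e %* e = e -> e %* u = 0 ->
  e %* v = 2^-1 *: v -> listed.
Proof.
move=> B ee eu ev; have [e0 u0 v0] := basis_neq0 B.
have eu0 : e %* u = 0 *: u by rewrite scale0r.
have ue : u %* e = 0 by rewrite mC.
have [a uu] : exists a, u %* u = a *: u.
  have [p [q [r [-> p0 _ r0]]]] := eigen_coef ee B eu0 ev (peirce_mul ee eu0 eu0 half0).
  by exists q; rewrite p0 ?r0 ?half0 ?scale0r ?add0r ?addr0 // eq_sym oner_eq0.
have [a0|a0] := eqVneq a 0; last first.
  have nza : a^-1 != 0 by rewrite invr_eq0.
  have B' := basisZ (oner_neq0 K) nza (oner_neq0 K) B; rewrite !scale1r in B'.
  apply: (case_0_half_idem B') => //; first by rewrite mE eu scaler0.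
  by rewrite !mE uu; vfield.
rewrite a0 scale0r in uu.
have [b uv] := zero_half_uv B ee eu ev; have [c [d vv]] := zero_half_vv B ee eu ev.
have cE := zero_half_coef B ee eu ev uv vv.
have b0 : b = 0.
  have := cube_mul u v; rewrite !(uu, uv, mE) => /eqP; rewrite -subr_eq0 => /eqP E.
  have /eqP : (2 * b ^+ 3) *: v = 0 by rewrite -[RHS]E; vring.
  by rewrite scaler_eq0 (negPf v0) orbF mulf_eq0 (negPf nz2) expf_eq0 => /eqP.
rewrite cE b0 mulr0 !scale0r ?add0r in uv vv.
have [d0|d0] := eqVneq d 0.
  rewrite d0 scale0r in vv.
  apply: (listed_check (P := [:: [:: 2; 0; 0]; [:: 0; 0; 0]; [:: 0; 0; 1];
                           [:: 0; 0; 0]; [:: 0; 0; 0]; [:: 0; 0; 0]]) B).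
  - by products_by (ee, eu, ev, uu, uv, vv).
  - exact: half_valued_idem.
  - exact: half_sqr0.
  - exact: half_sqr0.
  by vm_cast_no_check (erefl true).
have B' := basisZ (oner_neq0 K) d0 (oner_neq0 K) B; rewrite !scale1r in B'.
have uu' : (d *: u) %* (d *: u) = 0 by rewrite !mE uu !scaler0.
have eu' : e %* (d *: u) = 0 by rewrite mE eu scaler0.
have uv' : (d *: u) %* v = 0 by rewrite mE uv scaler0.
apply: (listed_check (P := [:: [:: 2; 0; 0]; [:: 0; 0; 0]; [:: 0; 0; 1];
                         [:: 0; 0; 0]; [:: 0; 0; 0]; [:: 0; 2; 0]]) B').
- by products_by (ee, eu', ev, uu', uv', vv).
- exact: half_valued_idem.
- exact: half_sqr0.
- exact: half_form ee ev.
by vm_cast_no_check (erefl true).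
Qed.

(** * Idempotents with two-dimensional Peirce 1-space *)

(** Completing the square in the unital algebra spanned by [e] and [v]. *)
Lemma peirce_1_sqr e u v : is_basis e u v -> e %* e = e -> e %* v = v ->
  (forall p q r, v %* v = p *: e + q *: u + r *: v -> q = 0) ->
  exists2 s, is_basis e u s & e %* s = s /\ exists g, s %* s = g *: e.
Proof.
move=> B ee ev vv0; have ve : v %* e = v by rewrite mC.
have [p [q [r vv]]] := is_basis_span B (v %* v).
have q0 := vv0 _ _ _ vv; rewrite q0 scale0r addr0 in vv.
exists (v - (r / 2) *: e).
  move=> x y z E; have [|x0 y0 z0] := B (x - z * (r / 2)) y z; last first.
    by split=> //; move: x0; rewrite z0 mul0r subr0.
  by rewrite -[RHS]E; vring.
split; first by rewrite !mE ev ee.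
by exists (p + r ^+ 2 / 4); rewrite !(mE, vv, ee, ev, ve); vfield.
Qed.

Lemma case_0_1 e u v : is_basis e u v -> e %* e = e -> e %* u = 0 -> e %* v = v -> listed.
Proof.
move=> B0 ee eu ev0; have [e0 u0 v0] := basis_neq0 B0.
have eu0 : e %* u = 0 *: u by rewrite scale0r.
have ev1 : e %* v = 1 *: v by rewrite scale1r.
have vvq p q r : v %* v = p *: e + q *: u + r *: v -> q = 0.
  have [p' [q' [r' [-> _ q0 _]]]] := eigen_coef ee B0 eu0 ev1 (peirce_mul ee ev1 ev1 half1).
  by case/(is_basis_coef B0) => _ <- _; apply: q0; rewrite oner_eq0.
have [s B [es [g ss]]] := peirce_1_sqr B0 ee ev0 vvq.
have se : s %* e = s by rewrite mC.
have es1 : e %* s = 1 *: s by rewrite scale1r.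
have ue : u %* e = 0 by rewrite mC.
have us : u %* s = 0.
  (* The Peirce 0-space and 1-space annihilate each other: the product has both eigenvalues. *)
  have E1 := peirce_mul ee eu0 es1 half1.
  have := peirce_mul ee es1 eu0 half0; rewrite [s %* u]mC E1 scale0r scale1r.
  by move=> <-.
have su : s %* u = 0 by rewrite mC.
have [a uu] : exists a, u %* u = a *: u.
  have [p [q [r [-> p0 _ r0]]]] := eigen_coef ee B eu0 es1 (peirce_mul ee eu0 eu0 half0).
  by exists q; rewrite p0 ?r0 ?scale0r ?add0r ?addr0 // eq_sym oner_eq0.
have [u' [B' eu' us' uu']] : exists u', [/\ is_basis e u' s, e %* u' = 0, u' %* s = 0 &
    u' %* u' = 0 \/ u' %* u' = u'].
  have [a0|a0] := eqVneq a 0.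
    by exists u; split=> //; left; rewrite uu a0 scale0r.
  have nza : a^-1 != 0 by rewrite invr_eq0.
  have := basisZ (oner_neq0 K) nza (oner_neq0 K) B; rewrite !scale1r => B'.
  exists (a^-1 *: u); split=> //; first by rewrite mE eu scaler0.
    by rewrite mE us scaler0.
  by right; rewrite !mE uu; vfield.
have hu' : half_valued u'.
  by case: uu' => ?; [apply: half_sqr0 | apply: half_valued_idem].
have su' : s %* u' = 0 by rewrite mC.
have ue' : u' %* e = 0 by rewrite mC.
have [g0|g0] := eqVneq g 0.
  rewrite g0 scale0r in ss.
  case: uu' => uu'.
    apply: (listed_check (P := [:: [:: 2; 0; 0]; [:: 0; 0; 0]; [:: 0; 0; 2];
                             [:: 0; 0; 0]; [:: 0; 0; 0]; [:: 0; 0; 0]]) B').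
    - by products_by (ee, eu', es, uu', us', ss).
    - exact: half_valued_idem.
    - by [].
    - exact: half_sqr0.
    by vm_cast_no_check (erefl true).
  apply: (listed_check (P := [:: [:: 2; 0; 0]; [:: 0; 0; 0]; [:: 0; 0; 2];
                           [:: 0; 2; 0]; [:: 0; 0; 0]; [:: 0; 0; 0]]) B').
  - by products_by (ee, eu', es, uu', us', ss).
  - exact: half_valued_idem.
  - by [].
  - exact: half_sqr0.
  by vm_cast_no_check (erefl true).
have c0 : sqrtC g != 0 by rewrite sqrtC_eq0.
have {}ss : s %* s = (sqrtC g * sqrtC g) *: e by rewrite ss -expr2 sqrtCK.
(* When the square of [s] is a nonzero multiple of [e], the idempotent [e] splits into two
   orthogonal idempotents. *)
pose c := (2 * sqrtC g)^-1; pose f1 := 2^-1 *: e + c *: s; pose f2 := 2^-1 *: e - c *: s.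
have B2 : is_basis f1 u' f2.
  move=> p q r E; have [|E1 E2 E3] := B' ((p + r) / 2) q ((p - r) * c).
    by rewrite -[RHS]E /f1 /f2; vring.
  have pr : p + r = 0 by apply: (eq_lin (k := 2) E1); field.
  have prm : p - r = 0 by apply: (eq_lin (k := 2 * sqrtC g) E3); rewrite /c; field.
  split=> //.
    by transitivity (((p + r) + (p - r)) / 2); [field | rewrite pr prm addr0 mul0r].
  by transitivity (((p + r) - (p - r)) / 2); [field | rewrite pr prm subr0 mul0r].
have f11 : f1 %* f1 = f1 by rewrite /f1 /c !(mE, ee, es, se, ss); vfield.
have f22 : f2 %* f2 = f2 by rewrite /f2 /c !(mE, ee, es, se, ss); vfield.
have f12 : f1 %* f2 = 0 by rewrite /f1 /f2 /c !(mE, ee, es, se, ss); vfield.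
have f1u : f1 %* u' = 0 by rewrite /f1 !(mE, eu', su'); vring.
have uf2 : u' %* f2 = 0 by rewrite /f2 !(mE, ue', us'); vring.
case: uu' => uu'.
  apply: (listed_check (P := [:: [:: 2; 0; 0]; [:: 0; 0; 0]; [:: 0; 0; 0];
                           [:: 0; 0; 0]; [:: 0; 0; 0]; [:: 0; 0; 2]]) B2).
  - by products_by (f11, f22, f12, f1u, uf2, uu').
  - exact: half_valued_idem.
  - by [].
  - exact: half_valued_idem.
  by vm_cast_no_check (erefl true).
apply: (listed_check (P := [:: [:: 2; 0; 0]; [:: 0; 0; 0]; [:: 0; 0; 0];
                         [:: 0; 2; 0]; [:: 0; 0; 0]; [:: 0; 0; 2]]) B2).
- by products_by (f11, f22, f12, f1u, uf2, uu').
- exact: half_valued_idem.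
- by [].
- exact: half_valued_idem.
by vm_cast_no_check (erefl true).
Qed.

Lemma case_half_1 e u v : is_basis e u v -> e %* e = e -> e %* u = 2^-1 *: u ->
  e %* v = v -> listed.
Proof.
move=> B0 ee eu ev0; have [e0 u0 v0] := basis_neq0 B0.
have h1 : (2^-1 : K) != 1 by rewrite eq_sym half1.
have ev1 : e %* v = 1 *: v by rewrite scale1r.
have vvq p q r : v %* v = p *: e + q *: u + r *: v -> q = 0.
  have [p' [q' [r' [-> _ q0 _]]]] := eigen_coef ee B0 eu ev1 (peirce_mul ee ev1 ev1 half1).
  by case/(is_basis_coef B0) => _ <- _; apply: q0; apply: half1.
have [s B [es [g ss]]] := peirce_1_sqr B0 ee ev0 vvq.
have se : s %* e = s by rewrite mC.
have es1 : e %* s = 1 *: s by rewrite scale1r.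
have ue : u %* e = 2^-1 *: u by rewrite mC.
have [b us] : exists b, u %* s = b *: u.
  have E := peirce_mul ee eu es1 half1.
  have [p [q [r [-> p0 _ r0]]]] := eigen_coef ee B eu es1 E; exists q.
  by rewrite (p0 h1) (r0 h1) !scale0r add0r addr0.
have su : s %* u = b *: u by rewrite mC.
have [g0|g0] := eqVneq g 0; last first.
  have c0 : sqrtC g != 0 by rewrite sqrtC_eq0.
  have {}ss : s %* s = (sqrtC g * sqrtC g) *: e by rewrite ss -expr2 sqrtCK.
  pose c := (2 * sqrtC g)^-1; pose f1 := 2^-1 *: e + c *: s; pose f2 := 2^-1 *: e - c *: s.
  have B2 : is_basis f1 f2 u.
    move=> p q r E; have [|E1 E2 E3] := B ((p + q) / 2) r ((p - q) * c).
      by rewrite -[RHS]E /f1 /f2; vring.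
    have pr : p + q = 0 by apply: (eq_lin (k := 2) E1); field.
    have prm : p - q = 0 by apply: (eq_lin (k := 2 * sqrtC g) E3); rewrite /c; field.
    split=> //.
      by transitivity (((p + q) + (p - q)) / 2); [field | rewrite pr prm addr0 mul0r].
    by transitivity (((p + q) - (p - q)) / 2); [field | rewrite pr prm subr0 mul0r].
  have B2' : is_basis f2 f1 u.
    by move=> p q r E; have [|-> -> ->] := B2 q p r; rewrite // [X in X + _]addrC.
  have f11 : f1 %* f1 = f1 by rewrite /f1 /c !(mE, ee, es, se, ss); vfield.
  have f22 : f2 %* f2 = f2 by rewrite /f2 /c !(mE, ee, es, se, ss); vfield.
  have f12 : f1 %* f2 = 0 by rewrite /f1 /f2 /c !(mE, ee, es, se, ss); vfield.
  have f21 : f2 %* f1 = 0 by rewrite mC.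
  have f1u : f1 %* u = (4^-1 + c * b) *: u by rewrite /f1 !(mE, eu, su); vfield.
  have f2u : f2 %* u = (4^-1 - c * b) *: u by rewrite /f2 !(mE, eu, su); vfield.
  (* The eigenvalues of [u] under [f1] and [f2] add up to 1/2, so one is 0 and the other 1/2, which
     is an earlier case; the value 1 would force -1/2 on the other side. *)
  have [t1|t1|t1] := idempotent_eigenvalue f11 f1u u0.
  - apply: (case_0_half B2' f22 f21); rewrite f2u; congr (_ *: _).
    by transitivity (2^-1 - (4^-1 + c * b)); [field | rewrite t1 subr0].
  - by apply: (case_0_half B2 f11 f12); rewrite f1u t1.
  have t2 : 4^-1 - c * b = - 2^-1.
    by transitivity (2^-1 - (4^-1 + c * b)); [field | rewrite t1; field].
  have [] := idempotent_eigenvalue f22 f2u u0; rewrite t2 => /eqP.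
  - by rewrite oppr_eq0 invr_eq0 (negPf nz2).
  - by rewrite -subr_eq0 -opprD oppr_eq0 -mulr2n mulrn_eq0 invr_eq0 (negPf nz2).
  move=> /eqP E; have /eqP : (3 : K) = 0 by apply: (eq_lin (k := -2) E); field.
  by rewrite pnatr_eq0.
rewrite g0 scale0r in ss.
have [p [r uu]] : exists p r, u %* u = p *: e + r *: s.
  have [p [q [r uu]]] := is_basis_span B (u %* u).
  have := peirce_half_mul ee eu eu; rewrite uu !(ee, eu, es, mE) => E.
  have [|_ q0 _] := @is_basis_coef e u s p (q / 4) r p (q / 2) r B.
    transitivity (p *: e + q *: (2^-1 *: (2^-1 *: u)) + r *: s); first by vfield.
    by rewrite E; vfield.
  exists p, r; have -> : q = 0 by apply: (eq_lin (k := -4) q0); field.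
  by rewrite scale0r addr0.
have b0 : b = 0.
  (* The square of [s] is 0, so its action is nilpotent and its eigenvalue [b] vanishes. *)
  have := cube_mul s u; rewrite !(ss, su, mE) => /eqP; rewrite -subr_eq0 => /eqP E.
  have /eqP : (2 * b ^+ 3) *: u = 0 by rewrite -[RHS]E; vring.
  by rewrite scaler_eq0 (negPf u0) orbF mulf_eq0 (negPf nz2) expf_eq0 => /eqP.
rewrite b0 scale0r in us su.
have p0 : p = 0.
  have := mJ u u e u; rewrite !(uu, mE, ee, es, se, eu, ue, su, us) => /eqP.
  rewrite -subr_eq0 => /eqP E.
  have /eqP : (3 / 4 * p) *: u = 0 by rewrite -[RHS]E; vfield.
  by rewrite scaler_eq0 (negPf u0) orbF !mulf_eq0 invr_eq0 !pnatr_eq0 => /eqP.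
rewrite p0 scale0r add0r in uu.
have [r0|r0] := eqVneq r 0.
  rewrite r0 scale0r in uu.
  apply: (listed_check (P := [:: [:: 2; 0; 0]; [:: 0; 1; 0]; [:: 0; 0; 2];
                           [:: 0; 0; 0]; [:: 0; 0; 0]; [:: 0; 0; 0]]) B).
  - by products_by (ee, eu, es, uu, us, ss).
  - exact: half_valued_idem.
  - exact: half_sqr0.
  - exact: half_sqr0.
  by vm_cast_no_check (erefl true).
have B' := basisZ (oner_neq0 K) (oner_neq0 K) r0 B; rewrite !scale1r in B'.
have es' : e %* (r *: s) = r *: s by rewrite mE es.
have us' : u %* (r *: s) = 0 by rewrite mE us scaler0.
have ss' : (r *: s) %* (r *: s) = 0 by rewrite !mE ss !scaler0.
apply: (listed_check (P := [:: [:: 2; 0; 0]; [:: 0; 1; 0]; [:: 0; 0; 2];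
                         [:: 0; 0; 2]; [:: 0; 0; 0]; [:: 0; 0; 0]]) B').
- by products_by (ee, eu, es', uu, us', ss').
- exact: half_valued_idem.
- exact: half_form ee eu.
- exact: half_sqr0.
by vm_cast_no_check (erefl true).
Qed.

(** * Idempotents annihilating a two-dimensional complement *)

Lemma power_relation x (x2 := x %* x) (x3 := x %* x2) :
  exists a b c, x %* x3 = a *: x + b *: x2 + c *: x3.
Proof.
have [x0|x0] := eqVneq x 0.
  by exists 0, 0, 0; rewrite x0 m0l !scale0r !addr0.
have [/vlineP[a Dx2]|x2P] := boolP (x2 \in <[x]>%VS).
  exists 0, 0, a; rewrite !scale0r !add0r.
  by have {1}-> : x3 = a *: x2 by rewrite /x3 {1}Dx2 mE.
have [/memv_addP[_ /vlineP[a ->] [_ /vlineP[b ->] Dx3]]|x3P] := boolP (x3 \in (<[x]> + <[x2]>)%VS).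
  exists 0, a, b; rewrite scale0r add0r {1}Dx3 !mE.
  by [].
by have [a [b [c ->]]] := is_basis_span (is_basisI x0 x2P x3P) (x %* x3); exists a, b, c.
Qed.

(** The 0-space [W] of [e] is a two-dimensional subalgebra. If it contains an idempotent [g], a
    second eigenvector of [g] is chosen in [W]; for eigenvalues 1/2 and 1 the earlier cases apply
    with [g] as the idempotent and [e] as its 0-eigenvector. Otherwise [W] is nil and its squares
    decide. *)
Lemma case_0_0 e u v : is_basis e u v -> e %* e = e -> e %* u = 0 -> e %* v = 0 -> listed.
Proof.
move=> B ee eu ev; have [e0 u0 v0] := basis_neq0 B.
have eu0 : e %* u = 0 *: u by rewrite scale0r.
have ev0 : e %* v = 0 *: v by rewrite scale0r.
pose W x := exists q r, x = q *: u + r *: v.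
have We x : W x -> e %* x = 0 by case=> q [r ->]; rewrite !(mE, eu, ev) !scaler0 addr0.
have eW x : e %* x = 0 -> W x.
  move=> ex; have ex0 : e %* x = 0 *: x by rewrite scale0r.
  have [p [q [r [-> p0 _ _]]]] := eigen_coef ee B eu0 ev0 ex0.
  by exists q, r; rewrite p0 ?scale0r ?add0r // eq_sym oner_eq0.
have WD x y : W x -> W y -> W (x + y).
  by move=> /We ex /We ey; apply: eW; rewrite mE ex ey addr0.
have WZ a x : W x -> W (a *: x) by move=> /We ex; apply: eW; rewrite mE ex scaler0.
have WM x y : W x -> W y -> W (x %* y).
  move=> /We ex /We ey; have ex0 : e %* x = 0 *: x by rewrite scale0r.
  have ey0 : e %* y = 0 *: y by rewrite scale0r.
  by apply: eW; rewrite (peirce_mul ee ex0 ey0 half0) scale0r.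
have Wu : W u by apply: eW. have Wv : W v by apply: eW.
have basW g w : W g -> g != 0 -> W w -> w \notin <[g]>%VS -> is_basis e g w.
  move=> Wg g0 Ww wg; have we : w %* e = 0 by rewrite mC We.
  have ge : g %* e = 0 by rewrite mC We.
  apply: is_basisI => //.
    by apply: contra g0 => /vlineP[c gE]; have := ge; rewrite gE mE ee => ->.
  apply: contra wg => /memv_addP[_ /vlineP[c ->] [_ /vlineP[d ->] wE]].
  move: we; rewrite wE !mE ee ge scaler0 addr0 => ->; rewrite add0r memvZ ?memv_line //.
have idem g : W g -> g != 0 -> g %* g = g -> listed.
  move=> Wg g0 gg.
  have [x Wx xg] : exists2 x, W x & x \notin <[g]>%VS.
    have [ug|] := boolP (u \in <[g]>%VS); last by exists u.
    exists v => //; apply/negP => /vlineP[d vE]; case/vlineP: ug => c uE.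
    have [|_ /eqP + /eqP] := B 0 d (- c).
      by rewrite uE vE; vring.
    by move=> /eqP d0 _; move: v0; rewrite vE d0 scale0r eqxx.
  have [w [j [Ww wg gw jE]]] := peirce_eigenvector gg WD WZ (fun y => WM g y Wg) Wx xg.
  have B1 := basW g w Wg g0 Ww wg.
  have B2 : is_basis g e w.
    by move=> p q r E; have [|-> -> ->] := B1 q p r; rewrite // [X in X + _]addrC.
  have eg := We g Wg; have ge : g %* e = 0 by rewrite mC.
  have ew := We w Ww; have we : w %* e = 0 by rewrite mC.
  case: jE => j0; rewrite j0 ?scale1r in gw.
  - have [a ww] : exists a, w %* w = a *: w.
      have eg0 : g %* e = 0 *: e by rewrite scale0r.
      have [p [q [r [wwE p0 _ _]]]] := eigen_coef gg B2 eg0 gw (peirce_mul gg gw gw half0).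
      have {p0}p0 : p = 0 by apply: p0; rewrite eq_sym oner_eq0.
      have := We _ (WM _ _ Ww Ww); rewrite wwE p0 scale0r add0r !mE ee ew scaler0 addr0 => /eqP.
      rewrite scaler_eq0 (negPf e0) orbF => /eqP ->.
      by exists r; rewrite scale0r add0r.
    rewrite scale0r in gw.
    have [a0|a0] := eqVneq a 0.
      rewrite a0 scale0r in ww.
      apply: (listed_check (P := [:: [:: 2; 0; 0]; [:: 0; 0; 0]; [:: 0; 0; 0];
                               [:: 0; 2; 0]; [:: 0; 0; 0]; [:: 0; 0; 0]]) B1).
      + by products_by (ee, eg, ew, gg, gw, ww).
      + exact: half_valued_idem.
      + exact: half_valued_idem.
      + exact: half_sqr0.
      by vm_cast_no_check (erefl true).
    have nza : a^-1 != 0 by rewrite invr_eq0.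
    have B' := basisZ (oner_neq0 K) (oner_neq0 K) nza B1; rewrite !scale1r in B'.
    have ww' : (a^-1 *: w) %* (a^-1 *: w) = a^-1 *: w by rewrite !mE ww; vfield.
    have ew' : e %* (a^-1 *: w) = 0 by rewrite mE ew scaler0.
    have gw' : g %* (a^-1 *: w) = 0 by rewrite mE gw scaler0.
    apply: (listed_check (P := [:: [:: 2; 0; 0]; [:: 0; 0; 0]; [:: 0; 0; 0];
                             [:: 0; 2; 0]; [:: 0; 0; 0]; [:: 0; 0; 2]]) B').
    + by products_by (ee, eg, ew', gg, gw', ww').
    + exact: half_valued_idem.
    + exact: half_valued_idem.
    + exact: half_valued_idem.
    by vm_cast_no_check (erefl true).
  - exact: (case_0_half B2 gg ge gw).
  exact: (case_0_1 B2 gg ge gw).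
have step x : W x -> listed \/ x %* x = 0.
  move=> Wx; have Wx2 := WM _ _ Wx Wx; have Wx3 := WM _ _ Wx Wx2.
  have [x4|x4] := eqVneq (x %* (x %* (x %* x))) 0; last first.
    have [a [b [c x4E]]] := power_relation x.
    have [p [q [r [g0 gg]]]] := idempotent_of_power x4E x4.
    by left; apply: (idem _ _ g0 gg); apply: (WD _ _ (WD _ _ _ _)); apply: (WZ).
  have [x20|x20] := eqVneq (x %* x) 0; [by right | left].
  have x0 : x != 0 by apply: contraNneq x20 => ->; rewrite m0l.
  have x2x : x %* x \notin <[x]>%VS.
    apply: contra x20 => /vlineP[c xx]; move: x4; rewrite xx !mE xx !mE xx => /eqP.
    by rewrite !scaler_eq0 (negPf x0) !orbF !orbb.
  have B' := basW x (x %* x) Wx x0 Wx2 x2x.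
  (* As [W] has dimension 2, [x^3 = q x + r x^2]; then [x^4 = 0] gives [r q = 0] and [q = -r^2], so
     both vanish. *)
  have x3 : x %* (x %* x) = 0.
    have [p [q [r x3E]]] := is_basis_span B' (x %* (x %* x)).
    have := We _ Wx3; rewrite x3E !(mE, ee, We x Wx, We _ Wx2) !scaler0 !addr0 => /eqP.
    rewrite scaler_eq0 (negPf e0) orbF => /eqP p0.
    rewrite p0 scale0r add0r in x3E.
    have := x4; rewrite x3E !mE x3E => E.
    have [|_ E1 E2] := B' 0 (r * q) (q + r ^+ 2).
      by rewrite -[RHS]E; vring.
    have q0 : q = - r ^+ 2 by apply: (eq_lin (k := 1) E2); ring.
    have r0 : r = 0.
      have /eqP : r ^+ 3 = 0 by apply: (eq_lin (k := -1) E1); rewrite q0; ring.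
      by rewrite expf_eq0 => /eqP.
    by rewrite p0 q0 r0 expr2 mul0r oppr0 !scale0r !addr0.
  have x22 : (x %* x) %* (x %* x) = 0 by rewrite sqr_sqr x3 m0r.
  have ex := We _ Wx; have exx := We _ Wx2.
  apply: (listed_check (P := [:: [:: 2; 0; 0]; [:: 0; 0; 0]; [:: 0; 0; 0];
                           [:: 0; 0; 2]; [:: 0; 0; 0]; [:: 0; 0; 0]]) B').
  - by products_by (ee, ex, exx, x3, x22).
  - exact: half_valued_idem.
  - by apply/half_valued0/form_nil; [apply: form_sqr0 | rewrite mC x3 l0].
  - exact: half_sqr0.
  by vm_cast_no_check (erefl true).
have [//|uu] := step _ Wu; have [//|vv] := step _ Wv; have [//|uvv] := step _ (WD _ _ Wu Wv).
have uv : u %* v = 0.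
  apply: (scalerI nz2); rewrite scaler0 -[RHS]uvv !mE uu vv [v %* u]mC; vring.
apply: (listed_check (P := [:: [:: 2; 0; 0]; [:: 0; 0; 0]; [:: 0; 0; 0];
                         [:: 0; 0; 0]; [:: 0; 0; 0]; [:: 0; 0; 0]]) B).
- by products_by (ee, eu, ev, uu, uv, vv).
- exact: half_valued_idem.
- exact: half_sqr0.
- exact: half_sqr0.
by vm_cast_no_check (erefl true).
Qed.

(** * Unital algebras *)

Lemma power_idempotent x : x %* (x %* (x %* x)) != 0 -> exists2 e, e != 0 & e %* e = e.
Proof.
move=> x4; have [a [b [c x4E]]] := power_relation x.
by have [p [q [r [e0 ee]]]] := idempotent_of_power x4E x4;
  exists (p *: x + q *: (x %* x) + r *: (x %* (x %* x))).
Qed.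

Section Unital.
Variable e : V.
Hypotheses (e0 : e != 0) (eunit : forall x, e %* x = x).
Let unite x : x %* e = x. Proof. by rewrite mC eunit. Qed.

Definition other_idempotent := exists g, [/\ g != 0, g != e & g %* g = g].

(** The complement [e - g] is a 0-eigenvector of [g], so one of the cases with an eigenvalue 0
    applies to [g]. *)
Lemma other_idempotent_listed : other_idempotent -> listed.
Proof.
case=> g [g0 ge gg]; have gh : g %* (e - g) = 0 by rewrite !mE unite gg subrr.
have hg : e - g \notin <[g]>%VS.
  apply/negP => /vlineP[c E]; move: gh; rewrite E mE gg => /eqP.
  rewrite scaler_eq0 (negPf g0) orbF => /eqP c0; move/eqP: E.
  by rewrite c0 scale0r subr_eq0 eq_sym (negPf ge).
have [x xP] := notin_plane g (e - g).
have [w [j [_ wP gw]]] := @peirce_eigenvector g gg (fun=> True) _ x (fun _ _ _ _ => I)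
  (fun _ _ _ => I) (fun _ _ => I) I xP.
have B := is_basisI g0 hg wP.
case=> j0; rewrite j0 ?scale0r ?scale1r in gw.
- exact: case_0_0 B gg gh gw.
- exact: case_0_half B gg gh gw.
exact: case_0_1 B gg gh gw.
Qed.

(** Completing the square gives [y^2 = d e]. For nonzero [d], the element [g] is an idempotent; if
    it is 0 or [e], then [y] and [x] are scalar. *)
Lemma unital_quadratic x p q : x %* x = p *: x + q *: e ->
  other_idempotent \/ exists r y, x = r *: e + y /\ y %* y = 0.
Proof.
move=> xx; pose y := x - (p / 2) *: e; pose d := q + p ^+ 2 / 4.
have yy : y %* y = d *: e by rewrite /y /d !(mE, xx, unite, eunit); vfield.
have xE : x = (p / 2) *: e + y by rewrite /y; vring.
clearbody y d.
have [d0|d0] := eqVneq d 0.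
  by right; exists (p / 2), y; rewrite yy d0 scale0r.
have s0 : sqrtC d != 0 by rewrite sqrtC_eq0.
have {}yy : y %* y = (sqrtC d * sqrtC d) *: e by rewrite yy -expr2 sqrtCK.
pose g := 2^-1 *: e + (2 * sqrtC d)^-1 *: y.
have gg : g %* g = g by rewrite /g !(mE, unite, eunit, yy); vfield.
have yE : y = (2 * sqrtC d) *: (g - 2^-1 *: e) by rewrite /g; vfield.
have [gz|gz] := eqVneq g 0.
  right; exists (p / 2 - sqrtC d), 0; rewrite m0l xE yE gz; split=> //; vfield.
have [ge|ge] := eqVneq g e.
  right; exists (p / 2 + sqrtC d), 0; rewrite m0l xE yE ge; split=> //; vfield.
by left; exists g.
Qed.

(** The analogue of a local algebra: if 0 and [e] are the only idempotents, every element is a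
    scalar plus a nilpotent. *)
Lemma unital_split y :
  other_idempotent \/ exists r x, y = r *: e + x /\ x %* (x %* x) = 0.
Proof.
have quadratic x r p q : y = r *: e + x -> x %* x = p *: x + q *: e ->
    other_idempotent \/ exists r x, y = r *: e + x /\ x %* (x %* x) = 0.
  move=> yE /unital_quadratic[|[r' [x' [xE x2]]]]; [by left | right].
  by exists (r + r'), x'; rewrite x2 m0r yE xE scalerDl addrA.
have [/vlineP[r ->]|ye] := boolP (y \in <[e]>%VS).
  by right; exists r, 0; rewrite addr0 m0l.
have [/memv_addP[_ /vlineP[q ->] [_ /vlineP[p ->] yy]]|yye] := boolP (y %* y \in (<[e]> + <[y]>)%VS).
  by apply: (quadratic y 0 p q); [rewrite scale0r add0r | rewrite yy addrC].
have [a [b [c y3]]] := is_basis_span (is_basisI e0 ye yye) (y %* (y %* y)).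
(* Subtracting a root of the cubic satisfied by [y] leaves an [x] whose cubic has no constant
   term. *)
have [r rE] : exists r, r ^+ 3 = a + b * r + c * r ^+ 2.
  have [r rE] := @solve_monicpoly K 3 (nth 0 [:: a; b; c]) isT.
  by exists r; rewrite rE !big_ord_recl big_ord0 /= expr0 expr1 mulr1 addr0 addrA.
pose x := y - r *: e; pose c' := c - 3 * r; pose b' := b + 2 * r * c - 3 * r ^+ 2.
have yE : y = r *: e + x by rewrite /x; vring.
have x3 : x %* (x %* x) = c' *: (x %* x) + b' *: x.
  have -> : x %* (x %* x) = y %* (y %* y) - (3 * r) *: (y %* y) + (3 * r ^+ 2) *: y - (r ^+ 3) *: e.
    by rewrite /x !(mE, unite, eunit); vring.
  by rewrite y3 rE /c' /b' /x !(mE, unite, eunit); vring.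
clearbody x b' c'.
have x4 : x %* (x %* (x %* x)) = c' *: (x %* (x %* x)) + b' *: (x %* x).
  by rewrite {1}x3 !mE.
have x22 := sqr_sqr x; rewrite x4 x3 in x22.
have xxx : x %* x %* x = c' *: (x %* x) + b' *: x by rewrite mC.
have [b0|b0] := eqVneq b' 0; last first.
  (* Solving the cubic relation for [x] gives [g x = x], so [g] is the unit of the algebra generated
     by [x]. If it equals [e], then [x] satisfies a quadratic equation. *)
  pose g := b'^-1 *: (x %* x) - (c' / b') *: x.
  have gx : g %* x = x by rewrite /g !(mE, xxx); vfield.
  have gg : g %* g = g by rewrite /g !(mE, x22, x3, xxx); vfield.
  have [gz|gz] := eqVneq g 0.
    by right; exists r, 0; rewrite m0l addr0 {1}yE -gx gz m0l addr0.
  have [ge|ge] := eqVneq g e; last by left; exists g.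
  apply: (quadratic x r c' b' yE); rewrite -ge /g; vfield.
rewrite b0 scale0r addr0 in x3 xxx; rewrite b0 !scale0r !addr0 in x22.
have [c0|c0] := eqVneq c' 0; first by right; exists r, x; rewrite x3 c0 scale0r.
pose g := (c'^-1 ^+ 2) *: (x %* x).
have gg : g %* g = g by rewrite /g !mE x22; vfield.
have [gz|gz] := eqVneq g 0.
  move/eqP: gz; rewrite scaler_eq0 expf_eq0 invr_eq0 (negPf c0) /= => /eqP xx.
  by right; exists r, x; rewrite xx m0r.
have [ge|ge] := eqVneq g e; last by left; exists g.
by apply: (quadratic x r 0 (c' ^+ 2) yE); rewrite -ge /g; vfield.
Qed.

Lemma unital_cube0_listed x : x %* (x %* x) = 0 -> x %* x != 0 -> listed.
Proof.
move=> x3 x2; have x22 : (x %* x) %* (x %* x) = 0 by rewrite sqr_sqr x3 m0r.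
have x3' : x %* x %* x = 0 by rewrite mC.
have B : is_basis e x (x %* x).
  move=> p q r E.
  have p0 : p = 0.
    have /eqP : p *: (x %* x) = 0.
      by rewrite -[RHS](m0r (x %* x)) -E !(mE, unite, x22, x3'); vring.
    by rewrite scaler_eq0 (negPf x2) orbF => /eqP.
  have q0 : q = 0.
    have /eqP : q *: (x %* x) = 0 by rewrite -[RHS](m0r x) -E p0 !(mE, unite, x3); vring.
    by rewrite scaler_eq0 (negPf x2) orbF => /eqP.
  split=> //; move: E; rewrite p0 q0 !scale0r !add0r => /eqP.
  by rewrite scaler_eq0 (negPf x2) orbF => /eqP.
apply: (listed_check (P := [:: [:: 2; 0; 0]; [:: 0; 2; 0]; [:: 0; 0; 2];
                         [:: 0; 0; 2]; [:: 0; 0; 0]; [:: 0; 0; 0]]) B).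
- by products_by (eunit, x22, x3).
- exact: half_valued_idem.
- by apply/half_valued0/form_nil; [apply: form_sqr0 | rewrite mC x3 l0].
- exact: half_sqr0.
by vm_cast_no_check (erefl true).
Qed.

Lemma unital_listed : listed.
Proof.
have [u0 ue] := notin_line e; have [v0 ve] := notin_plane e u0.
have [/other_idempotent_listed//|[r [u [uE u3]]]] := unital_split u0.
have [/other_idempotent_listed//|[s [v [vE v3]]]] := unital_split v0.
have B : is_basis e u v.
  apply: is_basisI => //.
    by apply: contra ue => uP; rewrite uE rpredD // memvZ ?memv_line.
  apply: contra ve => /memv_addP[_ /vlineP[c ->] [_ /vlineP[d ->] vP]].
  have -> : v0 = (s + c - d * r) *: e + d *: u0 by rewrite vE uE vP; vring.
  by rewrite memv_add // memvZ ?memv_line.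
have [uu|uu] := eqVneq (u %* u) 0; last exact: unital_cube0_listed u3 uu.
have [vv|vv] := eqVneq (v %* v) 0; last exact: unital_cube0_listed v3 vv.
have [/other_idempotent_listed//|[a [x [xE x3]]]] := unital_split (u + v).
have [xx|xx] := eqVneq (x %* x) 0; last exact: unital_cube0_listed x3 xx.
have uv : u %* v = a *: (u + v) - (a ^+ 2 / 2) *: e.
  have : (u + v - a *: e) %* (u + v - a *: e) = 0.
    by rewrite xE [a *: e + x]addrC addrK.
  rewrite !(mE, unite, eunit, uu, vv) [v %* u]mC => E.
  by apply: (scalerI nz2); apply/eqP; rewrite -subr_eq0; apply/eqP; rewrite -[RHS]E; vfield.
have vu : v %* u = a *: (u + v) - (a ^+ 2 / 2) *: e by rewrite mC.
(* Since the square of [u] is 0, [cube_mul] says that multiplication by [u] has cube 0; applied to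
   [v], this leaves the coefficient [2a^3] on [v]. *)
have a0 : a = 0.
  have := cube_mul u v; rewrite !(uu, uv, mE, unite) ?(uu, uv, mE, unite) => /eqP.
  rewrite -subr_eq0 => /eqP E.
  have [|_ _ /eqP] := B (- a ^+ 4) (a ^+ 3) (2 * a ^+ 3).
    by rewrite -[RHS]E; vfield.
  by rewrite mulf_eq0 (negPf nz2) expf_eq0 => /eqP.
rewrite a0 expr2 !mul0r !scale0r subr0 in uv.
apply: (listed_check (P := [:: [:: 2; 0; 0]; [:: 0; 2; 0]; [:: 0; 0; 2];
                         [:: 0; 0; 0]; [:: 0; 0; 0]; [:: 0; 0; 0]]) B).
- by products_by (eunit, uu, uv, vv).
- exact: half_valued_idem.
- exact: half_sqr0.
- exact: half_sqr0.
by vm_cast_no_check (erefl true).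
Qed.

End Unital.

Lemma idempotent_listed e : e != 0 -> e %* e = e -> listed.
Proof.
move=> e0 ee; have eigen (U : {vspace V}) (x : V) :=
  @peirce_eigenvector e ee (fun=> True) U x (fun _ _ _ _ => I) (fun _ _ _ => I) (fun _ _ => I) I.
have [x xe] := notin_line e; have [u [i [_ ue eu iE]]] := eigen _ _ xe.
have [y yu] := notin_plane e u; have [v [j [_ ve ev jE]]] := eigen _ _ yu.
have B := is_basisI e0 ue ve.
have B' : is_basis e v u.
  by move=> p q r E; have [|-> -> ->] := B p r q; rewrite // -addrA [X in _ + X]addrC addrA.
case: iE => i0; rewrite i0 ?scale0r ?scale1r in eu;
  case: jE => j0; rewrite j0 ?scale0r ?scale1r in ev.
- exact: case_0_0 B ee eu ev.
- exact: case_0_half B ee eu ev.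
- exact: case_0_1 B ee eu ev.
- exact: case_0_half B' ee ev eu.
- exact: case_half_half B ee eu ev.
- exact: case_half_1 B ee eu ev.
- exact: case_0_1 B' ee ev eu.
- exact: case_half_1 B' ee ev eu.
apply: (unital_listed e0) => z; have [p [q [r ->]]] := is_basis_span B z.
by rewrite !mE ee eu ev.
Qed.

(** * Algebras without idempotents *)

Section Nil.
Hypothesis nil : forall x, x %* (x %* (x %* x)) = 0.

Lemma nil_cube_listed x : x %* (x %* x) != 0 -> listed.
Proof.
set x2 := x %* x; set x3 := x %* x2 => nz3.
have x4 : x %* x3 = 0 by exact: nil.
have [x22 x23 x33] := power_algebra x; rewrite -/x2 -/x3 x4 ?m0r in x22 x23 x33.
have x11 : x %* x = x2 by []. have x12 : x %* x2 = x3 by [].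
have B : is_basis x x2 x3.
  move=> p q r E.
  have E1 : p *: x2 + q *: x3 = 0 by rewrite -[RHS](m0r x) -E !(mE, x11, x12, x4); vring.
  have E2 : p *: x3 = 0 by rewrite -[RHS](m0r x) -E1 !(mE, x12, x4); vring.
  move/eqP: E2; rewrite scaler_eq0 (negPf nz3) orbF => /eqP p0.
  move/eqP: E1; rewrite p0 scale0r add0r scaler_eq0 (negPf nz3) orbF => /eqP q0.
  move/eqP: E; rewrite p0 q0 !scale0r !add0r scaler_eq0 (negPf nz3) orbF => /eqP r0.
  by [].
apply: (listed_check (P := [:: [:: 0; 2; 0]; [:: 0; 0; 2]; [:: 0; 0; 0];
                         [:: 0; 0; 0]; [:: 0; 0; 0]; [:: 0; 0; 0]]) B).
- by products_by (x11, x12, x4, x22, x23, x33).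
- by apply/half_valued0/form_nil; rewrite x11 ?[x2 %* x]mC ?x12 form_sqr0.
- exact: half_sqr0.
- exact: half_sqr0.
by vm_cast_no_check (erefl true).
Qed.

Hypothesis nil3 : forall x, x %* (x %* x) = 0.

(** Polarization of [x^3 = 0]: in the difference of the cubes of [x + y] and [x - y], the terms of
    even degree in [y] cancel. *)
Lemma cube_linearized x y : (x %* x) %* y = - 2 *: (x %* (x %* y)).
Proof.
have E1 := nil3 (x + y); have E2 := nil3 (x - y); have yx : y %* x = x %* y by rewrite mC.
rewrite !mE !(nil3, yx) in E1; rewrite !mE !(nil3, yx) in E2.
apply: (scalerI nz2); apply/eqP; rewrite -subr_eq0; apply/eqP.
have {E1 E2}E := congr2 (fun v w => v - w) E1 E2.
by rewrite -[RHS]subr0 -[RHS]E [x %* x %* y]mC; vring.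
Qed.

(** Substituting [L_(x^2) = -2 L_x^2] in [cube_mul] gives [8 L_x^3 = 0]. *)
Lemma nil_mul3 x y : x %* (x %* (x %* y)) = 0.
Proof.
have := cube_mul x y; rewrite nil3 m0l add0r cube_linearized => E.
have nz8 : 8 != 0 :> K by rewrite pnatr_eq0.
apply: (scalerI nz8); rewrite scaler0; apply/eqP; move/eqP: E; rewrite -subr_eq0 => /eqP E.
by apply/eqP; rewrite -[RHS]E; vring.
Qed.

Lemma nil_sqr_listed x : x %* x != 0 -> listed.
Proof.
set x2 := x %* x => nz2x; have x11 : x %* x = x2 by [].
have x12 : x %* x2 = 0 by exact: nil3.
have x21 : x2 %* x = 0 by rewrite mC.
have x22 : x2 %* x2 = 0 by rewrite /x2 sqr_sqr nil3 m0r.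
have nzx : x != 0 by apply: contraNneq nz2x => x0; rewrite /x2 x0 m0l.
have x2x : x2 \notin <[x]>%VS.
  apply: contra nz2x => /vlineP[c E]; move/eqP: x12; rewrite E mE x11 E scalerA.
  by rewrite !scaler_eq0 mulf_eq0 orbb.
have [z0 z0P] := notin_plane x x2.
have B0 := is_basisI nzx x2x z0P.
have [a [b [c xz0]]] := is_basis_span B0 (x %* z0).
(* Modulo [x] and [x2], [c] is an eigenvalue of the nilpotent multiplication by [x]. *)
have c0 : c = 0.
  have := nil_mul3 x z0; rewrite !(xz0, mE, x11, x12) => E.
  have [|_ _ /eqP] := B0 (c ^+ 2 * a) (a * c + c ^+ 2 * b) (c ^+ 3).
    by rewrite -[RHS]E; vring.
  by rewrite expf_eq0 => /eqP.
rewrite c0 scale0r addr0 in xz0.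
pose z := z0 - b *: x.
have B : is_basis x x2 z.
  move=> p q r E; have [|p0 q0 r0] := B0 (p - r * b) q r.
    by rewrite -[RHS]E /z; vring.
  by split=> //; move: p0; rewrite r0 mul0r subr0.
have xz : x %* z = a *: x by rewrite /z !mE xz0 x11; vring.
clearbody z; have zx : z %* x = a *: x by rewrite mC.
have a0 : a = 0.
  have := nil_mul3 z x; rewrite !(zx, mE) !scalerA => /eqP.
  by rewrite scaler_eq0 (negPf nzx) orbF !mulf_eq0 !orbb => /eqP.
rewrite a0 scale0r in xz zx.
have x2z : x2 %* z = 0 by rewrite cube_linearized xz m0r scaler0.
have zx2 : z %* x2 = 0 by rewrite mC.
have [p [q [r zz]]] := is_basis_span B (z %* z).
have p0 : p = 0.
  have := cube_linearized z x; rewrite zx m0r scaler0 zz !(mE, x11, x21, zx) => E.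
  have /eqP : p *: x2 = 0 by rewrite -[RHS]E; vring.
  by rewrite scaler_eq0 (negPf nz2x) orbF => /eqP.
rewrite p0 scale0r add0r in zz.
have hx : half_valued x.
  by apply/half_valued0/form_nil; rewrite x11 ?x21 ?l0 // form_sqr0.
have [zz0|zz0] := eqVneq (z %* z) 0.
  apply: (listed_check (P := [:: [:: 0; 2; 0]; [:: 0; 0; 0]; [:: 0; 0; 0];
                           [:: 0; 0; 0]; [:: 0; 0; 0]; [:: 0; 0; 0]]) B).
  - by products_by (x11, x12, xz, x22, x2z, zz0).
  - by [].
  - exact: half_sqr0.
  - exact: half_sqr0.
  by vm_cast_no_check (erefl true).
have r0 : r = 0.
  have := nil3 z; rewrite {1}zz !mE zx2 scaler0 add0r => /eqP.
  by rewrite scaler_eq0 (negPf zz0) orbF => /eqP.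
rewrite r0 scale0r addr0 in zz.
have q0 : q != 0 by apply: contraNneq zz0 => q0; rewrite zz q0 scale0r.
(* The square of [x + s z] is [(1 + s^2 q) x2], so this [s] makes it zero and gives the basis of
   [T4]. *)
pose s := sqrtC (- q^-1).
have s0 : s != 0 by rewrite sqrtC_eq0 oppr_eq0 invr_eq0.
have ss : s * s = - q^-1 by rewrite -expr2 sqrtCK.
pose y := x + s *: z.
have B' : is_basis x x2 y.
  move=> p' q' r' E; have [|E1 E2 E3] := B (p' + r') q' (r' * s).
    by rewrite -[RHS]E /y; vring.
  move/eqP: E3; rewrite mulf_eq0 (negPf s0) orbF => /eqP r'0.
  by split=> //; rewrite r'0 addr0 in E1.
have xy : x %* y = x2 by rewrite /y !(mE, x11, xz) scaler0 addr0.
have x2y : x2 %* y = 0 by rewrite /y !(mE, x21, x2z) scaler0 addr0.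
have yy : y %* y = 0.
  rewrite /y !(mE, x11, xz, zx, zz).
  by transitivity ((1 + s * s * q) *: x2); [vring | rewrite ss mulNr mulVf // subrr scale0r].
apply: (listed_check (P := [:: [:: 0; 2; 0]; [:: 0; 0; 0]; [:: 0; 2; 0];
                         [:: 0; 0; 0]; [:: 0; 0; 0]; [:: 0; 0; 0]]) B').
- by products_by (x11, x12, xy, x22, x2y, yy).
- by [].
- exact: half_sqr0.
- exact: half_sqr0.
by vm_cast_no_check (erefl true).
Qed.

End Nil.

(** If all squares vanish, polarization kills the product and [form_sqr0] kills the form, which is
    the excluded zero algebra. *)
Lemma jordan_form_listed : ~ ((forall x y, x %* y = 0) /\ (forall x, l x = 0)) -> listed.
Proof.
move=> nz; have [[x x4]|nil] := boolp.EM (exists x, x %* (x %* (x %* x)) != 0).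
  by have [e e0 ee] := power_idempotent x4; apply: idempotent_listed e0 ee.
have {}nil x : x %* (x %* (x %* x)) = 0.
  by apply/eqP/negPn/negP => x4; apply: nil; exists x.
have [[x x3]|nil3] := boolp.EM (exists x, x %* (x %* x) != 0); first exact: nil_cube_listed x3.
have {}nil3 x : x %* (x %* x) = 0.
  by apply/eqP/negPn/negP => x3; apply: nil3; exists x.
have [[x x2]|nil2] := boolp.EM (exists x, x %* x != 0); first exact: nil_sqr_listed x2.
have {}nil2 x : x %* x = 0.
  by apply/eqP/negPn/negP => x2; apply: nil2; exists x.
case: nz; split=> [x y|x]; last exact: form_sqr0.
apply: (scalerI nz2); rewrite scaler0 -[RHS](nil2 (x + y)) !mE !nil2 [y %* x]mC; vring.
Qed.

End Classification.

Definition type31_check (r : Defs.row rat) : bool :=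
  let c := row_sconst r in
  all (fun i => all (fun j =>
    [&& c i j 3 == 0, c i 3 j == 0, c 3 i j == 0 & c 3 3 j == 0]) (iota 0 3)
    && (c 3 i 3 == c i 3 3)) (iota 0 3) && (c 3 3 3 == 0)%N.

Lemma type31_check_rows : all type31_check (rows rat).
Proof. by vm_cast_no_check (erefl true). Qed.

Lemma J_sconst_type31 (k : 'I_59) : let c := J_sconst k in
  c 3 3 3 = 0 /\ forall i j : 'I_3,
  [/\ c i j 3 = 0, c i 3 j = 0, c 3 i j = 0, c 3 3 j = 0 & c 3 i 3 = c i 3 3].
Proof.
have /all_tnthP/(_ k) := type31_check_rows; rewrite -/(J_row k) => /andP[/allP C /eqP C3].
split=> // i j; have I3 (s : 'I_3) : val s \in iota 0 3 by rewrite mem_iota ltn_ord.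
have /andP[/allP/(_ _ (I3 j))/and4P[/eqP ? /eqP ? /eqP ? /eqP ?] /eqP ?] := C _ (I3 i).
by [].
Qed.

(** * Classification *)

Section Type31.
Variables (K : numClosedFieldType) (A : superalgebra K).
Hypotheses (jA : jordan_superalgebra A) (tA : has_type A 3 1).

Local Notation V := (subvs_of (part A false)).
Let f : A := vpick (part A true).

Let f0 : f != 0.
Proof. by rewrite vpick0 -dimv_eq0 tA.2. Qed.

Let part1 : part A true = <[f]>%VS.
Proof.
by apply/eqP; rewrite eq_sym eqEdim -memvE memv_pick tA.2 dim_vline f0.
Qed.

Let m (x y : V) : V := vsproj (part A false) (vsval x ** vsval y).
Let l (x : V) : K := vector.coord [tuple f] ord0 (vsval x ** f).

Let mE x y : vsval (m x y) = vsval x ** vsval y.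
Proof. by rewrite vsprojK // (smul_part (i := false) (j := false)) ?subvsP. Qed.

Let fP : f \in part A true. Proof. exact: memv_pick. Qed.

Let lE x : vsval x ** f = l x *: f.
Proof.
have : vsval x ** f \in <<[tuple f]>>%VS.
  by rewrite span_seq1 -part1 (smul_part (i := false) (j := true)) ?subvsP.
by move/coord_span; rewrite big_ord1.
Qed.

Let f_inj a b : a *: f = b *: f -> a = b.
Proof.
by move/eqP; rewrite -subr_eq0 -scalerBl scaler_eq0 (negPf f0) orbF subr_eq0 => /eqP.
Qed.

Let lE' x : f ** vsval x = l x *: f.
Proof. by rewrite (jA.1 true false) ?subvsP // scale1r lE. Qed.

Let ff : f ** f = 0.
Proof.
have /eqP := jA.1 true true f f fP fP; rewrite expr1 scaleN1r -subr_eq0 opprK.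
by rewrite -mulr2n -scaler_nat scaler_eq0 pnatr_eq0 => /eqP.
Qed.

(** The identity for four even arguments gives [jfJ]; with the odd generator [f] as the last
    argument, all terms are multiples of [f], and their coefficients give [jfL]. *)
Lemma jordan_form31 : jordan_form m l.
Proof.
have P (x : V) : vsval x \in part A false := subvsP x.
split.
- by move=> x y; apply: val_inj; rewrite /= !mE (jA.1 false false) ?P // scale1r.
- by move=> x y z; rewrite /m /= smulDl linearD.
- by move=> a x y; rewrite /m /= smulZl linearZ.
- by move=> x y; rewrite /l /= smulDl linearD.
- by move=> a x; rewrite /l /= smulZl linearZ.
- move=> x y z t; apply: val_inj; rewrite -![\val _]/(vsval _) !linearD /= !mE.
  have := jA.2 false false false false _ _ _ _ (P x) (P y) (P z) (P t).
  by rewrite !scale1r.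
move=> x y z; apply: f_inj.
have := jA.2 false false false true _ _ _ _ (P x) (P y) (P z) fP.
rewrite !scale1r -!mE !(lE, lE', smulZl, smulZr) !scalerA -!scalerDl => E.
transitivity ((l (m (m x y) z) + l x * l z * l y + l y * l z * l x) *: f).
  by congr (_ *: _); ring.
by rewrite E; congr (_ *: _); ring.
Qed.

Lemma classification31 : ~ zero_product A -> exists k, isomorphic A (J K k).
Proof.
move=> nzA; have dimV : \dim {:V} = 3%N by rewrite dimvf /dim /= tA.1.
have [|k [b [bfree bM bl]]] := jordan_form_listed jordan_form31 dimV.
  case=> m0 l0; apply: nzA => x y.
  have [x0 [x1 [x0P x1P ->]]] := part_split x; have [y0 [y1 [y0P y1P ->]]] := part_split y.
  move: x1P y1P; rewrite part1 => /vlineP[c ->] /vlineP[d ->].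
  rewrite -(vsprojK x0P) -(vsprojK y0P) !(smulDl, smulDr, smulZl, smulZr) -mE lE lE' ff m0 !l0.
  by rewrite linear0 !scale0r !scaler0 !addr0.
exists k; rewrite JE.
have [c33 cE] := J_sconst_type31 k.
pose b' (i : 'I_(3 + 1)) : A := match split i with inl i => vsval (b i) | inr _ => f end.
have b'l i : b' (lshift 1 i) = vsval (b i) by rewrite /b' (unsplitK (inl i)).
have b'r i : b' (rshift 3 i) = f by rewrite /b' (unsplitK (inr i)).
have hi := J_half_integral K k.
apply: (@isomorphic_table K (J_table K k) A b').
- rewrite -part_full.
  by have /directvP/= -> := part_direct A; rewrite tA.1 tA.2.
- move=> i; case: (split_ordP i) => j ->; rewrite ?b'l ?b'r.
    by rewrite /odd_index /= leqNgt ltn_ord subvsP.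
  by rewrite /odd_index /= leq_addr.
- move=> c; rewrite big_split_ord /= big_ord1 b'r.
  under eq_bigr do rewrite b'l.
  move=> E.
  have c1 : c (rshift 3 ord0) *: f = 0.
    apply: (@part_cap K A true); first by rewrite memvZ.
    move/eqP: E; rewrite addrC addr_eq0 => /eqP ->; rewrite memvN.
    by apply: memv_suml => i _; rewrite memvZ ?subvsP.
  move=> i; case: (split_ordP i) => j ->.
    apply: (bfree (fun i => c (lshift 1 i))).
    apply: val_inj; rewrite -![\val _]/(vsval _) linear_sum linear0 -[RHS]E c1 addr0.
    by apply: eq_bigr => s _; rewrite linearZ.
  by move/eqP: c1; rewrite scaler_eq0 (negPf f0) orbF (ord1 j) => /eqP.
move=> i j; rewrite big_split_ord /= big_ord1 b'r.
under eq_bigr do rewrite b'l.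
case: (split_ordP i) => i' ->; case: (split_ordP j) => j' ->; rewrite ?b'l ?b'r.
- have [ci _ _ _ _] := cE i' j'.
  rewrite -mE bM linear_sum /= hi /= ci mul0r scale0r addr0.
  by apply: eq_bigr => s _; rewrite hi.
- rewrite lE bl hi /= big1 ?add0r (ord1 j') // => s _.
  by have [_ ci _ _ _] := cE i' s; rewrite hi /= ci mul0r scale0r.
- rewrite lE' bl hi /= big1 ?add0r (ord1 i') => [|s _].
    by have [_ _ _ _ <-] := cE j' j'.
  by have [_ _ ci _ _] := cE j' s; rewrite hi /= ci mul0r scale0r.
rewrite ff hi (ord1 i') (ord1 j') /= c33 mul0r scale0r addr0 big1 // => s _.
by have [_ _ _ ci _] := cE ord0 s; rewrite hi /= ci mul0r scale0r.
Qed.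

End Type31.

Theorem theorem12 (R : realType) :
  (forall k : 'I_59,
     [/\ jordan_superalgebra (J R[i] k), has_type (J R[i] k) 3 1
       & ~ zero_product (J R[i] k)])
  /\ (forall k l : 'I_59, isomorphic (J R[i] k) (J R[i] l) -> k = l)
  /\ (forall A : superalgebra R[i],
        jordan_superalgebra A -> has_type A 3 1 -> ~ zero_product A ->
        exists k : 'I_59, isomorphic A (J R[i] k))
  /\ (forall k : 'I_59, has_orbit_dim (J R[i] k) (J_orbit_dim R[i] k))
  /\ (forall s : summand, indecomposable (summand_alg R[i] s))
  /\ (forall k : 'I_59,
        match J_summands R[i] k with
        | Some s => isomorphic (J R[i] k) (dsums R[i] s)
        | None => indecomposable (J R[i] k)
        end).
Proof.
split; first by move=> k; split; [apply: J_jordan | apply: J_has_type | apply: J_nonzero].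
split; first exact: J_inj.
split; first by move=> A jA tA; apply: classification31.
split; first exact: J_has_orbit_dim.
split; first exact: summand_indecomposable.
move=> k; rewrite J_summandsE; case Ds: (summands (J_row k)) => [s|].
  exact: J_decomposition.
exact: J_indecomposable.
Qed.
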